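(* For every $1<p<2$ there is a constant $C_p$ such that for all sufficiently large $d$ there exist quantum channels $\mathcal N_1,\mathcal N_2$, each with output dimension $d$, satisfying $$H_p^{\min}(\mathcal N_1)\ge \ln d-2,\qquad H_p^{\min}(\mathcal N_2)\ge \ln d-2,\qquad H_p^{\min}(\mathcal N_1\otimes\mathcal N_2)\le p\ln d + C_p .$$ Consequently $H_p^{\min}(\mathcal N_1)+H_p^{\min}(\mathcal N_2)-H_p^{\min}(\mathcal N_1\otimes\mathcal N_2)\ge (2-p)\ln d - C_p-4>0$ for large $d$, so additivity of the minimum output Rényi entropy of order $p$ fails, and equivalently the maximal $p$-norm is not multiplicative: $\nu_p(\mathcal N_1\otimes\mathcal N_2)>\nu_p(\mathcal N_1)\nu_p(\mathcal N_2)$.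
   Context: A quantum channel is a completely positive trace-preserving linear map between matrix algebras of finite-dimensional Hilbert spaces. For a density operator $\rho$ and $p>0$, $p\ne1$, $H_p(\rho)=\frac{1}{1-p}\ln\operatorname{Tr}\rho^p$. For a channel $\mathcal N$, $H_p^{\min}(\mathcal N)=\min_{|\varphi\rangle}H_p(\mathcal N(|\varphi\rangle\langle\varphi|))$, the minimum over unit input vectors. The maximal $p$-norm is $\nu_p(\mathcal N)=\sup\{\|\mathcal N(\rho)\|_p:\rho\ge0,\operatorname{Tr}\rho=1\}$ with $\|\sigma\|_p=(\operatorname{Tr}|\sigma|^p)^{1/p}$; one has $H_p^{\min}(\mathcal N)=\frac{p}{1-p}\ln\nu_p(\mathcal N)$. *)

(* Defs.v *)
From Stdlib Require Import Reals ClassicalEpsilon.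
Open Scope R_scope.

Definition C : Type := (R * R)%type.
Definition C0 : C := (0, 0).
Definition C1 : C := (1, 0).
Definition RtoC (x : R) : C := (x, 0).
Definition Cadd (a b : C) : C := (fst a + fst b, snd a + snd b).
Definition Cmul (a b : C) : C :=
  (fst a * fst b - snd a * snd b, fst a * snd b + snd a * fst b).
Definition Cconj (a : C) : C := (fst a, - snd a).
Definition Cnorm2 (a : C) : R := fst a * fst a + snd a * snd a.

Fixpoint csum (n : nat) (f : nat -> C) : C :=
  match n with O => C0 | S k => Cadd (csum k f) (f k) end.
Fixpoint rsum (n : nat) (f : nat -> R) : R :=
  match n with O => 0 | S k => rsum k f + f k end.

(** * Matrices: an n x n matrix is a function on indices, only entries with
    indices < n are meaningful. *)
Definition Mat : Type := nat -> nat -> C.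
Definition Vec : Type := nat -> C.

Definition agree (n : nat) (A B : Mat) : Prop :=
  forall i j, (i < n)%nat -> (j < n)%nat -> A i j = B i j.

Definition madd (A B : Mat) : Mat := fun i j => Cadd (A i j) (B i j).
Definition mscale (a : C) (A : Mat) : Mat := fun i j => Cmul a (A i j).
Definition mmul (n : nat) (A B : Mat) : Mat :=
  fun i j => csum n (fun k => Cmul (A i k) (B k j)).
Definition adj (A : Mat) : Mat := fun i j => Cconj (A j i).
Definition idm : Mat := fun i j => if Nat.eqb i j then C1 else C0.
Definition trace (n : nat) (A : Mat) : C := csum n (fun i => A i i).

Definition munit (a b : nat) : Mat :=
  fun i j => if andb (Nat.eqb i a) (Nat.eqb j b) then C1 else C0.

Definition kron (m2 : nat) (A B : Mat) : Mat :=
  fun r s => Cmul (A (r / m2) (s / m2))%nat (B (r mod m2) (s mod m2))%nat.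

Definition hermitian (n : nat) (A : Mat) : Prop := agree n A (adj A).

Definition quad (n : nat) (A : Mat) (v : Vec) : C :=
  csum n (fun i => csum n (fun j => Cmul (Cconj (v i)) (Cmul (A i j) (v j)))).

Definition psd (n : nat) (A : Mat) : Prop :=
  hermitian n A /\ forall v : Vec, 0 <= fst (quad n A v).

Definition density (n : nat) (rho : Mat) : Prop := psd n rho /\ trace n rho = C1.

Definition unit_vec (n : nat) (v : Vec) : Prop := rsum n (fun i => Cnorm2 (v i)) = 1.

Definition pure (v : Vec) : Mat := fun i j => Cmul (v i) (Cconj (v j)).

Definition unitary (n : nat) (U : Mat) : Prop := agree n (mmul n (adj U) U) idm.

Definition Map : Type := Mat -> Mat.

Definition linear_map (n m : nat) (N : Map) : Prop :=
  (forall X Y, agree n X Y -> agree m (N X) (N Y)) /\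
  (forall (a : C) X Y, agree m (N (madd X (mscale a Y))) (madd (N X) (mscale a (N Y)))).

Definition trace_preserving (n m : nat) (N : Map) : Prop :=
  forall X, trace m (N X) = trace n X.

(** id_k (x) N acting on M_k (x) M_n = M_(k*n) (block form) *)
Definition ampliate (k n m : nat) (N : Map) : Map :=
  fun X r s =>
    N (fun i j => X (r / m * n + i)%nat (s / m * n + j)%nat) (r mod m)%nat (s mod m)%nat.

Definition completely_positive (n m : nat) (N : Map) : Prop :=
  forall (k : nat) (X : Mat), psd (k * n) X -> psd (k * m) (ampliate k n m N X).

Definition is_channel (n m : nat) (N : Map) : Prop :=
  linear_map n m N /\ completely_positive n m N /\ trace_preserving n m N.

(** Tensor product of channels N1 : M_n1 -> M_m1, N2 : M_n2 -> M_m2,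
    defined by linearity on matrix units: (N1 (x) N2)(E_ab (x) E_ce) = N1 E_ab (x) N2 E_ce. *)
Definition chan_tensor (n1 m1 n2 m2 : nat) (N1 N2 : Map) : Map :=
  fun X r s =>
    csum n1 (fun a => csum n1 (fun b => csum n2 (fun c => csum n2 (fun e =>
      Cmul (X (a * n2 + c)%nat (b * n2 + e)%nat)
           (kron m2 (N1 (munit a b)) (N2 (munit c e)) r s))))).

Definition spectral (n : nat) (rho : Mat) (lam : nat -> R) : Prop :=
  exists U : Mat, unitary n U /\
    agree n rho (fun i j => csum n (fun k => Cmul (U i k) (Cmul (RtoC (lam k)) (Cconj (U j k))))).

Definition eigvals (n : nat) (rho : Mat) : nat -> R :=
  epsilon (inhabits (fun _ : nat => 0)) (fun lam => spectral n rho lam).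

Definition rpow (x p : R) : R := if Rlt_dec 0 x then Rpower x p else 0.

Definition trpow (n : nat) (p : R) (rho : Mat) : R :=
  rsum n (fun k => rpow (eigvals n rho k) p).

Definition trabspow (n : nat) (p : R) (sigma : Mat) : R :=
  rsum n (fun k => rpow (Rabs (eigvals n sigma k)) p).

Definition renyi (n : nat) (p : R) (rho : Mat) : R := / (1 - p) * ln (trpow n p rho).

Definition schatten (n : nat) (p : R) (sigma : Mat) : R := Rpower (trabspow n p sigma) (/ p).

Definition is_Hmin (n m : nat) (N : Map) (p h : R) : Prop :=
  (exists v : Vec, unit_vec n v /\ renyi m p (N (pure v)) = h) /\
  (forall v : Vec, unit_vec n v -> h <= renyi m p (N (pure v))).

Definition is_nu (n m : nat) (N : Map) (p nu : R) : Prop :=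
  is_lub (fun x => exists rho : Mat, density n rho /\ x = schatten m p (N rho)) nu.

(* Main.v *)
From Stdlib Require Import Reals Lra Lia List Permutation ZArith ClassicalEpsilon.
Require Import Defs.
Open Scope R_scope.

(** With [r] about [d ^ (2 - p)] and [k] very large, take [k] real [d x (r k)] matrices [A_i] with entries [+s] or
    [-s], where [s ^ 2] is a small constant times [1 / (k d)], and let both channels be
    [N X = sum_i A_i X A_i^T + (1 / d) Tr((1 - sum_i A_i^T A_i) X) 1].  A union bound over lattice points shows that
    for some choice of signs no output state has weight more than [r / (2 d)] from the random part on any [r]
    orthonormal vectors.  Off fewer than [r] eigenvectors all eigenvalues are then at most [2 / d], and the
    exceptional eigenvalues sum to at most [2 r / d], which is about [d ^ (1 - p)]; since [p (1 - p) < 1 - p], their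
    contribution to the trace power is negligible against [d ^ (1 - p)].  On the other hand the product channel maps
    the maximally entangled state to a state whose overlap with the maximally entangled state is at least a constant
    times [r / d], because the diagonal terms [(Tr A_i A_i^T) ^ 2] of the overlap add up. *)

(** The input dimension is [n = r k]. The random tensor is tested against a [d x r] contraction, a
    vector of length [r k] and an input vector of length [n]. Lattice points for the two vectors
    cost a factor [exp (O(n))]; those for the contraction cost [(8 d + 1) ^ (d r)], which is at most
    [exp n] once [k >= d ln (8 d + 1)]. This is why [k] is large, and it brings the supremum of the
    trilinear form down to order [sqrt n]. Demanding weight [r / (2 d)] then fixes [s ^ 2] as a
    constant over [k d], so the [k] diagonal overlap terms, each [n d s ^ 4], add up to a constant
    times [r / d]. With [r] near [d ^ (2 - p)] this is of order [d ^ (1 - p)], and its [p]-th power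
    bounds the trace power of the product output from below, whence [p ln d + C_p]. The weight bound
    has to hold for all orthonormal families at once, because the eigenvectors of an output state
    depend on the input. The natural partner of a channel in such an overlap is its complex
    conjugate; real [A_i] make the two random parts coincide, so one channel serves twice. *)

(** * Finite sums *)

Lemma rsum_ext n f g : (forall i, (i < n)%nat -> f i = g i) -> rsum n f = rsum n g.
Proof.
  induction n as [|n IH]; intros H; simpl; [reflexivity|].
  rewrite IH, (H n); auto.
Qed.

Lemma rsum_plus n f g : rsum n (fun i => f i + g i) = rsum n f + rsum n g.
Proof. induction n as [|n IH]; simpl; [|rewrite IH]; ring. Qed.

Lemma rsum_minus n f g : rsum n (fun i => f i - g i) = rsum n f - rsum n g.
Proof. induction n as [|n IH]; simpl; [|rewrite IH]; ring. Qed.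

Lemma rsum_scal n a f : rsum n (fun i => a * f i) = a * rsum n f.
Proof. induction n as [|n IH]; simpl; [|rewrite IH]; ring. Qed.

Lemma rsum_scal_r n a f : rsum n (fun i => f i * a) = rsum n f * a.
Proof. induction n as [|n IH]; simpl; [|rewrite IH]; ring. Qed.

Lemma rsum_const n a : rsum n (fun _ => a) = INR n * a.
Proof. induction n as [|n IH]; [simpl; ring|]. rewrite S_INR; simpl rsum; rewrite IH; ring. Qed.

Lemma rsum_zero n f : (forall i, (i < n)%nat -> f i = 0) -> rsum n f = 0.
Proof. intros H; rewrite (rsum_ext n f (fun _ => 0) H), rsum_const; ring. Qed.

Lemma rsum_le n f g : (forall i, (i < n)%nat -> f i <= g i) -> rsum n f <= rsum n g.
Proof.
  induction n as [|n IH]; intros H; simpl; [lra|].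
  apply Rplus_le_compat; auto.
Qed.

Lemma rsum_nonneg n f : (forall i, (i < n)%nat -> 0 <= f i) -> 0 <= rsum n f.
Proof.
  intros H; rewrite <- (rsum_zero n (fun _ => 0)) by reflexivity; apply rsum_le; auto.
Qed.

Lemma rsum_term_le n f j :
  (forall i, (i < n)%nat -> 0 <= f i) -> (j < n)%nat -> f j <= rsum n f.
Proof.
  induction n as [|n IH]; intros H Hj; [lia|]; simpl.
  assert (0 <= rsum n f) by (apply rsum_nonneg; auto).
  destruct (Nat.eq_dec j n) as [->|Hne]; [lra|].
  assert (f j <= rsum n f) by (apply IH; [auto|lia]).
  assert (0 <= f n) by auto; lra.
Qed.

Lemma rsum_exchange n m (f : nat -> nat -> R) :
  rsum n (fun i => rsum m (fun j => f i j)) = rsum m (fun j => rsum n (fun i => f i j)).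
Proof.
  induction n as [|n IH]; simpl.
  - rewrite rsum_zero; auto.
  - rewrite IH, rsum_plus; reflexivity.
Qed.

Lemma rsum_delta n j (f : nat -> R) :
  (j < n)%nat -> rsum n (fun i => if Nat.eqb i j then f i else 0) = f j.
Proof.
  induction n as [|n IH]; intros Hj; [lia|]; simpl.
  destruct (Nat.eq_dec n j) as [->|Hne].
  - rewrite Nat.eqb_refl, rsum_zero; [ring|].
    intros i Hi; destruct (Nat.eqb_spec i j); [lia|reflexivity].
  - rewrite IH by lia; destruct (Nat.eqb_spec n j); [lia|ring].
Qed.

Lemma rsum_app n m f : rsum (n + m) f = rsum n f + rsum m (fun i => f (n + i)%nat).
Proof.
  induction m as [|m IH]; simpl.
  - rewrite Nat.add_0_r; ring.
  - rewrite Nat.add_succ_r; simpl; rewrite IH; ring.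
Qed.

Lemma rsum_flatten n m f :
  rsum (n * m) f = rsum n (fun i => rsum m (fun j => f (i * m + j)%nat)).
Proof.
  induction n as [|n IH]; simpl; [reflexivity|].
  rewrite Nat.add_comm, rsum_app, IH; reflexivity.
Qed.

Lemma rsum_cauchy_schwarz n f g :
  (rsum n (fun i => f i * g i)) ^ 2 <= rsum n (fun i => f i ^ 2) * rsum n (fun i => g i ^ 2).
Proof.
  set (a := rsum n (fun i => f i ^ 2)); set (b := rsum n (fun i => g i ^ 2)).
  set (m := rsum n (fun i => f i * g i)).
  assert (Ha : 0 <= a) by (apply rsum_nonneg; intros; apply pow2_ge_0).
  assert (Hb : 0 <= b) by (apply rsum_nonneg; intros; apply pow2_ge_0).
  assert (Q : forall x y, 0 <= x * x * a - 2 * x * y * m + y * y * b).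
  { intros x y; unfold a, b, m.
    rewrite <- !rsum_scal, <- rsum_minus, <- rsum_plus.
    apply rsum_nonneg; intros i _.
    replace (_ + _) with ((x * f i - y * g i) ^ 2) by ring; apply pow2_ge_0. }
  destruct (Req_dec b 0) as [Hb0|Hb0].
  - specialize (Q 1); rewrite Hb0 in *.
    assert (m = 0) as ->; [|nra].
    destruct (Req_dec m 0) as [?|Hm]; [assumption|].
    (* With [b = 0] the form is affine in the second variable, and this value makes it [- a - 2],
       which is negative. *)
    specialize (Q ((a + 1) / m)).
    replace (1 * 1 * a - 2 * 1 * ((a + 1) / m) * m + (a + 1) / m * ((a + 1) / m) * 0)
      with (- a - 2) in Q by (field; assumption). lra.
  - specialize (Q b m). assert (0 < b) by lra.
    assert (0 <= b * (a * b - m * m)) by lra.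
    assert (0 <= a * b - m * m) by nra. nra.
Qed.

(** * Complex numbers *)

Definition Copp (a : C) : C := (- fst a, - snd a).
Definition Csub (a b : C) : C := Cadd a (Copp b).

Lemma C_ext (a b : C) : fst a = fst b -> snd a = snd b -> a = b.
Proof. destruct a, b; simpl; congruence. Qed.

Lemma C_ring : ring_theory C0 C1 Cadd Cmul Csub Copp eq.
Proof.
  constructor; intros; apply C_ext; unfold Csub, Cadd, Cmul, Copp, C0, C1; simpl; ring.
Qed.
Add Ring C_ring : C_ring.

Ltac Cext := apply C_ext; unfold Csub, Copp, Cadd, Cmul, Cconj, RtoC, Cnorm2, C0, C1; simpl.

Lemma Cconj_add a b : Cconj (Cadd a b) = Cadd (Cconj a) (Cconj b).
Proof. Cext; ring. Qed.
Lemma Cconj_mul a b : Cconj (Cmul a b) = Cmul (Cconj a) (Cconj b).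
Proof. Cext; ring. Qed.
Lemma Cconj_conj a : Cconj (Cconj a) = a.
Proof. Cext; ring. Qed.
Lemma Cconj_RtoC x : Cconj (RtoC x) = RtoC x.
Proof. Cext; ring. Qed.
Lemma Cconj_0 : Cconj C0 = C0.
Proof. Cext; ring. Qed.
Lemma Cconj_1 : Cconj C1 = C1.
Proof. Cext; ring. Qed.
Lemma Cconj_opp a : Cconj (Copp a) = Copp (Cconj a).
Proof. Cext; ring. Qed.
Lemma RtoC_mul x y : RtoC (x * y) = Cmul (RtoC x) (RtoC y).
Proof. Cext; ring. Qed.
Lemma RtoC_add x y : RtoC (x + y) = Cadd (RtoC x) (RtoC y).
Proof. Cext; ring. Qed.
Lemma Cmul_conj_l a : Cmul (Cconj a) a = RtoC (Cnorm2 a).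
Proof. Cext; ring. Qed.
Lemma Cmul_conj_r a : Cmul a (Cconj a) = RtoC (Cnorm2 a).
Proof. Cext; ring. Qed.
Lemma Cnorm2_mul a b : Cnorm2 (Cmul a b) = Cnorm2 a * Cnorm2 b.
Proof. unfold Cnorm2, Cmul; simpl; ring. Qed.
Lemma Cnorm2_conj a : Cnorm2 (Cconj a) = Cnorm2 a.
Proof. unfold Cnorm2, Cconj; simpl; ring. Qed.
Lemma Cnorm2_RtoC x : Cnorm2 (RtoC x) = x * x.
Proof. unfold Cnorm2, RtoC; simpl; ring. Qed.
Lemma Cnorm2_nonneg a : 0 <= Cnorm2 a.
Proof. unfold Cnorm2; nra. Qed.
Lemma Cnorm2_eq0 a : Cnorm2 a = 0 -> a = C0.
Proof. unfold Cnorm2; intros H; apply C_ext; simpl; nra. Qed.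

Lemma csum_fst n f : fst (csum n f) = rsum n (fun i => fst (f i)).
Proof. induction n as [|n IH]; simpl; [|rewrite <- IH]; reflexivity. Qed.
Lemma csum_snd n f : snd (csum n f) = rsum n (fun i => snd (f i)).
Proof. induction n as [|n IH]; simpl; [|rewrite <- IH]; reflexivity. Qed.

Lemma csum_ext n f g : (forall i, (i < n)%nat -> f i = g i) -> csum n f = csum n g.
Proof.
  induction n as [|n IH]; intros H; simpl; [reflexivity|].
  rewrite IH, (H n); auto.
Qed.

Lemma csum_add n f g : csum n (fun i => Cadd (f i) (g i)) = Cadd (csum n f) (csum n g).
Proof. induction n as [|n IH]; simpl; [|rewrite IH]; ring. Qed.

Lemma csum_mul_l n a f : csum n (fun i => Cmul a (f i)) = Cmul a (csum n f).
Proof. induction n as [|n IH]; simpl; [|rewrite IH]; ring. Qed.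

Lemma csum_mul_r n a f : csum n (fun i => Cmul (f i) a) = Cmul (csum n f) a.
Proof. induction n as [|n IH]; simpl; [|rewrite IH]; ring. Qed.

Lemma csum_conj n f : Cconj (csum n f) = csum n (fun i => Cconj (f i)).
Proof.
  induction n as [|n IH]; simpl; [apply Cconj_0|]. rewrite Cconj_add, IH; reflexivity.
Qed.

Lemma csum_RtoC n f : csum n (fun i => RtoC (f i)) = RtoC (rsum n f).
Proof. induction n as [|n IH]; simpl; [reflexivity|]. rewrite IH, RtoC_add; reflexivity. Qed.

Lemma csum_zero n f : (forall i, (i < n)%nat -> f i = C0) -> csum n f = C0.
Proof.
  intros H; rewrite (csum_ext n f (fun _ => C0) H); clear.
  induction n as [|n IH]; simpl; [|rewrite IH]; ring.
Qed.

Lemma csum_exchange n m (f : nat -> nat -> C) :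
  csum n (fun i => csum m (fun j => f i j)) = csum m (fun j => csum n (fun i => f i j)).
Proof.
  induction n as [|n IH]; simpl.
  - rewrite csum_zero; auto.
  - rewrite IH, csum_add; reflexivity.
Qed.

Lemma csum_delta n j (f : nat -> C) :
  (j < n)%nat -> csum n (fun i => if Nat.eqb i j then f i else C0) = f j.
Proof.
  induction n as [|n IH]; intros Hj; [lia|]; simpl.
  destruct (Nat.eq_dec n j) as [->|Hne].
  - rewrite Nat.eqb_refl, csum_zero; [ring|].
    intros i Hi; destruct (Nat.eqb_spec i j); [lia|reflexivity].
  - rewrite IH by lia; destruct (Nat.eqb_spec n j); [lia|ring].
Qed.

Lemma csum_app n m f : csum (n + m) f = Cadd (csum n f) (csum m (fun i => f (n + i)%nat)).
Proof.
  induction m as [|m IH]; simpl.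
  - rewrite Nat.add_0_r; ring.
  - rewrite Nat.add_succ_r; simpl; rewrite IH; ring.
Qed.

Lemma csum_flatten n m f :
  csum (n * m) f = csum n (fun i => csum m (fun j => f (i * m + j)%nat)).
Proof.
  induction n as [|n IH]; simpl; [reflexivity|].
  rewrite Nat.add_comm, csum_app, IH; reflexivity.
Qed.

Lemma csum_prod n m (f g : nat -> C) :
  csum n (fun i => csum m (fun j => Cmul (f i) (g j))) = Cmul (csum n f) (csum m g).
Proof.
  rewrite <- csum_mul_r; apply csum_ext; intros i _; apply csum_mul_l.
Qed.

Lemma divmod_add (m i j : nat) : (j < m)%nat ->
  ((i * m + j) / m)%nat = i /\ ((i * m + j) mod m)%nat = j.
Proof.
  intros H; rewrite Nat.add_comm, Nat.div_add, Nat.Div0.mod_add by lia.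
  rewrite Nat.div_small, Nat.mod_small; auto.
Qed.

Lemma div_mod_lt (n m i : nat) :
  (i < n * m)%nat -> ((i / m < n)%nat /\ (i mod m < m)%nat) /\ (i = i / m * m + i mod m)%nat.
Proof.
  intros H; assert (m <> 0)%nat by (intros ->; lia); repeat split.
  - apply Nat.Div0.div_lt_upper_bound; lia.
  - apply Nat.mod_upper_bound; assumption.
  - rewrite Nat.mul_comm; apply Nat.div_mod_eq.
Qed.

(** * Inner products and quadratic forms *)

Definition inner (n : nat) (u v : Vec) : C := csum n (fun i => Cmul (Cconj (u i)) (v i)).
Definition norm2 (n : nat) (v : Vec) : R := rsum n (fun i => Cnorm2 (v i)).
Definition col (U : Mat) (k : nat) : Vec := fun i => U i k.

Lemma inner_conj n u v : Cconj (inner n u v) = inner n v u.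
Proof.
  unfold inner; rewrite csum_conj; apply csum_ext; intros.
  rewrite Cconj_mul, Cconj_conj; ring.
Qed.

Lemma inner_self n u : inner n u u = RtoC (norm2 n u).
Proof.
  unfold inner, norm2; rewrite <- csum_RtoC; apply csum_ext; intros; apply Cmul_conj_l.
Qed.

Lemma inner_ext n u v u' v' :
  (forall i, (i < n)%nat -> u i = u' i) -> (forall i, (i < n)%nat -> v i = v' i) ->
  inner n u v = inner n u' v'.
Proof. intros H H'; apply csum_ext; intros; rewrite H, H'; auto. Qed.

Lemma inner_add_r n u v w : inner n u (fun i => Cadd (v i) (w i)) = Cadd (inner n u v) (inner n u w).
Proof. unfold inner; rewrite <- csum_add; apply csum_ext; intros; ring. Qed.

Lemma inner_scal_r n u a v : inner n u (fun i => Cmul a (v i)) = Cmul a (inner n u v).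
Proof. unfold inner; rewrite <- csum_mul_l; apply csum_ext; intros; ring. Qed.

Lemma inner_add_l n u v w : inner n (fun i => Cadd (v i) (w i)) u = Cadd (inner n v u) (inner n w u).
Proof. unfold inner; rewrite <- csum_add; apply csum_ext; intros; rewrite Cconj_add; ring. Qed.

Lemma inner_scal_l n u a v : inner n (fun i => Cmul a (v i)) u = Cmul (Cconj a) (inner n v u).
Proof. unfold inner; rewrite <- csum_mul_l; apply csum_ext; intros; rewrite Cconj_mul; ring. Qed.

Lemma inner_csum_r n m u (v : nat -> Vec) :
  inner n u (fun i => csum m (fun k => v k i)) = csum m (fun k => inner n u (v k)).
Proof.
  unfold inner; rewrite csum_exchange; apply csum_ext; intros; rewrite csum_mul_l; reflexivity.
Qed.

Lemma inner_csum_l n m u (v : nat -> Vec) :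
  inner n (fun i => csum m (fun k => v k i)) u = csum m (fun k => inner n (v k) u).
Proof.
  rewrite <- inner_conj, inner_csum_r, csum_conj; apply csum_ext; intros; apply inner_conj.
Qed.

Lemma norm2_nonneg n u : 0 <= norm2 n u.
Proof. apply rsum_nonneg; intros; apply Cnorm2_nonneg. Qed.

Lemma quad_inner n A v : quad n A v = inner n v (fun i => csum n (fun j => Cmul (A i j) (v j))).
Proof.
  unfold quad, inner; apply csum_ext; intros; rewrite csum_mul_l; reflexivity.
Qed.

Lemma quad_ext n A B u v :
  agree n A B -> (forall i, (i < n)%nat -> u i = v i) -> quad n A u = quad n B v.
Proof.
  intros HA H; unfold quad; apply csum_ext; intros i Hi; apply csum_ext; intros j Hj.
  rewrite HA, !H; auto.
Qed.

Lemma quad_rank_one_sum n m (lam : nat -> R) (u : nat -> Vec) v :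
  quad n (fun i j => csum m (fun k => Cmul (u k i) (Cmul (RtoC (lam k)) (Cconj (u k j))))) v
  = RtoC (rsum m (fun k => lam k * Cnorm2 (inner n (u k) v))).
Proof.
  rewrite <- csum_RtoC; unfold quad.
  transitivity (csum m (fun k => csum n (fun i => csum n (fun j =>
    Cmul (Cmul (Cmul (Cconj (v i)) (u k i)) (RtoC (lam k))) (Cmul (Cconj (u k j)) (v j)))))).
  - symmetry; rewrite csum_exchange; apply csum_ext; intros i _.
    rewrite csum_exchange; apply csum_ext; intros j _.
    rewrite <- csum_mul_r, <- csum_mul_l; apply csum_ext; intros; ring.
  - apply csum_ext; intros k _; rewrite csum_prod, csum_mul_r.
    fold (inner n v (u k)) (inner n (u k) v).
    rewrite RtoC_mul, <- Cmul_conj_l, inner_conj; ring.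
Qed.

(** * Compactness and the spectral theorem *)

Definition Ccv (z : nat -> C) (l : C) : Prop :=
  Un_cv (fun j => fst (z j)) (fst l) /\ Un_cv (fun j => snd (z j)) (snd l).

Lemma Un_cv_const a : Un_cv (fun _ => a) a.
Proof. intros e He; exists 0%nat; intros; rewrite Rdist_eq; assumption. Qed.

Lemma Un_cv_ext x y l : (forall j : nat, x j = y j) -> Un_cv x l -> Un_cv y l.
Proof. intros E H e He; destruct (H e He) as [N HN]; exists N; intros; rewrite <- E; auto. Qed.

Lemma Ccv_const a : Ccv (fun _ => a) a.
Proof. split; apply Un_cv_const. Qed.

Lemma Ccv_ext x y l : (forall j, x j = y j) -> Ccv x l -> Ccv y l.
Proof. intros E [H1 H2]; split; eapply Un_cv_ext; eauto; intros j; simpl; rewrite E; reflexivity. Qed.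

Lemma Ccv_add x y a b : Ccv x a -> Ccv y b -> Ccv (fun j => Cadd (x j) (y j)) (Cadd a b).
Proof. intros [H1 H2] [H3 H4]; split; apply CV_plus; assumption. Qed.

Lemma Ccv_mul x y a b : Ccv x a -> Ccv y b -> Ccv (fun j => Cmul (x j) (y j)) (Cmul a b).
Proof.
  intros [H1 H2] [H3 H4]; split; [apply CV_minus|apply CV_plus]; apply CV_mult; assumption.
Qed.

Lemma Ccv_conj x a : Ccv x a -> Ccv (fun j => Cconj (x j)) (Cconj a).
Proof. intros [H1 H2]; split; [assumption|apply CV_opp; assumption]. Qed.

Lemma Ccv_csum n (x : nat -> nat -> C) a :
  (forall i, (i < n)%nat -> Ccv (fun j => x j i) (a i)) ->
  Ccv (fun j => csum n (x j)) (csum n a).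
Proof.
  induction n as [|n IH]; intros H; [apply (Ccv_const C0)|].
  apply (Ccv_add (fun j => csum n (x j)) (fun j => x j n)); [apply IH; auto|apply H; lia].
Qed.

Lemma Un_cv_rsum n (x : nat -> nat -> R) a :
  (forall i, (i < n)%nat -> Un_cv (fun j => x j i) (a i)) ->
  Un_cv (fun j => rsum n (x j)) (rsum n a).
Proof.
  induction n as [|n IH]; intros H; [apply (Un_cv_const 0)|].
  apply (CV_plus (fun j => rsum n (x j)) (fun j => x j n)); [apply IH; auto|apply H; lia].
Qed.

Lemma Un_cv_Cnorm2 x a : Ccv x a -> Un_cv (fun j => Cnorm2 (x j)) (Cnorm2 a).
Proof. intros [H1 H2]; apply CV_plus; apply CV_mult; assumption. Qed.

Lemma Un_cv_unique_const x a l : (forall j : nat, x j = a) -> Un_cv x l -> l = a.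
Proof.
  intros E H; apply (UL_sequence x); [assumption|].
  apply Un_cv_ext with (fun _ => a); [auto|apply Un_cv_const].
Qed.

Definition increasing_index (phi : nat -> nat) : Prop := forall j, (phi j < phi (S j))%nat.

Lemma increasing_index_ge phi : increasing_index phi -> forall j, (j <= phi j)%nat.
Proof. intros H j; induction j; [lia|]; specialize (H j); lia. Qed.

Lemma increasing_index_comp phi psi :
  increasing_index phi -> increasing_index psi -> increasing_index (fun j => phi (psi j)).
Proof.
  intros H H' j; assert (M : forall a b, (a < b)%nat -> (phi a < phi b)%nat).
  { intros a b Hab; induction Hab; [apply H|specialize (H m); lia]. }
  apply M, H'.
Qed.

Lemma Un_cv_subseq x l phi :
  increasing_index phi -> Un_cv x l -> Un_cv (fun j => x (phi j)) l.
Proof.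
  intros H Hx e He; destruct (Hx e He) as [N HN]; exists N; intros j Hj.
  apply HN; pose proof (increasing_index_ge phi H j); lia.
Qed.

Lemma Ccv_subseq x l phi : increasing_index phi -> Ccv x l -> Ccv (fun j => x (phi j)) l.
Proof.
  intros H [H1 H2]; split;
    [apply (Un_cv_subseq (fun j => fst (x j)))|apply (Un_cv_subseq (fun j => snd (x j)))]; assumption.
Qed.

(** [Bolzano_Weierstrass] yields a cluster value: indices beyond any bound come arbitrarily close to
    [l]. Choosing after each [N] an index within [1 / (N + 1)] of [l], and iterating the choice,
    gives an actual subsequence. *)
Lemma subsequence_real (x : nat -> R) :
  (forall j, -1 <= x j <= 1) ->
  exists phi l, increasing_index phi /\ Un_cv (fun j => x (phi j)) l.
Proof.
  intros Hx.
  destruct (Bolzano_Weierstrass x (fun t => -1 <= t <= 1)) as [l Hl]; [apply compact_P3|assumption|].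
  assert (step : forall N : nat, exists q, (N < q)%nat /\ Rabs (x q - l) < / INR (S N)).
  { intros N; destruct (Hl (disc l (mkposreal _ (Rinv_0_lt_compat _ (lt_0_INR (S N) (Nat.lt_0_succ N)))))
      (S N)) as [q [Hq Hd]].
    - exists (mkposreal _ (Rinv_0_lt_compat _ (lt_0_INR (S N) (Nat.lt_0_succ N)))); intros t Ht; exact Ht.
    - exists q; split; [lia|exact Hd]. }
  pose (next := fun N => proj1_sig (constructive_indefinite_description _ (step N))).
  assert (Hnext : forall N, (N < next N)%nat /\ Rabs (x (next N) - l) < / INR (S N)).
  { intros N; unfold next; destruct constructive_indefinite_description; assumption. }
  pose (phi := fix phi j := match j with O => next O | S k => next (phi k) end).
  assert (Hphi : increasing_index phi) by (intros j; apply Hnext).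
  exists phi, l; split; [assumption|].
  assert (Hle : forall j, (1 <= j)%nat -> Rabs (x (phi j) - l) < / INR j).
  { intros [|j] Hj; [lia|].
    eapply Rlt_le_trans; [apply (Hnext (phi j))|].
    apply Rinv_le_contravar; [apply lt_0_INR; lia|apply le_INR].
    pose proof (increasing_index_ge phi Hphi j); lia. }
  intros e He; destruct (archimed_cor1 e He) as [N [HN HN0]].
  exists N; intros j Hj; eapply Rlt_trans; [apply Hle; lia|].
  eapply Rle_lt_trans; [|exact HN].
  apply Rinv_le_contravar; [apply lt_0_INR; lia|apply le_INR; lia].
Qed.

Lemma subsequence_vec N (x : nat -> Vec) :
  (forall j i, (i < N)%nat -> Cnorm2 (x j i) <= 1) ->
  exists phi (l : Vec), increasing_index phi /\
    forall i, (i < N)%nat -> Ccv (fun j => x (phi j) i) (l i).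
Proof.
  induction N as [|N IH]; intros Hx.
  - exists (fun j => j), (fun _ => C0); split; [intros j; lia|intros; lia].
  - destruct IH as (phi & l & Hphi & Hl); [auto|].
    assert (B : forall j, Cnorm2 (x j N) <= 1) by (intros; apply Hx; lia).
    destruct (subsequence_real (fun j => fst (x (phi j) N))) as (psi & a & Hpsi & Ha).
    { intros j; specialize (B (phi j)); unfold Cnorm2 in B; nra. }
    destruct (subsequence_real (fun j => snd (x (phi (psi j)) N))) as (chi & b & Hchi & Hb).
    { intros j; specialize (B (phi (psi j))); unfold Cnorm2 in B; nra. }
    exists (fun j => phi (psi (chi j))), (fun i => if Nat.eqb i N then (a, b) else l i); split.
    { apply (increasing_index_comp phi (fun j => psi (chi j)));
        [|apply increasing_index_comp]; assumption. }
    intros i Hi; destruct (Nat.eqb_spec i N) as [->|Hne].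
    + split; [|assumption]. apply (Un_cv_subseq _ _ chi Hchi Ha).
    + apply (Ccv_subseq (fun j => x (phi j) i) (l i) (fun j => psi (chi j)));
        [apply increasing_index_comp; assumption|apply Hl; lia].
Qed.

(** Closedness of [P] and continuity of [F] enter as one hypothesis on limits that are controlled
    only in the first [N] coordinates. If [F] were unbounded on [P], a subsequence with values
    tending to infinity would converge, so the same extraction settles both cases. *)
Lemma max_attained N (P : Vec -> Prop) (F : Vec -> R) (w0 : Vec) :
  P w0 -> (forall w, P w -> forall i, (i < N)%nat -> Cnorm2 (w i) <= 1) ->
  (forall (x : nat -> Vec) l, (forall j, P (x j)) ->
     (forall i, (i < N)%nat -> Ccv (fun j => x j i) (l i)) ->
     P l /\ Un_cv (fun j => F (x j)) (F l)) ->
  exists w, P w /\ forall w', P w' -> F w' <= F w.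
Proof.
  intros H0 HB HC.
  assert (Hlim : forall x : nat -> Vec, (forall j, P (x j)) ->
            exists phi l, increasing_index phi /\ P l /\ Un_cv (fun j => F (x (phi j))) (F l)).
  { intros x Hx; destruct (subsequence_vec N x) as (phi & l & Hphi & Hl); [auto|].
    exists phi, l; split; [assumption|]. apply (HC (fun j => x (phi j))); auto. }
  destruct (classic (bound (fun t => exists w, P w /\ t = F w))) as [Hb|Hb].
  - destruct (completeness _ Hb) as [s [Hs1 Hs2]]; [exists (F w0), w0; auto|].
    assert (step : forall j : nat, exists w, P w /\ s - / INR (S j) < F w).
    { intros j; apply NNPP; intros Hn.
      assert (s <= s - / INR (S j)).
      { apply Hs2; intros t (w & Hw & ->); apply Rnot_lt_le; intros Hlt; apply Hn; eauto. }
      assert (0 < / INR (S j)) by (apply Rinv_0_lt_compat, lt_0_INR; lia); lra. }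
    pose (x := fun j => proj1_sig (constructive_indefinite_description _ (step j))).
    assert (Hx : forall j, P (x j) /\ s - / INR (S j) < F (x j)).
    { intros j; unfold x; destruct constructive_indefinite_description; assumption. }
    destruct (Hlim x) as (phi & l & Hphi & Pl & Hl); [apply Hx|].
    exists l; split; [assumption|]; intros w Hw.
    apply Rle_trans with s; [apply Hs1; eauto|].
    apply Rnot_lt_le; intros Hlt.
    destruct (Hl ((s - F l) / 2)) as [n1 Hn1]; [lra|].
    destruct (archimed_cor1 ((s - F l) / 2)) as [n2 [Hn2 Hn2']]; [lra|].
    set (j := (n1 + n2)%nat).
    specialize (Hn1 j ltac:(lia)); apply Rabs_def2 in Hn1.
    destruct (Hx (phi j)) as [_ Hj].
    assert (/ INR (S (phi j)) <= / INR n2).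
    { apply Rinv_le_contravar; [apply lt_0_INR; lia|apply le_INR].
      pose proof (increasing_index_ge phi Hphi j); lia. }
    lra.
  - assert (step : forall j : nat, exists w, P w /\ INR j < F w).
    { intros j; apply NNPP; intros Hn; apply Hb; exists (INR j).
      intros t (w & Hw & ->); apply Rnot_lt_le; intros Hlt; apply Hn; eauto. }
    pose (x := fun j => proj1_sig (constructive_indefinite_description _ (step j))).
    assert (Hx : forall j, P (x j) /\ INR j < F (x j)).
    { intros j; unfold x; destruct constructive_indefinite_description; assumption. }
    destruct (Hlim x) as (phi & l & Hphi & Pl & Hl); [apply Hx|].
    exfalso; destruct (Hl 1) as [n1 Hn1]; [lra|].
    destruct (INR_unbounded (F l + 1)) as [n2 Hn2].
    set (j := (n1 + n2)%nat).
    specialize (Hn1 j ltac:(lia)); apply Rabs_def2 in Hn1.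
    destruct (Hx (phi j)) as [_ Hj].
    assert (INR n2 <= INR (phi j)).
    { apply le_INR; pose proof (increasing_index_ge phi Hphi j); lia. }
    lra.
Qed.

(** * Unitary matrices and their limits *)

Lemma unitary_inner n U : unitary n U <->
  forall k l, (k < n)%nat -> (l < n)%nat -> inner n (col U k) (col U l) = if Nat.eqb k l then C1 else C0.
Proof. split; intros H k l Hk Hl; apply (H k l Hk Hl). Qed.

Lemma unitary_idm n : unitary n idm.
Proof.
  apply unitary_inner; intros k l Hk Hl; unfold inner, col, idm.
  rewrite (csum_ext n _ (fun i => if Nat.eqb i l then (if Nat.eqb i k then C1 else C0) else C0)).
  - rewrite csum_delta by assumption; rewrite Nat.eqb_sym; reflexivity.
  - intros i Hi; destruct (Nat.eqb i k), (Nat.eqb i l); Cext; ring.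
Qed.

Lemma unitary_norm2 n U k : unitary n U -> (k < n)%nat -> norm2 n (col U k) = 1.
Proof.
  intros H Hk; pose proof (proj1 (unitary_inner n U) H k k Hk Hk) as E.
  rewrite inner_self, Nat.eqb_refl in E; apply (f_equal fst) in E; exact E.
Qed.

(* [1 - U U^*] is a Hermitian projection of trace [0]. *)
Lemma unitary_right_inverse n U :
  unitary n U -> agree n (mmul n U (adj U)) idm.
Proof.
  intros HU.
  set (G := mmul n U (adj U)).
  assert (GG : agree n (mmul n G G) G).
  { intros i j Hi Hj; unfold G, mmul at 1.
    transitivity (csum n (fun k => csum n (fun l => Cmul (Cmul (U i k) (adj U l j)) (mmul n (adj U) U k l)))).
    - rewrite (csum_ext n _ (fun a => csum n (fun k => csum n (fun l =>
        Cmul (Cmul (U i k) (adj U k a)) (Cmul (U a l) (adj U l j)))))).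
      + rewrite csum_exchange; apply csum_ext; intros k Hk.
        rewrite csum_exchange; apply csum_ext; intros l Hl.
        unfold mmul; rewrite <- csum_mul_l; apply csum_ext; intros; ring.
      + intros a Ha; unfold mmul; rewrite csum_prod; reflexivity.
    - unfold mmul at 2; apply csum_ext; intros k Hk.
      rewrite (csum_ext n _ (fun l => if Nat.eqb l k then Cmul (U i k) (adj U l j) else C0)).
      + rewrite csum_delta by assumption; reflexivity.
      + intros l Hl; rewrite HU by assumption; unfold idm; rewrite Nat.eqb_sym.
        destruct (Nat.eqb l k); ring. }
  assert (GH : forall i j, Cconj (G i j) = G j i).
  { intros i j; unfold G, mmul; rewrite csum_conj; apply csum_ext; intros k _.
    unfold adj; rewrite Cconj_mul, Cconj_conj; ring. }
  assert (TG : fst (trace n G) = INR n).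
  { unfold trace, G, mmul; rewrite csum_exchange, csum_fst.
    rewrite (rsum_ext n _ (fun _ => 1)); [rewrite rsum_const; ring|].
    intros k Hk; rewrite <- (unitary_norm2 n U k HU Hk), csum_fst.
    apply rsum_ext; intros; unfold adj; rewrite Cmul_conj_r; reflexivity. }
  (* For a Hermitian idempotent [G] the squared Frobenius norm of [1 - G] is its trace, here
     [n - n = 0]; a vanishing sum of squares kills every entry. *)
  assert (Z : rsum n (fun i => rsum n (fun j => Cnorm2 (Csub (idm i j) (G i j)))) = 0).
  { rewrite (rsum_ext n _ (fun i => 1 - fst (G i i))).
    - rewrite rsum_minus, rsum_const; unfold trace in TG; rewrite csum_fst in TG; lra.
    - intros i Hi.
      rewrite (rsum_ext n _ (fun j => fst (Cadd (if Nat.eqb j i then Csub C1 (Cadd (G i i) (G i i)) else C0)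
         (Cmul (G i j) (G j i))))).
      + rewrite <- csum_fst, csum_add, csum_delta by assumption.
        fold (mmul n G G i i); rewrite GG by assumption; simpl; lra.
      + intros j Hj; rewrite <- (GH i j); unfold idm; rewrite Nat.eqb_sym.
        destruct (Nat.eqb_spec j i) as [->|]; [|unfold Cnorm2; simpl; ring].
        assert (snd (G i i) = 0) as E.
        { pose proof (f_equal snd (GH i i)) as E; simpl in E; lra. }
        unfold Cnorm2; simpl; rewrite E; ring. }
  intros i j Hi Hj.
  assert (Cnorm2 (Csub (idm i j) (G i j)) <= 0) as H.
  { rewrite <- Z.
    apply Rle_trans with (rsum n (fun j => Cnorm2 (Csub (idm i j) (G i j)))).
    - apply (rsum_term_le n (fun j => Cnorm2 (Csub (idm i j) (G i j)))); [|assumption].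
      intros; apply Cnorm2_nonneg.
    - apply (rsum_term_le n (fun i => rsum n (fun j => Cnorm2 (Csub (idm i j) (G i j))))); [|assumption].
      intros; apply rsum_nonneg; intros; apply Cnorm2_nonneg. }
  pose proof (Cnorm2_nonneg (Csub (idm i j) (G i j))).
  assert (E : Csub (idm i j) (G i j) = C0) by (apply Cnorm2_eq0; lra).
  replace (idm i j) with (Cadd (Csub (idm i j) (G i j)) (G i j)) by ring.
  rewrite E; ring.
Qed.

(** Flattening row by row lets [max_attained], which speaks of vectors, run over matrices. *)
Definition mat_of_vec (n : nat) (w : Vec) : Mat := fun i j => w (i * n + j)%nat.
Definition vec_of_mat (n : nat) (U : Mat) : Vec := fun i => U (i / n)%nat (i mod n)%nat.

Lemma mat_of_vec_of_mat n U i j : (j < n)%nat -> mat_of_vec n (vec_of_mat n U) i j = U i j.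
Proof.
  intros H; unfold mat_of_vec, vec_of_mat; destruct (divmod_add n i j H) as [-> ->]; reflexivity.
Qed.

Lemma Cnorm2_unitary_le n U i j :
  unitary n U -> (i < n)%nat -> (j < n)%nat -> Cnorm2 (U i j) <= 1.
Proof.
  intros HU Hi Hj; rewrite <- (unitary_norm2 n U j HU Hj).
  apply (rsum_term_le n (fun i => Cnorm2 (col U j i))); [intros; apply Cnorm2_nonneg|assumption].
Qed.

Lemma Ccv_inner n (x y : nat -> Vec) u v :
  (forall i, (i < n)%nat -> Ccv (fun j => x j i) (u i)) ->
  (forall i, (i < n)%nat -> Ccv (fun j => y j i) (v i)) ->
  Ccv (fun j => inner n (x j) (y j)) (inner n u v).
Proof.
  intros Hx Hy; apply (Ccv_csum n (fun j i => Cmul (Cconj (x j i)) (y j i))); intros i Hi.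
  apply Ccv_mul; [apply Ccv_conj|]; auto.
Qed.

Lemma Ccv_quad n (A : nat -> Mat) A0 (x : nat -> Vec) v :
  (forall i k, (i < n)%nat -> (k < n)%nat -> Ccv (fun j => A j i k) (A0 i k)) ->
  (forall i, (i < n)%nat -> Ccv (fun j => x j i) (v i)) ->
  Ccv (fun j => quad n (A j) (x j)) (quad n A0 v).
Proof.
  intros HA Hx.
  apply (Ccv_csum n (fun j i => csum n (fun k => Cmul (Cconj (x j i)) (Cmul (A j i k) (x j k))))); intros i Hi.
  apply (Ccv_csum n (fun j k => Cmul (Cconj (x j i)) (Cmul (A j i k) (x j k)))); intros k Hk.
  apply Ccv_mul; [apply Ccv_conj; auto|apply Ccv_mul; auto].
Qed.

Lemma unitary_limit n (x : nat -> Mat) U :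
  (forall j, unitary n (x j)) ->
  (forall i k, (i < n)%nat -> (k < n)%nat -> Ccv (fun j => x j i k) (U i k)) -> unitary n U.
Proof.
  intros Hx HU; apply unitary_inner; intros k l Hk Hl.
  assert (H : Ccv (fun j => inner n (col (x j) k) (col (x j) l)) (inner n (col U k) (col U l))).
  { apply Ccv_inner; intros; apply HU; assumption. }
  destruct H as [H1 H2]; apply C_ext.
  - apply Un_cv_unique_const with (2 := H1); intros j.
    rewrite (proj1 (unitary_inner n (x j)) (Hx j)); auto.
  - apply Un_cv_unique_const with (2 := H2); intros j.
    rewrite (proj1 (unitary_inner n (x j)) (Hx j)); auto.
Qed.

(** * Diagonalisation by rotating pairs of columns *)

Definition bilin (n : nat) (A : Mat) (u v : Vec) : C :=
  inner n u (fun i => csum n (fun j => Cmul (A i j) (v j))).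

Lemma bilin_comb_r n A u a v b w :
  bilin n A u (fun i => Cadd (Cmul a (v i)) (Cmul b (w i)))
  = Cadd (Cmul a (bilin n A u v)) (Cmul b (bilin n A u w)).
Proof.
  unfold bilin; rewrite <- !inner_scal_r, <- inner_add_r; apply inner_ext; intros i _; [reflexivity|].
  rewrite <- !csum_mul_l, <- csum_add; apply csum_ext; intros; ring.
Qed.

Lemma bilin_comb_l n A u a v b w :
  bilin n A (fun i => Cadd (Cmul a (v i)) (Cmul b (w i))) u
  = Cadd (Cmul (Cconj a) (bilin n A v u)) (Cmul (Cconj b) (bilin n A w u)).
Proof. unfold bilin; rewrite inner_add_l, !inner_scal_l; reflexivity. Qed.

Lemma bilin_conj n A u v : hermitian n A -> Cconj (bilin n A u v) = bilin n A v u.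
Proof.
  intros H; unfold bilin, inner; rewrite csum_conj.
  transitivity (csum n (fun i => csum n (fun j => Cmul (Cconj (v j)) (Cmul (A j i) (u i))))).
  - apply csum_ext; intros i Hi; rewrite Cconj_mul, Cconj_conj, csum_conj, <- csum_mul_l.
    apply csum_ext; intros j Hj; rewrite Cconj_mul, (H i j) by assumption.
    unfold adj; rewrite Cconj_conj; ring.
  - rewrite csum_exchange; apply csum_ext; intros i Hi; rewrite <- csum_mul_l; reflexivity.
Qed.

Lemma inner_comb n a b c d u v :
  inner n (fun i => Cadd (Cmul a (u i)) (Cmul b (v i))) (fun i => Cadd (Cmul c (u i)) (Cmul d (v i)))
  = Cadd (Cadd (Cmul (Cmul (Cconj a) c) (inner n u u)) (Cmul (Cmul (Cconj a) d) (inner n u v)))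
         (Cadd (Cmul (Cmul (Cconj b) c) (inner n v u)) (Cmul (Cmul (Cconj b) d) (inner n v v))).
Proof. rewrite inner_add_r, !inner_add_l, !inner_scal_r, !inner_scal_l, ?inner_scal_r; ring. Qed.

Lemma inner_comb_r n u a v b w :
  inner n u (fun i => Cadd (Cmul a (v i)) (Cmul b (w i)))
  = Cadd (Cmul a (inner n u v)) (Cmul b (inner n u w)).
Proof. rewrite inner_add_r, !inner_scal_r; reflexivity. Qed.

(** A complex Givens rotation of columns [i] and [j]. It is parametrised by the slope [z] in place
    of an angle and phase, with [c = 1 / sqrt (1 + |z| ^ 2)]. *)
Definition rotate (U : Mat) (i j : nat) (c : R) (z : C) : Mat := fun l k =>
  if Nat.eqb k i then Cadd (Cmul (RtoC c) (U l i)) (Cmul (Cmul (RtoC c) z) (U l j))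
  else if Nat.eqb k j
  then Cadd (Cmul (Copp (Cmul (RtoC c) (Cconj z))) (U l i)) (Cmul (RtoC c) (U l j))
  else U l k.

Lemma rotate_unitary n U i j c z :
  (i < n)%nat -> (j < n)%nat -> i <> j -> c * c * (1 + Cnorm2 z) = 1 ->
  unitary n U -> unitary n (rotate U i j c z).
Proof.
  intros Hi Hj Hij Hc HU; pose proof (proj1 (unitary_inner n U) HU) as HI.
  assert (Hii := HI i i Hi Hi); assert (Hjj := HI j j Hj Hj).
  assert (H_ij := HI i j Hi Hj); assert (H_ji := HI j i Hj Hi).
  rewrite Nat.eqb_refl in Hii, Hjj.
  replace (Nat.eqb i j) with false in H_ij by (symmetry; apply Nat.eqb_neq; auto).
  replace (Nat.eqb j i) with false in H_ji by (symmetry; apply Nat.eqb_neq; auto).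
  set (u := fun l => Cadd (Cmul (RtoC c) (col U i l)) (Cmul (Cmul (RtoC c) z) (col U j l))).
  set (v := fun l => Cadd (Cmul (Copp (Cmul (RtoC c) (Cconj z))) (col U i l)) (Cmul (RtoC c) (col U j l))).
  assert (Hcol : forall k, col (rotate U i j c z) k =
    if Nat.eqb k i then u else if Nat.eqb k j then v else col U k).
  { intros k; unfold col, rotate, u, v; destruct (Nat.eqb k i), (Nat.eqb k j); reflexivity. }
  assert (Huu : inner n u u = C1).
  { unfold u; rewrite inner_comb, Hii, Hjj, H_ij, H_ji; unfold Cnorm2 in Hc.
    rewrite !Cconj_mul, Cconj_RtoC; apply C_ext; simpl; nra. }
  assert (Hvv : inner n v v = C1).
  { unfold v; rewrite inner_comb, Hii, Hjj, H_ij, H_ji; unfold Cnorm2 in Hc.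
    apply C_ext; simpl; nra. }
  assert (Huv : inner n u v = C0).
  { unfold u, v; rewrite inner_comb, Hii, Hjj, H_ij, H_ji.
    apply C_ext; simpl; ring. }
  assert (Hu : forall k, (k < n)%nat -> k <> i -> k <> j -> inner n (col U k) u = C0).
  { intros k Hk H1 H2; unfold u; rewrite inner_comb_r, !HI by assumption.
    destruct (Nat.eqb_spec k i), (Nat.eqb_spec k j); try tauto; ring. }
  assert (Hv : forall k, (k < n)%nat -> k <> i -> k <> j -> inner n (col U k) v = C0).
  { intros k Hk H1 H2; unfold v; rewrite inner_comb_r, !HI by assumption.
    destruct (Nat.eqb_spec k i), (Nat.eqb_spec k j); try tauto; ring. }
  assert (sym : forall a b, inner n a b = C0 -> inner n b a = C0).
  { intros a b E; rewrite <- inner_conj, E; apply Cconj_0. }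
  apply unitary_inner; intros k l Hk Hl; rewrite !Hcol.
  destruct (Nat.eqb_spec k i) as [->|Hki]; [|destruct (Nat.eqb_spec k j) as [->|Hkj]];
    (destruct (Nat.eqb_spec l i) as [->|Hli]; [|destruct (Nat.eqb_spec l j) as [->|Hlj]]);
    rewrite ?Nat.eqb_refl; auto;
    match goal with |- context [Nat.eqb ?a ?b] => destruct (Nat.eqb_spec a b); try congruence | _ => idtac end;
    auto.
Qed.

Lemma rsum_change_two n (f g : nat -> R) i j :
  (i < n)%nat -> (j < n)%nat -> i <> j ->
  (forall k, (k < n)%nat -> k <> i -> k <> j -> f k = g k) ->
  rsum n f - rsum n g = (f i - g i) + (f j - g j).
Proof.
  intros Hi Hj Hij H; rewrite <- rsum_minus.
  rewrite (rsum_ext n _ (fun k => (if Nat.eqb k i then f k - g k else 0) +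
                                  (if Nat.eqb k j then f k - g k else 0))).
  - rewrite rsum_plus, !rsum_delta by assumption; reflexivity.
  - intros k Hk; destruct (Nat.eqb_spec k i), (Nat.eqb_spec k j); try lia; try ring.
    rewrite H by assumption; ring.
Qed.

(** Equal weights would give the trace, which no unitary changes. Strictly decreasing weights reward
    moving diagonal mass to an earlier column, so a maximiser over the compact set of unitaries must
    diagonalise [A]. The spectral theorem is obtained this way. *)
Definition weighted_diag (n : nat) (A U : Mat) : R :=
  rsum n (fun k => - INR k * fst (bilin n A (col U k) (col U k))).

(* A rotation of two columns raises the weighted diagonal unless their off-diagonal entry vanishes. *)
Lemma weighted_diag_improve n A U i j :
  hermitian n A -> unitary n U -> (i < j)%nat -> (j < n)%nat ->
  bilin n A (col U i) (col U j) <> C0 ->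
  exists U', unitary n U' /\ weighted_diag n A U < weighted_diag n A U'.
Proof.
  intros HA HU Hij Hj Hb.
  set (b := bilin n A (col U i) (col U j)) in *.
  set (x := fst (bilin n A (col U i) (col U i))); set (y := fst (bilin n A (col U j) (col U j))).
  assert (Hself : forall v, bilin n A v v = RtoC (fst (bilin n A v v))).
  { intros v; apply C_ext; [reflexivity|].
    pose proof (f_equal snd (bilin_conj n A v v HA)) as E; simpl in *; lra. }
  assert (Hx : bilin n A (col U i) (col U i) = RtoC x) by apply Hself.
  assert (Hy : bilin n A (col U j) (col U j) = RtoC y) by apply Hself.
  assert (Hba : bilin n A (col U j) (col U i) = Cconj b) by (symmetry; apply bilin_conj; assumption).
  assert (Hb0 : 0 < Cnorm2 b).
  { destruct (Cnorm2_nonneg b) as [|E]; [assumption|]; exfalso; apply Hb, Cnorm2_eq0; auto. }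
  (* Column [i] is tilted towards column [j] with slope [eta] times the conjugate of [b]. Up to the
     factor [c ^ 2] its diagonal entry gains [eta |b| ^ 2 (2 - eta (x - y))], and this [eta] is
     small enough for the bracket to stay positive. *)
  set (eta := / (1 + Rabs (x - y))).
  assert (Heta : 0 < eta) by (apply Rinv_0_lt_compat; pose proof (Rabs_pos (x - y)); lra).
  assert (Heta' : eta * (x - y) < 1).
  { apply Rle_lt_trans with (eta * Rabs (x - y)).
    - apply Rmult_le_compat_l; [lra|apply Rle_abs].
    - assert (eta * (1 + Rabs (x - y)) = 1); [|lra].
      apply Rinv_l; pose proof (Rabs_pos (x - y)); lra. }
  set (z := Cmul (RtoC eta) (Cconj b)).
  assert (Hz : Cnorm2 z = eta * eta * Cnorm2 b).
  { unfold z; rewrite Cnorm2_mul, Cnorm2_RtoC, Cnorm2_conj; reflexivity. }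
  assert (Hpos : 0 < 1 + Cnorm2 z) by (pose proof (Cnorm2_nonneg z); lra).
  set (c := / sqrt (1 + Cnorm2 z)).
  assert (Hcc : c * c = / (1 + Cnorm2 z)).
  { unfold c; rewrite <- Rinv_mult, sqrt_sqrt; lra. }
  assert (Hc : c * c * (1 + Cnorm2 z) = 1) by (rewrite Hcc; field; lra).
  exists (rotate U i j c z); split; [apply rotate_unitary; auto; lia|].
  set (u := fun l => Cadd (Cmul (RtoC c) (col U i l)) (Cmul (Cmul (RtoC c) z) (col U j l))).
  set (v := fun l => Cadd (Cmul (Copp (Cmul (RtoC c) (Cconj z))) (col U i l)) (Cmul (RtoC c) (col U j l))).
  assert (Hcol : forall k, col (rotate U i j c z) k =
    if Nat.eqb k i then u else if Nat.eqb k j then v else col U k).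
  { intros k; unfold col, rotate, u, v; destruct (Nat.eqb k i), (Nat.eqb k j); reflexivity. }
  assert (Hu : fst (bilin n A u u) = c * c * (x + 2 * eta * Cnorm2 b + eta * eta * Cnorm2 b * y)).
  { unfold u; rewrite bilin_comb_l, !bilin_comb_r, Hx, Hy, Hba; fold b.
    unfold z, Cnorm2; simpl; ring. }
  assert (Hv : fst (bilin n A v v) = c * c * (y - 2 * eta * Cnorm2 b + eta * eta * Cnorm2 b * x)).
  { unfold v; rewrite bilin_comb_l, !bilin_comb_r, Hx, Hy, Hba; fold b.
    unfold z, Cnorm2; simpl; ring. }
  assert (Huv : fst (bilin n A u u) + fst (bilin n A v v) = x + y).
  { rewrite Hu, Hv; rewrite Hz in Hc.
    replace (x + y) with (c * c * (1 + eta * eta * Cnorm2 b) * (x + y)) by (rewrite Hc; ring); ring. }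
  assert (Hgain : x < fst (bilin n A u u)).
  { rewrite Hu; apply Rmult_lt_reg_l with (1 + Cnorm2 z); [assumption|].
    rewrite Hcc, <- Rmult_assoc, Rinv_r, Rmult_1_l by lra.
    rewrite Hz; assert (0 < eta * Cnorm2 b * (2 - eta * (x - y))); [|nra].
    apply Rmult_lt_0_compat; [apply Rmult_lt_0_compat; assumption|lra]. }
  (* By [Huv] the other diagonal entry loses what entry [i] gains, so the weighted sum changes by
     [j - i] times the gain. *)
  assert (D : weighted_diag n A (rotate U i j c z) - weighted_diag n A U
    = (- INR i * fst (bilin n A u u) - - INR i * x) + (- INR j * fst (bilin n A v v) - - INR j * y)).
  { unfold weighted_diag; rewrite (rsum_change_two n _ _ i j); try lia.
    - rewrite !Hcol, !Nat.eqb_refl.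
      replace (Nat.eqb j i) with false by (symmetry; apply Nat.eqb_neq; lia); reflexivity.
    - intros k Hk H1 H2; rewrite Hcol.
      destruct (Nat.eqb_spec k i), (Nat.eqb_spec k j); try lia; reflexivity. }
  assert (INR i < INR j) by (apply lt_INR; assumption).
  assert (fst (bilin n A v v) = x + y - fst (bilin n A u u)) as Ev by lra.
  rewrite Ev in D. nra.
Qed.

Lemma weighted_diag_max n A :
  exists U, unitary n U /\ forall U', unitary n U' -> weighted_diag n A U' <= weighted_diag n A U.
Proof.
  destruct (max_attained (n * n) (fun w => unitary n (mat_of_vec n w))
              (fun w => weighted_diag n A (mat_of_vec n w)) (vec_of_mat n idm)) as (w & Hw & Hmax).
  - intros i j Hi Hj; rewrite <- (unitary_idm n i j Hi Hj).
    unfold mmul, adj; apply csum_ext; intros k Hk; rewrite !mat_of_vec_of_mat by assumption; reflexivity.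
  - intros w Hw i Hi; destruct (div_mod_lt n n i Hi) as [[H1 H2] E].
    rewrite E; apply (Cnorm2_unitary_le n (mat_of_vec n w)); assumption.
  - intros x l Hx Hl.
    assert (HM : forall i k, (i < n)%nat -> (k < n)%nat ->
              Ccv (fun j => mat_of_vec n (x j) i k) (mat_of_vec n l i k)).
    { intros i k Hi Hk; apply Hl; nia. }
    split; [apply (unitary_limit n (fun j => mat_of_vec n (x j))); assumption|].
    apply (Un_cv_rsum n (fun j k => - INR k * fst (bilin n A (col (mat_of_vec n (x j)) k) (col (mat_of_vec n (x j)) k)))).
    intros k Hk; apply CV_mult; [apply Un_cv_const|].
    apply (Ccv_inner n (fun j => col (mat_of_vec n (x j)) k)
      (fun j i => csum n (fun q => Cmul (A i q) (col (mat_of_vec n (x j)) k q)))).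
    + intros i Hi; apply HM; assumption.
    + intros i Hi; apply (Ccv_csum n (fun j q => Cmul (A i q) (col (mat_of_vec n (x j)) k q))).
      intros q Hq; apply Ccv_mul; [apply Ccv_const|apply HM; assumption].
  - exists (mat_of_vec n w); split; [assumption|].
    intros U HU; assert (E : forall i k, (k < n)%nat -> mat_of_vec n (vec_of_mat n U) i k = U i k)
      by (intros; apply mat_of_vec_of_mat; assumption).
    replace (weighted_diag n A U) with (weighted_diag n A (mat_of_vec n (vec_of_mat n U))).
    + apply Hmax; intros i j Hi Hj; rewrite <- (HU i j Hi Hj).
      unfold mmul, adj; apply csum_ext; intros; rewrite !E by assumption; reflexivity.
    + apply rsum_ext; intros k Hk; do 2 f_equal.
      unfold bilin; apply inner_ext; intros i Hi; [apply E; assumption|].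
      apply csum_ext; intros; f_equal; apply E; assumption.
Qed.

Theorem spectral_exists n A : hermitian n A -> exists lam, spectral n A lam.
Proof.
  intros HA; destruct (weighted_diag_max n A) as (U & HU & Hmax).
  assert (Hoff : forall i j, (i < j)%nat -> (j < n)%nat -> bilin n A (col U i) (col U j) = C0).
  { intros i j Hij Hj; apply NNPP; intros Hb.
    destruct (weighted_diag_improve n A U i j HA HU Hij Hj Hb) as (U' & HU' & Hlt).
    specialize (Hmax U' HU'); lra. }
  set (lam := fun k => fst (bilin n A (col U k) (col U k))).
  assert (HD : forall k l, (k < n)%nat -> (l < n)%nat ->
    bilin n A (col U k) (col U l) = if Nat.eqb l k then RtoC (lam k) else C0).
  { intros k l Hk Hl; destruct (Nat.eqb_spec l k) as [->|Hne].
    - apply C_ext; [reflexivity|].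
      pose proof (f_equal snd (bilin_conj n A (col U k) (col U k) HA)) as E; simpl in *; lra.
    - destruct (Nat.lt_ge_cases k l) as [H|H]; [apply Hoff; assumption|].
      rewrite <- (bilin_conj n A _ _ HA), Hoff by lia; apply Cconj_0. }
  exists lam, U; split; [assumption|].
  (* [A = (U U^* ) A (U U^* )] with [U^* A U] diagonal. *)
  assert (HI := unitary_right_inverse n U HU).
  intros i j Hi Hj.
  transitivity (csum n (fun a => csum n (fun b =>
     Cmul (Cmul (mmul n U (adj U) i a) (A a b)) (mmul n U (adj U) b j)))).
  - rewrite (csum_ext n _ (fun a => if Nat.eqb a i then A a j else C0)).
    + rewrite csum_delta by assumption; reflexivity.
    + intros a Ha.
      rewrite (csum_ext n _ (fun b => if Nat.eqb b j then Cmul (mmul n U (adj U) i a) (A a b) else C0)).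
      * rewrite csum_delta, HI by assumption; unfold idm; rewrite Nat.eqb_sym.
        destruct (Nat.eqb a i); ring.
      * intros b Hb'; rewrite (HI b j) by assumption; unfold idm.
        destruct (Nat.eqb b j); ring.
  - transitivity (csum n (fun k => csum n (fun l =>
      Cmul (Cmul (U i k) (bilin n A (col U k) (col U l))) (Cconj (U j l))))).
    + transitivity (csum n (fun a => csum n (fun b => csum n (fun k => csum n (fun l =>
        Cmul (Cmul (Cmul (U i k) (Cconj (U a k))) (A a b)) (Cmul (U b l) (Cconj (U j l)))))))).
      * apply csum_ext; intros a _; apply csum_ext; intros b _; unfold mmul, adj.
        rewrite <- csum_mul_r, <- csum_prod; reflexivity.
      * rewrite (csum_ext n _ (fun a => csum n (fun k => csum n (fun l => csum n (fun b =>
          Cmul (Cmul (Cmul (U i k) (Cconj (U a k))) (A a b)) (Cmul (U b l) (Cconj (U j l)))))))).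
        -- rewrite csum_exchange; apply csum_ext; intros k _.
           rewrite csum_exchange; apply csum_ext; intros l _.
           unfold bilin, inner, col; rewrite <- csum_mul_l, <- csum_mul_r.
           apply csum_ext; intros a _.
           rewrite <- !csum_mul_l, <- csum_mul_r; apply csum_ext; intros; ring.
        -- intros a _; rewrite csum_exchange; apply csum_ext; intros k _; apply csum_exchange.
    + apply csum_ext; intros k Hk.
      rewrite (csum_ext n _ (fun l => if Nat.eqb l k then Cmul (U i k) (Cmul (RtoC (lam k)) (Cconj (U j l))) else C0)).
      * rewrite csum_delta by assumption; reflexivity.
      * intros l Hl; rewrite HD by assumption; destruct (Nat.eqb l k); ring.
Qed.

(** * Trace powers of positive matrices *)

Lemma rpow_nonneg x p : 0 <= rpow x p.
Proof. unfold rpow; destruct (Rlt_dec 0 x); [left; apply exp_pos|lra]. Qed.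

Lemma rpow_pos x p : 0 < x -> rpow x p = Rpower x p.
Proof. intros H; unfold rpow; destruct (Rlt_dec 0 x); [reflexivity|lra]. Qed.

Lemma rpow_npos x p : x <= 0 -> rpow x p = 0.
Proof. intros H; unfold rpow; destruct (Rlt_dec 0 x); [lra|reflexivity]. Qed.

Lemma ln_le_sub_1 x : 0 < x -> ln x <= x - 1.
Proof.
  intros Hx; pose proof (exp_ineq1_le (ln x)) as H; rewrite exp_ln in H; lra.
Qed.

Lemma ln_quotient x y : 0 < x -> 0 < y -> ln (x / y) = ln x - ln y.
Proof.
  intros Hx Hy; unfold Rdiv; rewrite ln_mult, ln_Rinv; try assumption; [ring|].
  apply Rinv_0_lt_compat; assumption.
Qed.

Lemma rpow_le x y p : 0 < p -> x <= y -> rpow x p <= rpow y p.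
Proof.
  intros Hp H; destruct (Rle_lt_dec x 0) as [Hx|Hx]; [rewrite rpow_npos by assumption; apply rpow_nonneg|].
  rewrite !rpow_pos by lra; apply Rle_Rpower_l; lra.
Qed.

Lemma rpow_mult_base x y p : 0 <= x -> 0 <= y -> rpow (x * y) p = rpow x p * rpow y p.
Proof.
  intros [Hx|<-] [Hy|<-]; rewrite ?Rmult_0_l, ?Rmult_0_r, ?(rpow_npos 0) by lra; try ring.
  rewrite !rpow_pos by nra; symmetry; apply Rpower_mult_distr; assumption.
Qed.

(* Weighted AM-GM between [t ^ p] and [1], with weights [1 / p] and [1 - 1 / p]. *)
Lemma rpow_bernoulli t p : 1 < p -> 0 <= t -> 1 + p * (t - 1) <= rpow t p.
Proof.
  intros Hp [Ht|<-]; [|rewrite rpow_npos; lra].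
  rewrite rpow_pos by assumption.
  set (a := Rpower t p); assert (Ha : 0 < a) by apply exp_pos.
  set (m := (a + (p - 1)) / p).
  assert (Hm : 0 < m) by (apply Rdiv_lt_0_compat; lra).
  assert (Em : p * m = a + (p - 1)) by (unfold m; field; lra).
  assert (Hla : ln a = p * ln t) by (unfold a, Rpower; apply ln_exp).
  assert (H1 : ln a - ln m <= a / m - 1).
  { rewrite <- ln_quotient by assumption; apply ln_le_sub_1, Rdiv_lt_0_compat; assumption. }
  assert (H2 : - ln m <= 1 / m - 1).
  { replace (- ln m) with (ln (1 / m)) by (rewrite ln_quotient, ln_1 by lra; ring).
    apply ln_le_sub_1, Rdiv_lt_0_compat; lra. }
  assert (H3 : a / m + (p - 1) * (1 / m) = p).
  { replace (a / m + (p - 1) * (1 / m)) with ((a + (p - 1)) / m) by (field; lra).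
    rewrite <- Em; field; lra. }
  assert (H4 : ln t <= ln m).
  { assert (p * (ln t - ln m) <= 0).
    2: { apply Rnot_lt_le; intros Hlt; assert (0 < p * (ln t - ln m)) by (apply Rmult_lt_0_compat; lra); lra. }
    replace (p * (ln t - ln m)) with ((ln a - ln m) + (p - 1) * (- ln m)) by (rewrite Hla; ring).
    assert ((p - 1) * (- ln m) <= (p - 1) * (1 / m - 1)) by (apply Rmult_le_compat_l; lra). lra. }
  assert (t <= m); [|assert (p * t <= p * m) by (apply Rmult_le_compat_l; lra); lra].
  apply Rnot_lt_le; intros Hlt; pose proof (ln_increasing m t Hm Hlt); lra.
Qed.

Lemma rpow_jensen n (w x : nat -> R) p :
  1 < p -> (forall i, (i < n)%nat -> 0 <= w i) -> rsum n w <= 1 ->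
  (forall i, (i < n)%nat -> 0 <= x i) ->
  rpow (rsum n (fun i => w i * x i)) p <= rsum n (fun i => w i * rpow (x i) p).
Proof.
  intros Hp Hw Hs Hx; set (y := rsum n (fun i => w i * x i)).
  destruct (Rle_lt_dec y 0) as [Hy|Hy].
  - rewrite rpow_npos by assumption; apply rsum_nonneg; intros.
    apply Rmult_le_pos; [auto|apply rpow_nonneg].
  - set (a := rpow y p).
    assert (Ha : 0 <= a) by apply rpow_nonneg.
    apply Rle_trans with (rsum n (fun i => (a * (1 - p)) * w i + (a * p / y) * (w i * x i))).
    + rewrite rsum_plus, !rsum_scal; fold y.
      replace (a * p / y * y) with (a * p) by (field; lra).
      assert (0 <= a * (p - 1) * (1 - rsum n w)) by (repeat apply Rmult_le_pos; lra). lra.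
    + apply rsum_le; intros i Hi.
      replace (x i) with (y * (x i / y)) at 2 by (field; lra).
      assert (0 <= x i / y) by (apply Rmult_le_pos; [auto|left; apply Rinv_0_lt_compat; assumption]).
      rewrite rpow_mult_base by lra; fold a.
      replace (a * (1 - p) * w i + a * p / y * (w i * x i))
        with (w i * (a * (1 + p * (x i / y - 1)))) by (field; lra).
      apply Rmult_le_compat_l; [auto|]; apply Rmult_le_compat_l; [assumption|].
      apply rpow_bernoulli; assumption.
Qed.

Lemma Un_cv_rpow x l p : 1 < p -> Un_cv x l -> Un_cv (fun j => rpow (x j) p) (rpow l p).
Proof.
  intros Hp H; destruct (Rtotal_order l 0) as [Hl|[->|Hl]].
  - intros e He; destruct (H (- l)) as [N HN]; [lra|].
    exists N; intros j Hj; specialize (HN j Hj); apply Rabs_def2 in HN.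
    rewrite !rpow_npos, Rdist_eq by lra; assumption.
  (* At the cut-off point the derivative argument fails; instead [0 < x < 1] and [p > 1] give
     [x ^ p <= x]. *)
  - intros e He; destruct (H (Rmin e 1)) as [N HN]; [apply Rmin_glb_lt; lra|].
    exists N; intros j Hj; specialize (HN j Hj); unfold Rdist in *.
    rewrite (rpow_npos 0), Rminus_0_r, Rabs_right by (try apply Rle_ge, rpow_nonneg; lra).
    rewrite Rminus_0_r in HN; pose proof (Rmin_l e 1); pose proof (Rmin_r e 1).
    destruct (Rle_lt_dec (x j) 0) as [Hx|Hx]; [rewrite rpow_npos; lra|].
    rewrite Rabs_right in HN by lra.
    rewrite rpow_pos by assumption.
    apply Rle_lt_trans with (Rpower (x j) 1); [|rewrite Rpower_1; lra].
    unfold Rpower.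
    assert (ln (x j) <= 0) by (rewrite <- ln_1; left; apply ln_increasing; lra).
    assert (p * ln (x j) <= 1 * ln (x j)) as [Hlt| ->] by nra; [|lra].
    left; apply exp_increasing; assumption.
  - assert (HR : continuity_pt (fun t => Rpower t p) l).
    { apply derivable_continuous_pt; exists (p * Rpower l (p - 1)).
      apply derivable_pt_lim_power; assumption. }
    pose proof (continuity_seq _ _ _ HR H) as Hc.
    intros e He; destruct (Hc e He) as [N1 HN1]; destruct (H l Hl) as [N2 HN2].
    exists (N1 + N2)%nat; intros j Hj; specialize (HN2 j ltac:(lia)); apply Rabs_def2 in HN2.
    rewrite !rpow_pos by lra; apply HN1; lia.
Qed.

(** [eigvals] is an epsilon choice, so it is the spectral theorem that gives it content; every later
    statement about trace powers passes through here. *)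
Lemma eigvals_spectral n A : hermitian n A -> spectral n A (eigvals n A).
Proof.
  intros H; unfold eigvals; apply epsilon_spec, spectral_exists; assumption.
Qed.

Lemma quad_idm n f : quad n idm f = RtoC (norm2 n f).
Proof.
  rewrite quad_inner, <- inner_self; apply inner_ext; intros i Hi; [reflexivity|].
  rewrite (csum_ext n _ (fun j => if Nat.eqb j i then f j else C0)).
  - apply csum_delta; assumption.
  - intros j Hj; unfold idm; rewrite Nat.eqb_sym; destruct (Nat.eqb j i); ring.
Qed.

Lemma unitary_parseval n U f :
  unitary n U -> rsum n (fun k => Cnorm2 (inner n (col U k) f)) = norm2 n f.
Proof.
  intros HU; assert (HI := unitary_right_inverse n U HU).
  enough (E : RtoC (rsum n (fun k => Cnorm2 (inner n (col U k) f))) = RtoC (norm2 n f))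
    by (apply (f_equal fst) in E; exact E).
  transitivity (quad n idm f).
  - rewrite (quad_ext n idm (fun i j => csum n (fun k => Cmul (U i k) (Cmul (RtoC 1) (Cconj (U j k))))) f f).
    + pose proof (quad_rank_one_sum n n (fun _ => 1) (col U) f) as Q; unfold col at 1 2 in Q.
      rewrite Q; f_equal; apply rsum_ext; intros; ring.
    + intros i j Hi Hj; rewrite <- HI by assumption; unfold mmul, adj; apply csum_ext.
      intros; Cext; ring.
    + reflexivity.
  - apply quad_idm.
Qed.

Lemma spectral_quad n A lam : spectral n A lam ->
  exists U, unitary n U /\
    (forall v, fst (quad n A v) = rsum n (fun k => lam k * Cnorm2 (inner n (col U k) v))) /\
    (forall k, (k < n)%nat -> lam k = fst (quad n A (col U k))).
Proof.
  intros (U & HU & HA); exists U.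
  assert (Q : forall v, fst (quad n A v) = rsum n (fun k => lam k * Cnorm2 (inner n (col U k) v))).
  { intros v; rewrite (quad_ext n _ _ v v HA) by reflexivity.
    rewrite (quad_rank_one_sum n n lam (fun k i => U i k) v); reflexivity. }
  repeat split; [assumption|assumption|].
  intros k Hk; rewrite Q, (rsum_ext n _ (fun l => if Nat.eqb l k then lam l else 0)).
  - rewrite rsum_delta by assumption; reflexivity.
  - intros l Hl; rewrite (proj1 (unitary_inner n U) HU) by assumption.
    destruct (Nat.eqb l k); unfold Cnorm2; simpl; ring.
Qed.

Lemma trace_spectral n A lam : spectral n A lam -> trace n A = RtoC (rsum n lam).
Proof.
  intros (U & HU & HA); unfold trace.
  rewrite (csum_ext n _ _ (fun i Hi => HA i i Hi Hi)), csum_exchange, <- csum_RtoC.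
  apply csum_ext; intros k Hk.
  rewrite (csum_ext n _ (fun i => Cmul (RtoC (lam k)) (RtoC (Cnorm2 (col U k i))))).
  - rewrite csum_mul_l, csum_RtoC; fold (norm2 n (col U k)).
    rewrite (unitary_norm2 n U k HU Hk); Cext; ring.
  - intros i Hi; rewrite <- Cmul_conj_r; unfold col; ring.
Qed.

Lemma psd_eigvals n A : psd n A ->
  exists U, unitary n U /\
    (forall v, fst (quad n A v) = rsum n (fun k => eigvals n A k * Cnorm2 (inner n (col U k) v))) /\
    (forall k, (k < n)%nat -> eigvals n A k = fst (quad n A (col U k))) /\
    (forall k, (k < n)%nat -> 0 <= eigvals n A k).
Proof.
  intros [H1 H2]; destruct (spectral_quad n A _ (eigvals_spectral n A H1)) as (U & HU & HQ & HE).
  exists U; repeat split; auto; intros k Hk; rewrite HE by assumption; apply H2.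
Qed.

Lemma rpow_quad_le n A p f : 1 < p -> psd n A -> norm2 n f <= 1 ->
  forall U, (forall v, fst (quad n A v) = rsum n (fun k => eigvals n A k * Cnorm2 (inner n (col U k) v))) ->
  unitary n U ->
  rpow (fst (quad n A f)) p <= rsum n (fun k => Cnorm2 (inner n (col U k) f) * rpow (eigvals n A k) p).
Proof.
  intros Hp HA Hf U HQ HU; destruct (psd_eigvals n A HA) as (_ & _ & _ & _ & HE).
  rewrite HQ, (rsum_ext n _ (fun k => Cnorm2 (inner n (col U k) f) * eigvals n A k)) by (intros; ring).
  apply rpow_jensen; auto; [intros; apply Cnorm2_nonneg|].
  rewrite unitary_parseval by assumption; assumption.
Qed.

Lemma rpow_quad_le_trpow n A p f : 1 < p -> psd n A -> norm2 n f <= 1 ->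
  rpow (fst (quad n A f)) p <= trpow n p A.
Proof.
  intros Hp HA Hf; destruct (psd_eigvals n A HA) as (U & HU & HQ & _ & _).
  eapply Rle_trans; [apply (rpow_quad_le n A p f Hp HA Hf U HQ HU)|].
  apply rsum_le; intros k Hk.
  assert (Cnorm2 (inner n (col U k) f) <= 1).
  { rewrite <- (unitary_parseval n U f HU) in Hf; eapply Rle_trans; [|exact Hf].
    apply (rsum_term_le n (fun k => Cnorm2 (inner n (col U k) f))); [intros; apply Cnorm2_nonneg|assumption]. }
  pose proof (rpow_nonneg (eigvals n A k) p); nra.
Qed.

(** A Schur-type inequality: the squared overlaps of two orthonormal bases form a doubly stochastic
    matrix, so Jensen is applied in each row and Parseval in each column. Equality at an eigenbasis
    makes the trace power a maximum of continuous functions, which replaces continuity of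
    eigenvalues. *)
Lemma rpow_diag_le_trpow n A p V : 1 < p -> psd n A -> unitary n V ->
  rsum n (fun i => rpow (fst (quad n A (col V i))) p) <= trpow n p A.
Proof.
  intros Hp HA HV; destruct (psd_eigvals n A HA) as (U & HU & HQ & _ & _).
  apply Rle_trans with (rsum n (fun i => rsum n (fun k =>
    Cnorm2 (inner n (col U k) (col V i)) * rpow (eigvals n A k) p))).
  - apply rsum_le; intros i Hi; apply rpow_quad_le; auto.
    rewrite (unitary_norm2 n V i) by assumption; lra.
  - rewrite rsum_exchange; right; apply rsum_ext; intros k Hk.
    rewrite rsum_scal_r, (rsum_ext n _ (fun i => Cnorm2 (inner n (col V i) (col U k)))).
    + rewrite unitary_parseval, unitary_norm2 by assumption; ring.
    + intros i Hi; rewrite <- inner_conj, Cnorm2_conj; reflexivity.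
Qed.

Lemma trpow_pos n A p : density n A -> 0 < trpow n p A.
Proof.
  intros [HA HT]; destruct (psd_eigvals n A HA) as (_ & _ & _ & _ & HE).
  rewrite (trace_spectral n A _ (eigvals_spectral n A (proj1 HA))) in HT.
  apply (f_equal fst) in HT; simpl in HT.
  destruct (Rlt_le_dec 0 (trpow n p A)) as [|Hle]; [assumption|exfalso].
  rewrite rsum_zero in HT; [lra|]; intros k Hk.
  destruct (HE k Hk) as [Hpos|]; [|auto]; exfalso.
  assert (rpow (eigvals n A k) p <= trpow n p A).
  { apply (rsum_term_le n (fun k => rpow (eigvals n A k) p)); [intros; apply rpow_nonneg|assumption]. }
  rewrite rpow_pos in H by assumption.
  pose proof (exp_pos (p * ln (eigvals n A k))); unfold Rpower in H; lra.
Qed.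

Lemma trabspow_trpow n A p : psd n A -> trabspow n p A = trpow n p A.
Proof.
  intros HA; destruct (psd_eigvals n A HA) as (_ & _ & _ & _ & HE).
  apply rsum_ext; intros k Hk; rewrite Rabs_right; [reflexivity|apply Rle_ge; auto].
Qed.

(** * Minimum output entropy and maximal output norm *)

Definition output_continuous (n m : nat) (N : Map) : Prop :=
  forall (x : nat -> Vec) (l : Vec), (forall i, (i < n)%nat -> Ccv (fun j => x j i) (l i)) ->
    forall a b, (a < m)%nat -> (b < m)%nat -> Ccv (fun j => N (pure (x j)) a b) (N (pure l) a b).

Lemma unit_vec_exists n : (0 < n)%nat -> exists v, unit_vec n v.
Proof.
  intros Hn; exists (fun i => if Nat.eqb i 0 then C1 else C0); unfold unit_vec.
  rewrite (rsum_ext n _ (fun i => if Nat.eqb i 0 then 1 else 0)).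
  - apply (rsum_delta n 0 (fun _ => 1) Hn).
  - intros i Hi; destruct (Nat.eqb i 0); unfold Cnorm2; simpl; ring.
Qed.

(* The trace power is the maximum over orthonormal bases of the diagonal power sum, so the minimum of the
   entropy is found by maximising jointly over the input vector and the basis. *)
Lemma is_Hmin_exists n m N p :
  1 < p -> (0 < n)%nat -> output_continuous n m N ->
  (forall v, unit_vec n v -> density m (N (pure v))) ->
  (forall v w, (forall i, (i < n)%nat -> v i = w i) -> agree m (N (pure v)) (N (pure w))) ->
  exists h, is_Hmin n m N p h.
Proof.
  intros Hp Hn HC HD HE.
  (* A point of the compact set is an input vector of length [n] followed by the [m * m] entries of
     a basis of the output space. *)
  set (basis := fun w : Vec => mat_of_vec m (fun i => w (n + i)%nat)).
  set (F := fun w : Vec => rsum m (fun i => rpow (fst (quad m (N (pure w)) (col (basis w) i))) p)).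
  set (pack := fun (v : Vec) U i => if Nat.ltb i n then v i else vec_of_mat m U (i - n)%nat).
  assert (Hpv : forall v U i, (i < n)%nat -> pack v U i = v i).
  { intros v U i Hi; unfold pack; destruct (Nat.ltb_spec i n); [reflexivity|lia]. }
  assert (HpU : forall v U i j, (i < m)%nat -> (j < m)%nat -> basis (pack v U) i j = U i j).
  { intros v U i j Hi Hj; unfold basis, pack, mat_of_vec.
    destruct (Nat.ltb_spec (n + (i * m + j)) n); [lia|].
    replace (n + (i * m + j) - n)%nat with (i * m + j)%nat by lia.
    apply mat_of_vec_of_mat; assumption. }
  set (P := fun w : Vec => unit_vec n w /\ unitary m (basis w)).
  assert (HP : forall v U, unit_vec n v -> unitary m U -> P (pack v U)).
  { intros v U Hv HU; split.
    - unfold unit_vec in *; rewrite <- Hv; apply rsum_ext; intros; rewrite Hpv; auto.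
    - intros i j Hi Hj; rewrite <- (HU i j Hi Hj); unfold mmul, adj; apply csum_ext.
      intros; rewrite !HpU by assumption; reflexivity. }
  destruct (unit_vec_exists n Hn) as [v0 Hv0].
  destruct (max_attained (n + m * m) P F (pack v0 idm)) as (w & Hw & Hmax).
  - apply HP; [assumption|apply unitary_idm].
  - intros w [Hw HU] i Hi; destruct (Nat.lt_ge_cases i n) as [Hin|Hin].
    + unfold unit_vec in Hw; rewrite <- Hw.
      apply (rsum_term_le n (fun i => Cnorm2 (w i))); [intros; apply Cnorm2_nonneg|assumption].
    + destruct (div_mod_lt m m (i - n)) as [[H1 H2] E]; [lia|].
      pose proof (Cnorm2_unitary_le m _ _ _ HU H1 H2) as B.
      unfold basis, mat_of_vec in B; rewrite <- E in B.
      replace (n + (i - n))%nat with i in B by lia; exact B.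
  - intros x l Hx Hl.
    assert (Hv : forall i, (i < n)%nat -> Ccv (fun j => x j i) (l i)) by (intros; apply Hl; lia).
    assert (HU : forall i k, (i < m)%nat -> (k < m)%nat -> Ccv (fun j => basis (x j) i k) (basis l i k)).
    { intros i k Hi Hk; apply (Hl (n + (i * m + k))%nat); nia. }
    repeat split.
    + apply Un_cv_unique_const with (fun j => rsum n (fun i => Cnorm2 (x j i))); [intros j; apply Hx|].
      apply (Un_cv_rsum n (fun j i => Cnorm2 (x j i))); intros; apply Un_cv_Cnorm2; auto.
    + apply (unitary_limit m (fun j => basis (x j))); [intros j; apply Hx|assumption].
    + apply (Un_cv_rsum m (fun j i => rpow (fst (quad m (N (pure (x j))) (col (basis (x j)) i))) p)).
      intros i Hi; apply Un_cv_rpow; [assumption|].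
      apply (Ccv_quad m (fun j => N (pure (x j))) _ (fun j => col (basis (x j)) i)).
      * intros; apply HC; assumption.
      * intros k Hk; apply HU; assumption.
  - exists (renyi m p (N (pure w))); split; [exists w; split; [apply Hw|reflexivity]|].
    intros v Hv.
    assert (Dw := HD w (proj1 Hw)); assert (Dv := HD v Hv).
    destruct (psd_eigvals m _ (proj1 Dv)) as (U & HU & _ & HQ & _).
    assert (T : trpow m p (N (pure v)) <= trpow m p (N (pure w))).
    { apply Rle_trans with (F w);
        [|apply (rpow_diag_le_trpow m (N (pure w)) p (basis w) Hp (proj1 Dw) (proj2 Hw))].
      (* In an eigenbasis [U] of the output at [v] the diagonal entries are the eigenvalues, so [F]
         equals the trace power there. *)
      apply Rle_trans with (F (pack v U)); [right|apply Hmax, HP; assumption].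
      apply rsum_ext; intros k Hk; rewrite HQ by assumption; do 2 f_equal.
      apply quad_ext; [apply HE; intros; symmetry; auto|].
      intros i Hi; unfold col; symmetry; auto. }
    pose proof (trpow_pos m (N (pure v)) p Dv) as Tv.
    assert (L : ln (trpow m p (N (pure v))) <= ln (trpow m p (N (pure w)))).
    { destruct T as [T| ->]; [left; apply ln_increasing; assumption|lra]. }
    unfold renyi; assert (/ (1 - p) < 0) by (apply Rinv_lt_0_compat; lra). nra.
Qed.

Lemma schatten_le m p A B : 1 < p -> density m A -> trpow m p A <= B -> schatten m p A <= Rpower B (/ p).
Proof.
  intros Hp HA HB; unfold schatten; rewrite trabspow_trpow by apply HA.
  pose proof (trpow_pos m A p HA).
  apply Rle_Rpower_l; [left; apply Rinv_0_lt_compat; lra|lra].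
Qed.

Lemma schatten_ge_quad m p A f : 1 < p -> density m A -> norm2 m f <= 1 ->
  0 < fst (quad m A f) -> fst (quad m A f) <= schatten m p A.
Proof.
  intros Hp HA Hf Hq; unfold schatten; rewrite trabspow_trpow by apply HA.
  pose proof (rpow_quad_le_trpow m A p f Hp (proj1 HA) Hf) as H; rewrite rpow_pos in H by assumption.
  rewrite <- (Rpower_1 (fst (quad m A f))) at 1 by assumption.
  replace 1 with (p * / p) by (field; lra); rewrite <- Rpower_mult.
  apply Rle_Rpower_l; [left; apply Rinv_0_lt_compat; lra|split; [apply exp_pos|assumption]].
Qed.

Lemma pure_density n v : unit_vec n v -> density n (pure v).
Proof.
  intros Hv; split; [split|].
  - intros i j Hi Hj; unfold adj, pure; rewrite Cconj_mul, Cconj_conj; ring.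
  - intros w.
    replace (quad n (pure v) w) with (Cmul (inner n w v) (inner n v w)).
    + rewrite <- (inner_conj n v w), Cmul_conj_l; simpl; apply Cnorm2_nonneg.
    + unfold inner; rewrite <- csum_prod; unfold quad, pure.
      apply csum_ext; intros; apply csum_ext; intros; ring.
  - unfold trace, pure; rewrite (csum_ext n _ (fun i => RtoC (Cnorm2 (v i)))).
    + rewrite csum_RtoC, Hv; reflexivity.
    + intros; apply Cmul_conj_r.
Qed.

(** Since [is_nu] asks for a least upper bound, order completeness provides it; the uniform
    trace-power bound gives both boundedness and the estimate on [nu]. *)
Lemma is_nu_exists n m N p B :
  1 < p -> (0 < n)%nat -> (forall rho, density n rho -> density m (N rho)) ->
  (forall rho, density n rho -> trpow m p (N rho) <= B) ->
  exists nu, is_nu n m N p nu /\ nu <= Rpower B (/ p).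
Proof.
  intros Hp Hn HD HB; destruct (unit_vec_exists n Hn) as [v Hv].
  destruct (completeness (fun x => exists rho, density n rho /\ x = schatten m p (N rho))) as [nu Hnu].
  - exists (Rpower B (/ p)); intros x (rho & Hrho & ->); apply schatten_le; auto.
  - exists (schatten m p (N (pure v))), (pure v); split; [apply pure_density; assumption|reflexivity].
  - exists nu; split; [exact Hnu|]; apply Hnu; intros x (rho & Hrho & ->); apply schatten_le; auto.
Qed.

(** * Random signs *)

Definition upd (e : nat -> R) (j : nat) (x : R) : nat -> R := fun i => if Nat.eqb i j then x else e i.

(** The expectation over [N] independent fair signs, as an iterated mean in place of a probability
    space. Signs with index at least [N] are frozen at [1], so a witness is a sign at every
    index. *)
Fixpoint sign_avg (N : nat) (F : (nat -> R) -> R) : R :=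
  match N with
  | O => F (fun _ => 1)
  | S N => (sign_avg N (fun e => F (upd e N 1)) + sign_avg N (fun e => F (upd e N (-1)))) / 2
  end.

Definition is_sign (e : nat -> R) : Prop := forall i, e i = 1 \/ e i = -1.

Lemma sign_avg_exists N F b : sign_avg N F < b -> exists e, is_sign e /\ F e < b.
Proof.
  revert F; induction N as [|N IH]; simpl; intros F H.
  - exists (fun _ => 1); split; [intros i; auto|assumption].
  - assert (U : forall e x, is_sign e -> x = 1 \/ x = -1 -> is_sign (upd e N x)).
    { intros e x He Hx i; unfold upd; destruct (Nat.eqb i N); auto. }
    destruct (Rlt_le_dec (sign_avg N (fun e => F (upd e N 1))) b) as [H1|H1].
    + destruct (IH _ H1) as (e & He & HF); eauto.
    + destruct (IH (fun e => F (upd e N (-1)))) as (e & He & HF); [lra|eauto].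
Qed.

Lemma sign_avg_ext N F G : (forall e, F e = G e) -> sign_avg N F = sign_avg N G.
Proof.
  revert F G; induction N as [|N IH]; simpl; intros F G H; [apply H|].
  f_equal; f_equal; apply IH; intros; apply H.
Qed.

Lemma sign_avg_plus N F G : sign_avg N (fun e => F e + G e) = sign_avg N F + sign_avg N G.
Proof.
  revert F G; induction N as [|N IH]; simpl; intros F G; [reflexivity|].
  rewrite !IH; field.
Qed.

Lemma sign_avg_scal N a F : sign_avg N (fun e => a * F e) = a * sign_avg N F.
Proof.
  revert F; induction N as [|N IH]; simpl; intros F; [reflexivity|]. rewrite !IH; field.
Qed.

Lemma sign_avg_rsum N m (F : (nat -> R) -> nat -> R) :
  sign_avg N (fun e => rsum m (F e)) = rsum m (fun t => sign_avg N (fun e => F e t)).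
Proof.
  induction m as [|m IH]; simpl.
  - rewrite (sign_avg_ext N _ (fun e => 0 * 1)), sign_avg_scal by (intros; ring); ring.
  - rewrite sign_avg_plus, IH; reflexivity.
Qed.

(** The sharp exponent is [x ^ 2 / 2]; the weaker constant [2] allows a proof from [1 + x <= exp x]
    alone. For [|x| >= 1 / 2] already [|x| <= 2 x ^ 2]. *)
Lemma cosh_le x : (exp x + exp (- x)) / 2 <= exp (2 * x ^ 2).
Proof.
  assert (Hge : forall y, 1 / 2 <= y -> (exp y + exp (- y)) / 2 <= exp (2 * y ^ 2)).
  { intros y Hy; apply Rle_trans with (exp y).
    - assert (exp (- y) <= exp y) by (left; apply exp_increasing; lra); lra.
    - assert (y <= 2 * y ^ 2) as [H| <-] by nra; [left; apply exp_increasing; assumption|lra]. }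
  destruct (Rle_lt_dec (1 / 2) x) as [H|H]; [auto|].
  destruct (Rle_lt_dec (1 / 2) (- x)) as [H'|H'].
  { specialize (Hge (- x) H'); rewrite Ropp_involutive in Hge.
    replace ((- x) ^ 2) with (x ^ 2) in Hge by ring; lra. }
  (* [exp x <= 1 / (1 - x)] and [1 / (1 - x ^ 2) <= 1 + 2 x ^ 2] *)
  assert (E : forall y, -1 / 2 < y < 1 / 2 -> exp y <= / (1 - y)).
  { intros y Hy; pose proof (exp_ineq1_le (- y)).
    rewrite <- (Ropp_involutive y) at 1; rewrite exp_Ropp.
    apply Rinv_le_contravar; lra. }
  pose proof (E x ltac:(lra)) as E1; pose proof (E (- x) ltac:(lra)) as E2.
  apply Rle_trans with (1 + 2 * x ^ 2); [|apply exp_ineq1_le].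
  assert (x ^ 2 < 1 / 2) by nra.
  apply Rle_trans with ((/ (1 - x) + / (1 - - x)) / 2); [lra|].
  replace ((/ (1 - x) + / (1 - - x)) / 2) with (/ (1 - x ^ 2)).
  2: { field; repeat split; nra. }
  apply Rmult_le_reg_l with (1 - x ^ 2); [lra|]. rewrite Rinv_r by lra. nra.
Qed.

Lemma rsum_upd N e x a : rsum (S N) (fun i => upd e N x i * a i) = rsum N (fun i => e i * a i) + x * a N.
Proof.
  simpl; f_equal.
  - apply rsum_ext; intros i Hi; unfold upd; destruct (Nat.eqb_spec i N); [lia|reflexivity].
  - unfold upd; rewrite Nat.eqb_refl; reflexivity.
Qed.

Lemma sign_avg_exp_le N a :
  sign_avg N (fun e => exp (rsum N (fun i => e i * a i))) <= exp (2 * rsum N (fun i => a i ^ 2)).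
Proof.
  induction N as [|N IH]; [simpl; rewrite Rmult_0_r; lra|].
  assert (E : forall x, sign_avg N (fun e => exp (rsum (S N) (fun i => upd e N x i * a i)))
            = exp (x * a N) * sign_avg N (fun e => exp (rsum N (fun i => e i * a i)))).
  { intros x; rewrite <- sign_avg_scal; apply sign_avg_ext; intros e.
    rewrite rsum_upd, exp_plus; ring. }
  change (sign_avg (S N) (fun e => exp (rsum (S N) (fun i => e i * a i))))
    with ((sign_avg N (fun e => exp (rsum (S N) (fun i => upd e N 1 i * a i))) +
           sign_avg N (fun e => exp (rsum (S N) (fun i => upd e N (-1) i * a i)))) / 2).
  rewrite !E; set (A := sign_avg _ _) in *.
  replace (rsum (S N) (fun i => a i ^ 2)) with (a N ^ 2 + rsum N (fun i => a i ^ 2))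
    by (simpl; ring).
  rewrite Rmult_plus_distr_l, exp_plus.
  replace ((exp (1 * a N) * A + exp (-1 * a N) * A) / 2) with ((exp (a N) + exp (- a N)) / 2 * A).
  2: { replace (1 * a N) with (a N) by ring; replace (-1 * a N) with (- a N) by ring; field. }
  apply Rle_trans with ((exp (a N) + exp (- a N)) / 2 * exp (2 * rsum N (fun i => a i ^ 2))).
  - apply Rmult_le_compat_l; [|assumption].
    pose proof (exp_pos (a N)); pose proof (exp_pos (- a N)); lra.
  - apply Rmult_le_compat_r; [left; apply exp_pos|apply cosh_le].
Qed.

(** * Lattice points *)

(** Sums over the integer points of a cube of radius [B]. The union bound takes the form of a sum of
    nonnegative terms, so that averaging over signs can be exchanged with it. *)
Fixpoint grid_sum (B m : nat) (F : (nat -> R) -> R) : R :=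
  match m with
  | O => F (fun _ => 0)
  | S m => rsum (2 * B + 1) (fun t => grid_sum B m (fun x => F (upd x m (INR t - INR B))))
  end.

Definition grid_point (B m : nat) (x : nat -> R) : Prop :=
  forall i, (i < m)%nat -> exists t, (t < 2 * B + 1)%nat /\ x i = INR t - INR B.

Definition l1 (m : nat) (x : nat -> R) : R := rsum m (fun i => Rabs (x i)).

Lemma grid_sum_le B m F G : (forall x, F x <= G x) -> grid_sum B m F <= grid_sum B m G.
Proof.
  revert F G; induction m as [|m IH]; simpl; intros F G H; [apply H|].
  apply rsum_le; intros; apply IH; intros; apply H.
Qed.

Lemma grid_sum_ext B m F G : (forall x, F x = G x) -> grid_sum B m F = grid_sum B m G.
Proof. intros H; apply Rle_antisym; apply grid_sum_le; intros x; rewrite H; lra. Qed.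

Lemma grid_sum_scal B m a F : grid_sum B m (fun x => a * F x) = a * grid_sum B m F.
Proof.
  revert F; induction m as [|m IH]; simpl; intros F; [reflexivity|].
  rewrite <- rsum_scal; apply rsum_ext; intros; apply IH.
Qed.

Lemma grid_sum_const B m a : grid_sum B m (fun _ => a) = INR (2 * B + 1) ^ m * a.
Proof.
  induction m as [|m IH]; [simpl; ring|].
  cbn [grid_sum]; rewrite (rsum_ext _ _ _ (fun t _ => IH)), rsum_const, <- tech_pow_Rmult; ring.
Qed.

Lemma grid_sum_nonneg B m F : (forall x, 0 <= F x) -> 0 <= grid_sum B m F.
Proof.
  intros H; rewrite <- (Rmult_0_r (INR (2 * B + 1) ^ m)), <- grid_sum_const.
  apply grid_sum_le; assumption.
Qed.

(** The sum runs over functions that vanish beyond [m], while [x] is arbitrary there; this is why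
    [F] is assumed to see only the first [m] coordinates. *)
Lemma grid_sum_ge B m F x :
  (forall y, 0 <= F y) -> (forall y z, (forall i, (i < m)%nat -> y i = z i) -> F y = F z) ->
  grid_point B m x -> F x <= grid_sum B m F.
Proof.
  revert F; induction m as [|m IH]; intros F H0 HF Hx.
  - simpl; right; apply HF; intros; lia.
  - destruct (Hx m (Nat.lt_succ_diag_r m)) as (t & Ht & Ex).
    apply Rle_trans with (grid_sum B m (fun y => F (upd y m (INR t - INR B)))).
    + apply Rle_trans with (F (upd x m (INR t - INR B))).
      * right; apply HF; intros i Hi; unfold upd; destruct (Nat.eqb_spec i m); congruence.
      * apply (IH (fun y => F (upd y m (INR t - INR B)))); [auto| |intros i Hi; apply Hx; lia].
        intros y z Hyz; apply HF; intros i Hi; unfold upd; destruct (Nat.eqb_spec i m); [reflexivity|].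
        apply Hyz; lia.
    + apply (rsum_term_le (2 * B + 1) (fun t => grid_sum B m (fun y => F (upd y m (INR t - INR B)))));
        [|assumption].
      intros; apply grid_sum_nonneg; auto.
Qed.

Lemma sign_avg_grid_sum N B m (F : (nat -> R) -> (nat -> R) -> R) :
  sign_avg N (fun e => grid_sum B m (F e)) = grid_sum B m (fun x => sign_avg N (fun e => F e x)).
Proof.
  revert F; induction m as [|m IH]; intros F; [reflexivity|].
  cbn [grid_sum]; rewrite sign_avg_rsum; apply rsum_ext; intros t _.
  apply (IH (fun e x => F e (upd x m (INR t - INR B)))).
Qed.

Lemma exp_1_ge_2 : 2 <= exp 1.
Proof. pose proof (exp_ineq1_le 1); lra. Qed.

(** The centre contributes [1], and each side is a geometric series of ratio [1 / e <= 1 / 2], hence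
    at most [1]. The bound is independent of [B]: with this weight, enlarging the cube costs nothing
    in the union bound. *)
Lemma rsum_exp_abs_le B : rsum (2 * B + 1) (fun t => exp (- Rabs (INR t - INR B))) <= 3.
Proof.
  set (f := fun t => exp (- Rabs (INR t - INR B))).
  assert (D : forall x, 2 * exp x <= exp (x + 1)).
  { intros x; rewrite exp_plus, Rmult_comm; apply Rmult_le_compat_l; [left; apply exp_pos|apply exp_1_ge_2]. }
  assert (L : forall T, (T <= B)%nat -> rsum T f <= exp (INR T - INR B)).
  { induction T as [|T IH]; intros HT; [left; apply exp_pos|].
    cbn [rsum]; rewrite S_INR; replace (INR T + 1 - INR B) with ((INR T - INR B) + 1) by ring.
    assert (f T = exp (INR T - INR B)) as ->.
    { unfold f; rewrite Rabs_left1, Ropp_involutive; [reflexivity|].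
      apply Rle_minus, le_INR; lia. }
    specialize (IH ltac:(lia)); specialize (D (INR T - INR B)); lra. }
  assert (U : forall T, rsum (B + 1 + T) f <= 3 - exp (- INR T)).
  { induction T as [|T IH].
    - rewrite Nat.add_0_r, Nat.add_1_r; cbn [rsum]; simpl INR; rewrite Ropp_0, exp_0.
      specialize (L B (Nat.le_refl B)); rewrite Rminus_diag, exp_0 in L.
      unfold f; rewrite Rminus_diag, Rabs_R0, Ropp_0, exp_0; fold f; lra.
    - rewrite Nat.add_succ_r; cbn [rsum].
      assert (f (B + 1 + T)%nat = exp (- INR (S T))) as ->.
      { unfold f; rewrite !plus_INR, (S_INR T), INR_1; do 2 f_equal.
        rewrite Rabs_right; [ring|]; pose proof (pos_INR T); lra. }
      specialize (D (- INR (S T))); rewrite S_INR in *.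
      replace (- (INR T + 1) + 1) with (- INR T) in D by ring; lra. }
  replace (2 * B + 1)%nat with (B + 1 + B)%nat by lia.
  specialize (U B); pose proof (exp_pos (- INR B)); lra.
Qed.

Lemma grid_sum_exp_l1_le B m : grid_sum B m (fun x => exp (- l1 m x)) <= 3 ^ m.
Proof.
  induction m as [|m IH]; [unfold l1; simpl; rewrite Ropp_0, exp_0; lra|].
  cbn [grid_sum].
  rewrite (rsum_ext _ _ (fun t => exp (- Rabs (INR t - INR B)) * grid_sum B m (fun x => exp (- l1 m x)))).
  - rewrite rsum_scal_r; simpl pow.
    apply Rmult_le_compat.
    + apply rsum_nonneg; intros; left; apply exp_pos.
    + apply grid_sum_nonneg; intros; left; apply exp_pos.
    + apply rsum_exp_abs_le.
    + assumption.
  - intros t _; rewrite <- grid_sum_scal; apply grid_sum_ext; intros x.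
    rewrite <- exp_plus; f_equal; unfold l1; cbn [rsum].
    rewrite (rsum_ext m _ (fun i => Rabs (x i))).
    + unfold upd; rewrite Nat.eqb_refl; ring.
    + intros i Hi; unfold upd; destruct (Nat.eqb_spec i m); [lia|reflexivity].
Qed.

(** Rounding towards zero never increases the absolute value, so a rounded vector stays in the ball
    it came from; rounding to the nearest integer could leave it. *)
Definition round0 (t : R) : R :=
  if Rle_dec 0 t then IZR (Int_part t) else - IZR (Int_part (- t)).

Lemma round0_spec t :
  Rabs (t - round0 t) <= 1 /\ Rabs (round0 t) <= Rabs t /\ Rabs (round0 t) <= round0 t ^ 2 /\
  forall B : nat, Rabs t <= INR B -> exists j, (j < 2 * B + 1)%nat /\ round0 t = INR j - INR B.
Proof.
  assert (Hint : forall s, 0 <= s -> (0 <= Int_part s)%Z /\ IZR (Int_part s) <= s < IZR (Int_part s) + 1).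
  { intros s Hs; destruct (base_Int_part s) as [H1 H2]; split; [|lra].
    assert (-1 < Int_part s)%Z; [apply lt_IZR; lra|lia]. }
  assert (Hz : exists z : Z, round0 t = IZR z /\ Rabs (t - IZR z) <= 1 /\ Rabs (IZR z) <= Rabs t).
  { unfold round0; destruct (Rle_dec 0 t) as [H|H].
    - destruct (Hint t H) as [Hz H1]; exists (Int_part t); apply IZR_le in Hz.
      rewrite !Rabs_right by lra; lra.
    - destruct (Hint (- t)) as [Hz H1]; [lra|]; exists (- Int_part (- t))%Z; apply IZR_le in Hz.
      rewrite opp_IZR, !Rabs_left1 by lra; lra. }
  destruct Hz as (z & -> & H1 & H2); repeat split; try assumption.
  - replace (IZR z ^ 2) with (IZR (z * z)) by (rewrite mult_IZR; ring).
    rewrite <- abs_IZR; apply IZR_le; nia.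
  - intros B HB; exists (Z.to_nat (z + Z.of_nat B)).
    assert (Hz : (- Z.of_nat B <= z <= Z.of_nat B)%Z).
    { assert (Rabs (IZR z) <= IZR (Z.of_nat B)) as H by (rewrite <- INR_IZR_INZ; lra).
      rewrite <- abs_IZR in H; apply le_IZR in H; lia. }
    split; [lia|]. rewrite INR_IZR_INZ, Z2Nat.id, plus_IZR, <- INR_IZR_INZ by lia; ring.
Qed.

(** * The random tensor *)

Definition sumsq (n : nat) (f : nat -> R) : R := rsum n (fun i => f i ^ 2).

Lemma sumsq_nonneg n f : 0 <= sumsq n f.
Proof. apply rsum_nonneg; intros; apply pow2_ge_0. Qed.

Lemma sumsq_scal n a f : sumsq n (fun i => a * f i) = a ^ 2 * sumsq n f.
Proof. unfold sumsq; rewrite <- rsum_scal; apply rsum_ext; intros; ring. Qed.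

(* Sign number [(b * k + i) * n + l] is the entry with output index [b < d], environment index [i < k] and
   input index [l < n]; [U] is a [d x r] matrix and [c] an [r x k] matrix stored row by row. *)
Definition coef (r k n : nat) (U : nat -> nat -> R) (c f : nat -> R) (m : nat) : R :=
  rsum r (fun a => U (m / n / k)%nat a * c (a * k + (m / n) mod k)%nat) * f (m mod n)%nat.

(** Written as a linear form in the signs, so that the exponential moment bound applies with
    variance [sumsq] of [coef]; [trilin_nested] recovers the trilinear shape. *)
Definition trilin (d r k n : nat) (e : nat -> R) (U : nat -> nat -> R) (c f : nat -> R) : R :=
  rsum (d * k * n) (fun m => e m * coef r k n U c f m).

(** The operator norm of [U], as a map from [r] to [d] dimensions, is at most [sqrt kappa]. *)
Definition bounded_by (kappa : R) (d r : nat) (U : nat -> nat -> R) : Prop :=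
  forall t, sumsq d (fun b => rsum r (fun a => U b a * t a)) <= kappa * sumsq r t.

Lemma rsum_flatten3 d k n (g : nat -> nat -> nat -> R) :
  rsum (d * k * n) (fun m => g (m / n / k)%nat ((m / n) mod k)%nat (m mod n)%nat)
  = rsum d (fun b => rsum k (fun i => rsum n (fun l => g b i l))).
Proof.
  rewrite rsum_flatten.
  rewrite (rsum_ext _ _ (fun q => rsum n (fun l => g (q / k)%nat (q mod k)%nat l))).
  - rewrite rsum_flatten; apply rsum_ext; intros b _; apply rsum_ext; intros i Hi.
    destruct (divmod_add k b i Hi) as [-> ->]; reflexivity.
  - intros q _; apply rsum_ext; intros l Hl; destruct (divmod_add n q l Hl) as [-> ->]; reflexivity.
Qed.

Lemma trilin_nested d r k n e U c f :
  trilin d r k n e U c f = rsum r (fun a => rsum k (fun i => c (a * k + i)%nat *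
    rsum d (fun b => rsum n (fun l => U b a * e ((b * k + i) * n + l)%nat * f l)))).
Proof.
  unfold trilin, coef.
  rewrite (rsum_ext _ _ (fun m => (fun b i l => rsum r (fun a =>
     c (a * k + i)%nat * (U b a * e ((b * k + i) * n + l)%nat * f l))) (m / n / k)%nat ((m / n) mod k)%nat (m mod n)%nat)).
  - rewrite (rsum_flatten3 d k n (fun b i l => rsum r (fun a =>
     c (a * k + i)%nat * (U b a * e ((b * k + i) * n + l)%nat * f l)))).
    symmetry; rewrite rsum_exchange, (rsum_exchange d k); apply rsum_ext; intros i _.
    rewrite (rsum_ext r _ (fun a => rsum d (fun b => rsum n (fun l =>
       c (a * k + i)%nat * (U b a * e ((b * k + i) * n + l)%nat * f l))))).
    + rewrite rsum_exchange; apply rsum_ext; intros b _; apply rsum_exchange.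
    + intros a _; rewrite <- rsum_scal; apply rsum_ext; intros; symmetry; apply rsum_scal.
  - intros m Hm; destruct (div_mod_lt (d * k) n m Hm) as [[Hq _] Em].
    destruct (div_mod_lt d k _ Hq) as [_ Eq]; cbv beta.
    rewrite <- Eq, <- Em, <- rsum_scal_r, <- rsum_scal; apply rsum_ext; intros; ring.
Qed.

(** The coefficients are those of [(U c)] tensor [f], so the squared norms multiply. Measuring [U]
    in operator norm keeps the variance free of [r]; the Frobenius norm of an isometry would bring
    in a factor [r]. *)
Lemma sumsq_coef_le kappa d r k n U c f :
  0 <= kappa -> bounded_by kappa d r U ->
  sumsq (d * k * n) (coef r k n U c f) <= kappa * sumsq (r * k) c * sumsq n f.
Proof.
  intros Hk HU; unfold sumsq at 1, coef.
  rewrite (rsum_flatten3 d k n (fun b i l => (rsum r (fun a => U b a * c (a * k + i)%nat) * f l) ^ 2)).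
  rewrite (rsum_ext d _ (fun b => rsum k (fun i => rsum r (fun a => U b a * c (a * k + i)%nat) ^ 2) * sumsq n f)).
  - rewrite rsum_scal_r; apply Rmult_le_compat_r; [apply sumsq_nonneg|].
    rewrite rsum_exchange.
    apply Rle_trans with (rsum k (fun i => kappa * sumsq r (fun a => c (a * k + i)%nat))).
    + apply rsum_le; intros i _; apply (HU (fun a => c (a * k + i)%nat)).
    + rewrite rsum_scal; right; f_equal; unfold sumsq; rewrite rsum_flatten, rsum_exchange; reflexivity.
  - intros b _; rewrite <- rsum_scal_r; apply rsum_ext; intros i _.
    rewrite <- sumsq_scal; reflexivity.
Qed.

Lemma trilin_sub_U d r k n e U V c f :
  trilin d r k n e (fun b a => U b a - V b a) c f = trilin d r k n e U c f - trilin d r k n e V c f.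
Proof.
  unfold trilin, coef; rewrite <- rsum_minus; apply rsum_ext; intros.
  rewrite <- Rmult_minus_distr_l, <- Rmult_minus_distr_r, <- rsum_minus; do 2 f_equal.
  apply rsum_ext; intros; ring.
Qed.

Lemma trilin_sub_c d r k n e U c c' f :
  trilin d r k n e U (fun a => c a - c' a) f = trilin d r k n e U c f - trilin d r k n e U c' f.
Proof.
  unfold trilin, coef; rewrite <- rsum_minus; apply rsum_ext; intros.
  rewrite <- Rmult_minus_distr_l, <- Rmult_minus_distr_r, <- rsum_minus; do 2 f_equal.
  apply rsum_ext; intros; ring.
Qed.

Lemma trilin_sub_f d r k n e U c f f' :
  trilin d r k n e U c (fun a => f a - f' a) = trilin d r k n e U c f - trilin d r k n e U c f'.
Proof.
  unfold trilin, coef; rewrite <- rsum_minus; apply rsum_ext; intros; ring.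
Qed.

Lemma trilin_scal d r k n e U c f x y z :
  trilin d r k n e (fun b a => x * U b a) (fun a => y * c a) (fun l => z * f l)
  = x * y * z * trilin d r k n e U c f.
Proof.
  unfold trilin, coef; rewrite <- rsum_scal; apply rsum_ext; intros i _.
  rewrite (rsum_ext r _ (fun a => (x * y) * (U (i / n / k)%nat a * c (a * k + (i / n) mod k)%nat))) by (intros; ring).
  rewrite rsum_scal; ring.
Qed.

Lemma trilin_ext d r k n e U U' c c' f f' :
  (forall b a, (b < d)%nat -> (a < r)%nat -> U b a = U' b a) ->
  (forall i, (i < r * k)%nat -> c i = c' i) -> (forall l, (l < n)%nat -> f l = f' l) ->
  trilin d r k n e U c f = trilin d r k n e U' c' f'.
Proof.
  intros HU Hc Hf; rewrite !trilin_nested.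
  apply rsum_ext; intros a Ha; apply rsum_ext; intros i Hi; rewrite Hc by nia; f_equal.
  apply rsum_ext; intros b Hb; apply rsum_ext; intros l Hl; rewrite HU, Hf by assumption; reflexivity.
Qed.

Lemma frobenius_bounded kappa d r D :
  rsum d (fun b => rsum r (fun a => D b a ^ 2)) <= kappa -> bounded_by kappa d r D.
Proof.
  intros H t; apply Rle_trans with (rsum d (fun b => rsum r (fun a => D b a ^ 2)) * sumsq r t).
  - rewrite <- rsum_scal_r; apply rsum_le; intros; apply rsum_cauchy_schwarz.
  - apply Rmult_le_compat_r; [apply sumsq_nonneg|assumption].
Qed.

Lemma contraction_entry d r U b a :
  bounded_by 1 d r U -> (b < d)%nat -> (a < r)%nat -> Rabs (U b a) <= 1.
Proof.
  intros HU Hb Ha; specialize (HU (fun i => if Nat.eqb i a then 1 else 0)).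
  assert (E : sumsq r (fun i => if Nat.eqb i a then 1 else 0) = 1).
  { unfold sumsq; rewrite (rsum_ext r _ (fun i => if Nat.eqb i a then 1 else 0)).
    - apply (rsum_delta r a (fun _ => 1) Ha).
    - intros i _; destruct (Nat.eqb i a); ring. }
  rewrite E, Rmult_1_r in HU.
  assert (U b a ^ 2 <= 1).
  { eapply Rle_trans; [|exact HU].
    eapply Rle_trans; [|apply (rsum_term_le d _ b)]; [|intros; apply pow2_ge_0|assumption].
    cbv beta; right; f_equal; rewrite (rsum_ext r _ (fun i => if Nat.eqb i a then U b i else 0)).
    - symmetry; apply rsum_delta; assumption.
    - intros i _; destruct (Nat.eqb i a); ring. }
  apply Rabs_le; nra.
Qed.

Lemma coef_ext d r k n U U' c c' f f' m :
  (m < d * k * n)%nat -> (forall b a, (b < d)%nat -> (a < r)%nat -> U b a = U' b a) ->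
  (forall i, (i < r * k)%nat -> c i = c' i) -> (forall l, (l < n)%nat -> f l = f' l) ->
  coef r k n U c f m = coef r k n U' c' f' m.
Proof.
  intros Hm HU Hc Hf; destruct (div_mod_lt (d * k) n m Hm) as [[Hq Hl] _].
  destruct (div_mod_lt d k _ Hq) as [[Hb Hi] _].
  unfold coef; rewrite Hf by assumption; f_equal; apply rsum_ext; intros a Ha.
  rewrite HU, Hc by nia; reflexivity.
Qed.

Definition grid_mat (M r : nat) (y : nat -> R) : nat -> nat -> R := fun b a => / INR M * y (b * r + a)%nat.
Definition grid_vec (h : R) (x : nat -> R) : nat -> R := fun i => h * x i.

(* Each summand has average at most [exp (- |x|_1 - |z|_1)]: the subtracted quadratic term compensates the
   exponential moment, whatever the sizes of the lattice points. *)
Lemma lattice_signs d r k n M B h lam b :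
  n = (r * k)%nat ->
  INR (2 * M + 1) ^ (d * r) * (3 ^ n * 3 ^ n) < b ->
  exists e, is_sign e /\ forall y x z,
    grid_point M (d * r) y -> grid_point B n x -> grid_point B n z ->
    exp (lam * trilin d r k n e (grid_mat M r y) (grid_vec h x) (grid_vec h z)
      - 2 * lam ^ 2 * sumsq (d * k * n) (coef r k n (grid_mat M r y) (grid_vec h x) (grid_vec h z))
      - l1 n x - l1 n z) < b.
Proof.
  intros En Hb.
  set (G := fun (e y x z : nat -> R) =>
    exp (lam * trilin d r k n e (grid_mat M r y) (grid_vec h x) (grid_vec h z)
      - 2 * lam ^ 2 * sumsq (d * k * n) (coef r k n (grid_mat M r y) (grid_vec h x) (grid_vec h z))
      - l1 n x - l1 n z)).
  set (F := fun e => grid_sum M (d * r) (fun y => grid_sum B n (fun x => grid_sum B n (fun z => G e y x z)))).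
  assert (Gext : forall e y y' x x' z z',
    (forall i, (i < d * r)%nat -> y i = y' i) -> (forall i, (i < n)%nat -> x i = x' i) ->
    (forall i, (i < n)%nat -> z i = z' i) -> G e y x z = G e y' x' z').
  { intros e y y' x x' z z' Hy Hx Hz; unfold G.
    assert (Hm : forall b a, (b < d)%nat -> (a < r)%nat -> grid_mat M r y b a = grid_mat M r y' b a)
      by (intros; unfold grid_mat; rewrite Hy by nia; reflexivity).
    assert (Hx' : forall i, (i < r * k)%nat -> grid_vec h x i = grid_vec h x' i) by (intros; unfold grid_vec; rewrite Hx by lia; reflexivity).
    assert (Hz' : forall i, (i < n)%nat -> grid_vec h z i = grid_vec h z' i) by (intros; unfold grid_vec; rewrite Hz by lia; reflexivity).
    assert (El : forall v v', (forall i, (i < n)%nat -> v i = v' i) -> l1 n v = l1 n v')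
      by (intros v v' H; apply rsum_ext; intros; rewrite H; auto).
    f_equal; rewrite (El x x' Hx), (El z z' Hz), (trilin_ext d r k n e _ _ _ _ _ _ Hm Hx' Hz').
    do 4 f_equal; apply rsum_ext; intros; f_equal; apply (coef_ext d); assumption. }
  assert (G0 : forall e y x z, 0 <= G e y x z) by (intros; left; apply exp_pos).
  assert (HF : sign_avg (d * k * n) F <= INR (2 * M + 1) ^ (d * r) * (3 ^ n * 3 ^ n)).
  { unfold F; rewrite (sign_avg_grid_sum _ M (d * r) (fun e y => grid_sum B n (fun x => grid_sum B n (fun z => G e y x z)))).
    rewrite <- grid_sum_const; apply grid_sum_le; intros y.
    rewrite (sign_avg_grid_sum _ B n (fun e x => grid_sum B n (fun z => G e y x z))).
    apply Rle_trans with (grid_sum B n (fun x => 3 ^ n * exp (- l1 n x))).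
    - apply grid_sum_le; intros x.
      rewrite (sign_avg_grid_sum _ B n (fun e z => G e y x z)).
      rewrite Rmult_comm; apply Rle_trans with (exp (- l1 n x) * grid_sum B n (fun z => exp (- l1 n z))).
      + rewrite <- grid_sum_scal; apply grid_sum_le; intros z.
        set (a := coef r k n (grid_mat M r y) (grid_vec h x) (grid_vec h z)).
        rewrite (sign_avg_ext _ _ (fun e => (exp (- (2 * lam ^ 2 * sumsq (d * k * n) a)) * (exp (- l1 n x) * exp (- l1 n z))) *
          exp (rsum (d * k * n) (fun m => e m * (lam * a m))))).
        * rewrite sign_avg_scal.
          rewrite <- (Rmult_1_l (exp (- l1 n x) * exp (- l1 n z))) at 2.
          rewrite (Rmult_comm (exp (- (_ * _)))), Rmult_assoc, Rmult_comm.
          apply Rmult_le_compat_r; [apply Rmult_le_pos; left; apply exp_pos|].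
          eapply Rle_trans; [apply Rmult_le_compat_l; [left; apply exp_pos|apply sign_avg_exp_le]|].
          rewrite <- exp_plus; right; rewrite <- exp_0; f_equal.
          fold (sumsq (d * k * n) (fun i => lam * a i)); rewrite sumsq_scal; ring.
        * intros e; rewrite <- !exp_plus; unfold G; f_equal.
          unfold trilin; fold a; rewrite <- rsum_scal.
          rewrite (rsum_ext _ (fun m => lam * (e m * a m)) (fun m => e m * (lam * a m))) by (intros; ring); ring.
      + apply Rmult_le_compat_l; [left; apply exp_pos|apply grid_sum_exp_l1_le].
    - rewrite grid_sum_scal; apply Rmult_le_compat_l; [apply pow_le; lra|apply grid_sum_exp_l1_le]. }
  destruct (sign_avg_exists (d * k * n) F b) as (e & He & Hlt); [lra|].
  exists e; split; [assumption|]; intros y x z Hy Hx Hz; change (G e y x z < b).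
  eapply Rle_lt_trans; [|exact Hlt]; unfold F.
  eapply Rle_trans; [|apply (grid_sum_ge M (d * r) _ y); [| |assumption]].
  - eapply Rle_trans; [|apply (grid_sum_ge B n _ x); [| |assumption]].
    + apply (grid_sum_ge B n (fun z => G e y x z) z); auto.
    + intros; apply grid_sum_nonneg; auto.
    + intros; apply grid_sum_ext; intros; apply Gext; auto.
  - intros; apply grid_sum_nonneg; intros; apply grid_sum_nonneg; auto.
  - intros; apply grid_sum_ext; intros; apply grid_sum_ext; intros; apply Gext; auto.
Qed.

(** * Rounding the arguments and bounding the supremum of the form *)

Lemma exp_pow x m : exp x ^ m = exp (x * INR m).
Proof.
  induction m as [|m IH]; [simpl; rewrite Rmult_0_r, exp_0; reflexivity|].
  rewrite S_INR, Rmult_plus_distr_l, Rmult_1_r, exp_plus, <- IH; simpl; ring.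
Qed.

(** At mesh [h = 1 / (4 sqrt n)] the squared error is at most [n h ^ 2 = 1 / 16], so four times the
    error is again in the unit ball. Integers satisfy [|z| <= z ^ 2], hence the [l1] norm is at most
    the squared norm, which is at most [1 / h ^ 2 = 16 n]. This keeps the cost of the vectors at
    [exp (O(n))], with no logarithm. *)
Lemma round_vector n c : (0 < n)%nat -> sumsq n c <= 1 ->
  let h := / (4 * sqrt (INR n)) in
  exists x, grid_point (4 * n) n x /\ sumsq n (grid_vec h x) <= 1 /\
    sumsq n (fun i => 4 * (c i - grid_vec h x i)) <= 1 /\ l1 n x <= 16 * INR n.
Proof.
  intros Hn Hc h; set (s := sqrt (INR n)) in *.
  assert (Hn1 : 1 <= INR n) by (apply (le_INR 1); lia).
  assert (Hs : s * s = INR n) by (apply sqrt_sqrt; lra).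
  assert (Hs1 : 1 <= s) by (unfold s; rewrite <- sqrt_1; apply sqrt_le_1_alt; assumption).
  assert (Hh : 0 < h) by (apply Rinv_0_lt_compat; lra).
  assert (Ehs : h * (4 * s) = 1) by (apply Rinv_l; lra).
  assert (Ehn : 16 * (h ^ 2 * INR n) = 1).
  { rewrite <- Hs; replace (16 * (h ^ 2 * (s * s))) with ((h * (4 * s)) * (h * (4 * s))) by ring.
    rewrite Ehs; ring. }
  set (x := fun i => round0 (4 * s * c i)).
  assert (Hci : forall i, (i < n)%nat -> Rabs (c i) <= 1).
  { intros i Hi; assert (c i ^ 2 <= 1).
    { eapply Rle_trans; [|exact Hc]; apply (rsum_term_le n (fun i => c i ^ 2)); [|assumption].
      intros; apply pow2_ge_0. }
    apply Rabs_le; nra. }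
  assert (Hsq : forall u v, Rabs u <= Rabs v -> u ^ 2 <= v ^ 2).
  { intros u v H; rewrite <- (pow2_abs u), <- (pow2_abs v); apply pow_incr; split; [apply Rabs_pos|assumption]. }
  assert (H1 : sumsq n (grid_vec h x) <= 1).
  { eapply Rle_trans; [|exact Hc]; apply rsum_le; intros i Hi.
    destruct (round0_spec (4 * s * c i)) as (_ & H & _).
    replace (c i) with (h * (4 * s * c i)) by (rewrite <- Rmult_assoc, Ehs; ring).
    apply Hsq; unfold grid_vec, x; rewrite !(Rabs_mult h); apply Rmult_le_compat_l; [apply Rabs_pos|assumption]. }
  exists x; repeat split; [|assumption| |].
  - intros i Hi; apply (round0_spec (4 * s * c i)).
    rewrite Rabs_mult, mult_INR, Rabs_right by lra.
    apply Rle_trans with (4 * s * 1); [apply Rmult_le_compat_l; [lra|auto]|].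
    simpl (INR 4); nra.
  - rewrite sumsq_scal; apply Rle_trans with (4 ^ 2 * (INR n * h ^ 2)); [|right; rewrite <- Ehn; ring].
    apply Rmult_le_compat_l; [lra|]; rewrite <- rsum_const; apply rsum_le; intros i Hi.
    destruct (round0_spec (4 * s * c i)) as (H & _).
    replace (c i - grid_vec h x i) with (h * (4 * s * c i - round0 (4 * s * c i))).
    + apply Hsq; rewrite Rabs_mult; rewrite <- (Rmult_1_r (Rabs h)) at 2.
      apply Rmult_le_compat_l; [apply Rabs_pos|assumption].
    + rewrite Rmult_minus_distr_l, <- (Rmult_assoc h), Ehs; unfold grid_vec, x; ring.
  - apply Rle_trans with (sumsq n x).
    + apply rsum_le; intros i Hi; apply (round0_spec (4 * s * c i)).
    + unfold grid_vec in H1; rewrite sumsq_scal in H1; pose proof (sumsq_nonneg n x).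
      replace (sumsq n x) with (16 * INR n * (h ^ 2 * sumsq n x)).
      * rewrite <- (Rmult_1_r (16 * INR n)) at 2; apply Rmult_le_compat_l; lra.
      * rewrite <- (Rmult_1_l (sumsq n x)) at 2; rewrite <- Ehn; ring.
Qed.

(** Mesh [1 / (4 d)] makes the Frobenius norm of four times the error at most [sqrt (r / d) <= 1].
    The rounded matrix satisfies [(u - v / 4) ^ 2 <= 2 u ^ 2 + v ^ 2 / 8], hence the constant [3].
    Counting all points of the box costs a logarithm of [d], which a large [k] absorbs. *)
Lemma round_contraction d r U : (0 < r)%nat -> (r <= d)%nat -> bounded_by 1 d r U ->
  exists y, grid_point (4 * d) (d * r) y /\ bounded_by 3 d r (grid_mat (4 * d) r y) /\
    bounded_by 1 d r (fun b a => 4 * (U b a - grid_mat (4 * d) r y b a)).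
Proof.
  intros Hr Hrd HU; set (M := (4 * d)%nat).
  assert (Hd1 : 1 <= INR d) by (apply (le_INR 1); lia).
  assert (EM : INR M = 4 * INR d) by (unfold M; rewrite mult_INR; simpl; ring).
  set (y := fun q => round0 (INR M * U (q / r)%nat (q mod r)%nat)).
  set (D := fun b a => 4 * (U b a - grid_mat M r y b a)).
  assert (HD : bounded_by 1 d r D).
  { apply frobenius_bounded.
    apply Rle_trans with (rsum d (fun _ => rsum r (fun _ => (4 * / INR M) ^ 2))).
    - apply rsum_le; intros b Hb; apply rsum_le; intros a Ha.
      unfold D, grid_mat, y; destruct (divmod_add r b a Ha) as [-> ->].
      destruct (round0_spec (INR M * U b a)) as (H & _).
      rewrite <- (pow2_abs (4 * / INR M)), <- pow2_abs; apply pow_incr; split; [apply Rabs_pos|].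
      replace (4 * (U b a - / INR M * round0 (INR M * U b a)))
        with (4 * / INR M * (INR M * U b a - round0 (INR M * U b a))) by (field; lra).
      rewrite Rabs_mult; rewrite <- (Rmult_1_r (Rabs (4 * / INR M))) at 2.
      apply Rmult_le_compat_l; [apply Rabs_pos|assumption].
    - rewrite !rsum_const, EM.
      replace (INR d * (INR r * (4 * / (4 * INR d)) ^ 2)) with (INR r / INR d) by (field; lra).
      apply Rmult_le_reg_r with (INR d); [lra|]; unfold Rdiv.
      rewrite Rmult_assoc, Rinv_l, Rmult_1_r, Rmult_1_l by lra; apply le_INR; assumption. }
  exists y; repeat split; [| |exact HD].
  - intros q Hq; destruct (div_mod_lt d r q Hq) as [[H1 H2] _].
    apply (round0_spec (INR M * U (q / r)%nat (q mod r)%nat)).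
    rewrite Rabs_mult, (Rabs_right (INR M)) by lra.
    rewrite <- (Rmult_1_r (INR M)) at 2; apply Rmult_le_compat_l; [lra|].
    apply (contraction_entry d r U); assumption.
  - intros t; specialize (HU t); specialize (HD t).
    apply Rle_trans with (2 * sumsq d (fun b => rsum r (fun a => U b a * t a))
       + / 8 * sumsq d (fun b => rsum r (fun a => D b a * t a))).
    + unfold sumsq at 1 2 3; rewrite <- !rsum_scal, <- rsum_plus; apply rsum_le; intros b _.
      replace (rsum r (fun a => grid_mat M r y b a * t a))
        with (rsum r (fun a => U b a * t a) - / 4 * rsum r (fun a => D b a * t a)).
      * set (u := rsum r _); set (v := rsum r _).
        assert (0 <= (u + / 4 * v) ^ 2) by apply pow2_ge_0; nra.
      * rewrite <- rsum_scal, <- rsum_minus; apply rsum_ext; intros a _; unfold D; field.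
    + pose proof (sumsq_nonneg r t); lra.
Qed.

Definition unit_ball (n : nat) (f : nat -> R) : Prop := sumsq n f <= 1.

(* Replacing the three arguments by lattice points costs three quarters of the supremum of the form. *)
Lemma tensor_signs d r k :
  (0 < r)%nat -> (r <= d)%nat -> (0 < k)%nat -> INR (8 * d + 1) ^ d <= exp (INR k) ->
  let n := (r * k)%nat in
  exists e, is_sign e /\ forall U c f, bounded_by 1 d r U -> unit_ball n c -> unit_ball n f ->
    trilin d r k n e U c f <= 124 * sqrt (INR n).
Proof.
  intros Hr Hrd Hk Hcount n; set (s := sqrt (INR n)); set (h := / (4 * s)).
  assert (Hn : (0 < n)%nat) by (unfold n; nia).
  assert (Hn1 : 1 <= INR n) by (apply (le_INR 1); lia).
  assert (Hs : s * s = INR n) by (apply sqrt_sqrt; lra).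
  assert (Hs1 : 1 <= s) by (unfold s; rewrite <- sqrt_1; apply sqrt_le_1_alt; assumption).
  assert (En : INR n = INR r * INR k) by (unfold n; apply mult_INR).
  (* The weighted count of lattice points is at most [exp n] for the matrix and [exp (2 n)] for each
     vector, so [exp (5 n)] in all, strictly below [exp (6 n)]. The choice [lam = 2 s], of order
     [sqrt n], makes the linear term at the target size and the quadratic term both of order [n]. *)
  destruct (lattice_signs d r k n (4 * d) (4 * n) h (2 * s) (exp (6 * INR n))) as (e & He & HL);
    [reflexivity| |].
  { assert (P3 : 3 ^ n <= exp (2 * INR n)).
    { rewrite <- exp_pow.
      apply pow_incr; split; [lra|]; pose proof (exp_ineq1_le 2); lra. }
    assert (PM : INR (2 * (4 * d) + 1) ^ (d * r) <= exp (INR n)).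
    { rewrite pow_mult; replace (2 * (4 * d) + 1)%nat with (8 * d + 1)%nat by lia.
      rewrite En, (Rmult_comm (INR r)), <- exp_pow.
      apply pow_incr; split; [apply pow_le, pos_INR|assumption]. }
    apply Rle_lt_trans with (exp (INR n) * (exp (2 * INR n) * exp (2 * INR n))).
    - assert (0 <= 3 ^ n) by (apply pow_le; lra).
      apply Rmult_le_compat; [apply pow_le, pos_INR|nra|assumption|].
      apply Rmult_le_compat; assumption.
    - rewrite <- !exp_plus; apply exp_increasing; lra. }
  exists e; split; [assumption|].
  assert (Hgrid : forall y x z, grid_point (4 * d) (d * r) y -> grid_point (4 * n) n x -> grid_point (4 * n) n z ->
    bounded_by 3 d r (grid_mat (4 * d) r y) -> sumsq n (grid_vec h x) <= 1 -> sumsq n (grid_vec h z) <= 1 ->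
    l1 n x <= 16 * INR n -> l1 n z <= 16 * INR n ->
    trilin d r k n e (grid_mat (4 * d) r y) (grid_vec h x) (grid_vec h z) <= 31 * s).
  { intros y x z Hy Hx Hz HM Bx Bz Lx Lz.
    specialize (HL y x z Hy Hx Hz).
    set (T := trilin _ _ _ _ _ _ _ _) in *; set (Q := sumsq (d * k * n) _) in *.
    assert (HQ : Q <= 3).
    { eapply Rle_trans; [apply (sumsq_coef_le 3); [lra|assumption]|].
      pose proof (sumsq_nonneg n (grid_vec h x)); pose proof (sumsq_nonneg n (grid_vec h z)).
      fold n; nra. }
    apply exp_lt_inv in HL.
    assert (H62 : (2 * s) ^ 2 = 4 * INR n) by (rewrite <- Hs; ring); rewrite H62 in HL.
    assert (2 * (4 * INR n) * Q <= 24 * INR n) by nra.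
    (* [62 = 6 + 24 + 16 + 16]: the count, the variance term and the two [l1] norms. *)
    assert (Hlin : 2 * s * T <= 62 * (s * s)) by (rewrite Hs; lra).
    apply Rmult_le_reg_l with (2 * s); [lra|]. lra. }
  (* A crude Cauchy-Schwarz bound makes the supremum [S] finite, so that [S <= 31 s + 3 / 4 S] can
     be solved for [S], giving [124 s]. *)
  set (E := fun t => exists U c f, bounded_by 1 d r U /\ unit_ball n c /\ unit_ball n f /\ t = trilin d r k n e U c f).
  destruct (completeness E) as [S [HS1 HS2]].
  { exists (INR (d * k * n) + 1); intros t (U & c & f & HU & Hc & Hf & ->).
    pose proof (rsum_cauchy_schwarz (d * k * n) e (coef r k n U c f)) as CS.
    fold (trilin d r k n e U c f) (sumsq (d * k * n) e) (sumsq (d * k * n) (coef r k n U c f)) in CS.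
    assert (sumsq (d * k * n) e = INR (d * k * n)) as Ee.
    { unfold sumsq; rewrite (rsum_ext _ _ (fun _ => 1)); [rewrite rsum_const; ring|].
      intros i _; destruct (He i) as [-> | ->]; ring. }
    assert (sumsq (d * k * n) (coef r k n U c f) <= 1) as Ec.
    { eapply Rle_trans; [apply (sumsq_coef_le 1); [lra|assumption]|].
      unfold unit_ball in *; pose proof (sumsq_nonneg n c); pose proof (sumsq_nonneg n f); fold n; nra. }
    rewrite Ee in CS; pose proof (pos_INR (d * k * n)).
    pose proof (sumsq_nonneg (d * k * n) (coef r k n U c f)). nra. }
  { exists (trilin d r k n e (fun _ _ => 0) (fun _ => 0) (fun _ => 0)), (fun _ _ => 0), (fun _ => 0), (fun _ => 0).
    assert (Z : forall m, sumsq m (fun _ => 0) = 0) by (intros; apply rsum_zero; intros; ring).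
    unfold unit_ball; rewrite Z; repeat split; try lra.
    intros t; unfold sumsq at 1; rewrite (rsum_ext d _ (fun _ => 0 ^ 2)).
    - rewrite rsum_const; pose proof (sumsq_nonneg r t); lra.
    - intros; f_equal; apply rsum_zero; intros; ring. }
  assert (HS : forall U c f, bounded_by 1 d r U -> unit_ball n c -> unit_ball n f ->
            trilin d r k n e U c f <= S) by (intros U c f HU Hc Hf; apply HS1; exists U, c, f; auto).
  assert (Hstep : forall U c f, bounded_by 1 d r U -> unit_ball n c -> unit_ball n f ->
            trilin d r k n e U c f <= 31 * s + 3 / 4 * S).
  { intros U c f HU Hc Hf.
    destruct (round_vector n c Hn Hc) as (x & Gx & Bx & Dx & Lx).
    destruct (round_vector n f Hn Hf) as (z & Gz & Bz & Dz & Lz).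
    destruct (round_contraction d r U Hr Hrd HU) as (y & Gy & By & Dy).
    fold s in Bx, Dx, Bz, Dz; fold h in Bx, Dx, Bz, Dz.
    (* Telescoping: the vectors [c] and [f] are replaced first, the contraction last. Each
       difference is a quarter of the form at admissible arguments, so each costs [S / 4]. *)
    pose proof (Hgrid y x z Gy Gx Gz By Bx Bz Lx Lz) as T0.
    pose proof (HS _ _ _ HU Dx Hf) as T1.
    pose proof (HS _ _ _ HU Bx Dz) as T2.
    pose proof (HS _ _ _ Dy Bx Bz) as T3.
    assert (E1 := trilin_scal d r k n e U (fun i => c i - grid_vec h x i) f 1 4 1).
    assert (E2 := trilin_scal d r k n e U (grid_vec h x) (fun i => f i - grid_vec h z i) 1 1 4).
    assert (E3 := trilin_scal d r k n e (fun b a => U b a - grid_mat (4 * d) r y b a) (grid_vec h x) (grid_vec h z) 4 1 1).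
    rewrite trilin_sub_c in E1; rewrite trilin_sub_f in E2; rewrite trilin_sub_U in E3.
    rewrite (trilin_ext d r k n e _ U _ (fun i => 4 * (c i - grid_vec h x i)) _ f) in E1 by (intros; ring).
    rewrite (trilin_ext d r k n e _ U _ (grid_vec h x) _ (fun i => 4 * (f i - grid_vec h z i))) in E2 by (intros; ring).
    rewrite (trilin_ext d r k n e _ (fun b a => 4 * (U b a - grid_mat (4 * d) r y b a)) _ (grid_vec h x) _ (grid_vec h z))
      in E3 by (intros; ring).
    lra. }
  assert (S <= 31 * s + 3 / 4 * S).
  { apply HS2; intros t (U & c & f & HU & Hc & Hf & ->); auto. }
  intros U c f HU Hc Hf; specialize (HS U c f HU Hc Hf); lra.
Qed.

(** * From the trilinear form to squared norms *)

Definition contract (d k n : nat) (e : nat -> R) (u f : nat -> R) (i : nat) : R :=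
  rsum d (fun b => rsum n (fun l => u b * e ((b * k + i) * n + l)%nat * f l)).

Definition tensor_bound (d r k : nat) (e : nat -> R) : Prop :=
  forall U f, bounded_by 1 d r U ->
    rsum r (fun a => rsum k (fun i => contract d k (r * k) e (fun b => U b a) f i ^ 2))
    <= 15376 * INR (r * k) * sumsq (r * k) f.

(** Duality: with [c] the normalised contraction of the tensor with [U] and [f], the form equals the
    norm of that contraction. The constant is [15376 = 124 ^ 2]. *)
Lemma tensor_signs_sq d r k :
  (0 < r)%nat -> (r <= d)%nat -> (0 < k)%nat -> INR (8 * d + 1) ^ d <= exp (INR k) ->
  exists e, is_sign e /\ tensor_bound d r k e.
Proof.
  intros Hr Hrd Hk Hcount; destruct (tensor_signs d r k Hr Hrd Hk Hcount) as (e & He & HT).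
  exists e; split; [assumption|]; intros U f HU; set (n := (r * k)%nat) in *.
  set (Z := fun a i => contract d k n e (fun b => U b a) f i).
  set (c0 := fun m => Z (m / k)%nat (m mod k)%nat).
  set (q := rsum r (fun a => rsum k (fun i => Z a i ^ 2))).
  change (q <= 15376 * INR n * sumsq n f).
  assert (Hc0 : forall a i, (i < k)%nat -> c0 (a * k + i)%nat = Z a i).
  { intros a i Hi; unfold c0; destruct (divmod_add k a i Hi) as [-> ->]; reflexivity. }
  assert (Eq : sumsq n c0 = q).
  { unfold sumsq, n; rewrite rsum_flatten; apply rsum_ext; intros a _; apply rsum_ext; intros i Hi.
    rewrite Hc0 by assumption; reflexivity. }
  assert (ET : trilin d r k n e U c0 f = q).
  { rewrite trilin_nested; apply rsum_ext; intros a _; apply rsum_ext; intros i Hi.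
    rewrite Hc0 by assumption; unfold Z at 1, contract; fold (contract d k n e (fun b => U b a) f i).
    fold (Z a i); ring. }
  pose proof (sumsq_nonneg n f) as Hf0; pose proof (sumsq_nonneg n c0) as Hq0; rewrite Eq in Hq0.
  pose proof (pos_INR n) as Hn0.
  destruct Hq0 as [Hq|Hq]; [|rewrite <- Hq; nra].
  destruct Hf0 as [Hf|Hf].
  - set (s := sqrt (sumsq n f)); set (w := sqrt q).
    assert (Hs : 0 < s) by (apply sqrt_lt_R0; assumption).
    assert (Hw : 0 < w) by (apply sqrt_lt_R0; assumption).
    assert (Es : s * s = sumsq n f) by (apply sqrt_sqrt; lra).
    assert (Ew : w * w = q) by (apply sqrt_sqrt; lra).
    assert (B : trilin d r k n e U (fun i => / w * c0 i) (fun l => / s * f l) <= 124 * sqrt (INR n)).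
    { apply HT; [assumption| |]; unfold unit_ball; rewrite sumsq_scal, ?Eq, <- ?Es, <- ?Ew; right; field; lra. }
    rewrite (trilin_ext d r k n e U (fun b a => 1 * U b a) _ (fun i => / w * c0 i) _ (fun l => / s * f l)) in B
      by (intros; ring).
    rewrite trilin_scal, ET, <- Ew in B.
    replace (1 * / w * / s * (w * w)) with (w / s) in B by (field; lra).
    assert (B' : w <= 124 * sqrt (INR n) * s).
    { replace w with (w / s * s) by (field; lra); apply Rmult_le_compat_r; lra. }
    pose proof (sqrt_sqrt (INR n) Hn0) as En; pose proof (sqrt_pos (INR n)).
    rewrite <- Ew, <- Es.
    apply Rle_trans with ((124 * sqrt (INR n) * s) * (124 * sqrt (INR n) * s)); [apply Rmult_le_compat; lra|].
    right; rewrite <- En at 3; ring.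
  - exfalso; assert (Hz : forall l, (l < n)%nat -> f l = 0).
    { intros l Hl; assert (f l ^ 2 <= 0); [|nra].
      rewrite Hf; apply (rsum_term_le n (fun l => f l ^ 2)); [intros; apply pow2_ge_0|assumption]. }
    assert (q = 0); [|lra]; apply rsum_zero; intros a _; apply rsum_zero; intros i _.
    replace (Z a i) with 0; [ring|symmetry]; apply rsum_zero; intros b _; apply rsum_zero; intros l Hl.
    rewrite Hz by assumption; ring.
Qed.

(** * From real to complex vectors *)

Definition ccontract (d k n : nat) (e : nat -> R) (u f : Vec) (i : nat) : C :=
  csum d (fun b => csum n (fun l => Cmul (Cmul (Cconj (u b)) (RtoC (e ((b * k + i) * n + l)%nat))) (f l))).

Lemma ccontract_norm d k n e u f i :
  Cnorm2 (ccontract d k n e u f i) <=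
  2 * (contract d k n e (fun b => fst (u b)) (fun l => fst (f l)) i ^ 2 +
       contract d k n e (fun b => snd (u b)) (fun l => snd (f l)) i ^ 2 +
       contract d k n e (fun b => fst (u b)) (fun l => snd (f l)) i ^ 2 +
       contract d k n e (fun b => snd (u b)) (fun l => fst (f l)) i ^ 2).
Proof.
  set (p1 := contract _ _ _ _ (fun b => fst (u b)) (fun l => fst (f l)) i).
  set (p2 := contract _ _ _ _ (fun b => snd (u b)) (fun l => snd (f l)) i).
  set (p3 := contract _ _ _ _ (fun b => fst (u b)) (fun l => snd (f l)) i).
  set (p4 := contract _ _ _ _ (fun b => snd (u b)) (fun l => fst (f l)) i).
  assert (E1 : fst (ccontract d k n e u f i) = p1 + p2).
  { unfold ccontract, p1, p2, contract; rewrite csum_fst, <- rsum_plus; apply rsum_ext; intros b _.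
    rewrite csum_fst, <- rsum_plus; apply rsum_ext; intros l _; simpl; ring. }
  assert (E2 : snd (ccontract d k n e u f i) = p3 - p4).
  { unfold ccontract, p3, p4, contract; rewrite csum_snd, <- rsum_minus; apply rsum_ext; intros b _.
    rewrite csum_snd, <- rsum_minus; apply rsum_ext; intros l _; simpl; ring. }
  unfold Cnorm2; rewrite E1, E2.
  assert (0 <= (p1 - p2) ^ 2 + (p3 + p4) ^ 2) by (pose proof (pow2_ge_0 (p1 - p2)); pose proof (pow2_ge_0 (p3 + p4)); lra).
  lra.
Qed.

(* Real linear combinations only: both the real and the imaginary part of [u] are then contractions. *)
Definition subnormal (d r : nat) (u : nat -> Vec) : Prop :=
  forall t : nat -> R, norm2 d (fun b => csum r (fun a => Cmul (RtoC (t a)) (u a b))) <= sumsq r t.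

(** Splitting into real and imaginary parts gives four real forms with a factor [2], and each part
    of [f] occurs in two of them: [61504 = 4 * 15376]. *)
Lemma ccontract_bound d r k e u f :
  tensor_bound d r k e -> subnormal d r u ->
  rsum r (fun a => rsum k (fun i => Cnorm2 (ccontract d k (r * k) e (u a) f i)))
  <= 61504 * INR (r * k) * norm2 (r * k) f.
Proof.
  intros HT Hu; set (n := (r * k)%nat) in *.
  assert (H1 : bounded_by 1 d r (fun b a => fst (u a b))).
  { intros t; rewrite Rmult_1_l; eapply Rle_trans; [|apply (Hu t)]; apply rsum_le; intros b _.
    unfold Cnorm2; rewrite csum_fst.
    rewrite (rsum_ext r (fun a => fst (Cmul (RtoC (t a)) (u a b))) (fun a => fst (u a b) * t a)) by (intros; simpl; ring).
    pose proof (pow2_ge_0 (snd (csum r (fun a => Cmul (RtoC (t a)) (u a b))))); lra. }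
  assert (H2 : bounded_by 1 d r (fun b a => snd (u a b))).
  { intros t; rewrite Rmult_1_l; eapply Rle_trans; [|apply (Hu t)]; apply rsum_le; intros b _.
    unfold Cnorm2; rewrite csum_snd.
    rewrite (rsum_ext r (fun a => snd (Cmul (RtoC (t a)) (u a b))) (fun a => snd (u a b) * t a)) by (intros; simpl; ring).
    pose proof (pow2_ge_0 (fst (csum r (fun a => Cmul (RtoC (t a)) (u a b))))); lra. }
  set (q := fun (x : nat -> nat -> R) g => rsum r (fun a => rsum k (fun i => contract d k n e (x a) g i ^ 2))).
  set (f1 := fun l => fst (f l)); set (f2 := fun l => snd (f l)).
  set (u1 := fun a b => fst (u a b)); set (u2 := fun a b => snd (u a b)).
  apply Rle_trans with (2 * (q u1 f1 + q u2 f2 + q u1 f2 + q u2 f1)).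
  - unfold q; rewrite <- !rsum_plus, <- rsum_scal; apply rsum_le; intros a _.
    rewrite <- !rsum_plus, <- rsum_scal; apply rsum_le; intros i _; apply ccontract_norm.
  - assert (norm2 n f = sumsq n f1 + sumsq n f2) as ->.
    { unfold norm2, sumsq; rewrite <- rsum_plus; apply rsum_ext; intros; unfold Cnorm2, f1, f2; ring. }
    pose proof (HT _ f1 H1) as B1; pose proof (HT _ f2 H2) as B2.
    pose proof (HT _ f2 H1) as B3; pose proof (HT _ f1 H2) as B4.
    fold n in B1, B2, B3, B4.
    change (q u1 f1 <= 15376 * INR n * sumsq n f1) in B1.
    change (q u2 f2 <= 15376 * INR n * sumsq n f2) in B2.
    change (q u1 f2 <= 15376 * INR n * sumsq n f2) in B3.
    change (q u2 f1 <= 15376 * INR n * sumsq n f1) in B4.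
    lra.
Qed.

Lemma orthonormal_subnormal d r u :
  (forall a b, (a < r)%nat -> (b < r)%nat -> inner d (u a) (u b) = if Nat.eqb a b then C1 else C0) ->
  subnormal d r u.
Proof.
  intros Hu t; right.
  enough (E : RtoC (norm2 d (fun b => csum r (fun a => Cmul (RtoC (t a)) (u a b)))) = RtoC (sumsq r t))
    by (apply (f_equal fst) in E; exact E).
  rewrite <- inner_self, inner_csum_l; unfold sumsq; rewrite <- csum_RtoC; apply csum_ext; intros a Ha.
  rewrite inner_csum_r, (csum_ext r _ (fun b => if Nat.eqb b a then RtoC (t a ^ 2) else C0)).
  - apply csum_delta; assumption.
  - intros b Hb; rewrite inner_scal_r, inner_scal_l, Hu, Nat.eqb_sym by assumption.
    destruct (Nat.eqb_spec b a) as [->|]; Cext; ring.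
Qed.

(** * Sums over [r] largest entries *)

Lemma rsum_list_nth (y : nat -> R) L :
  rsum (length L) (fun i => y (nth i L 0%nat)) = fold_right (fun i s => y i + s) 0 L.
Proof.
  induction L as [|a L IH]; [reflexivity|].
  cbn [length fold_right]; rewrite <- IH, <- Nat.add_1_l, rsum_app; simpl; ring.
Qed.

Definition list_rsum (y : nat -> R) (L : list nat) : R := fold_right (fun i s => y i + s) 0 L.

Lemma list_rsum_app y L L' : list_rsum y (L ++ L') = list_rsum y L + list_rsum y L'.
Proof. induction L as [|a L IH]; simpl; [ring|rewrite IH; ring]. Qed.

Lemma list_rsum_filter_seq y (B : nat -> bool) d :
  list_rsum y (filter B (seq 0 d)) = rsum d (fun k => if B k then y k else 0).
Proof.
  induction d as [|d IH]; [reflexivity|].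
  rewrite seq_S, filter_app, list_rsum_app, IH; simpl; destruct (B d); simpl; ring.
Qed.

Lemma rsum_lt n f g : (0 < n)%nat -> (forall i, (i < n)%nat -> f i < g i) -> rsum n f < rsum n g.
Proof.
  destruct n as [|n]; [lia|]; intros _ H; simpl.
  apply Rplus_le_lt_compat; [apply rsum_le; intros; left; auto|auto].
Qed.

Lemma Permutation_filter_partition {A : Type} (B : A -> bool) L :
  Permutation L (filter B L ++ filter (fun k => negb (B k)) L).
Proof.
  induction L as [|a L IH]; simpl; [constructor|].
  destruct (B a); simpl; [constructor; assumption|].
  apply Permutation_cons_app; assumption.
Qed.

(* The exceptional set is [y > T / r]: it has fewer than [r] elements, so it extends to an [r]-tuple. *)
Lemma large_entries_split d r (y : nat -> R) T :
  (0 < r)%nat -> (r <= d)%nat -> (forall k, (k < d)%nat -> 0 <= y k) ->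
  (forall f : nat -> nat, (forall a, (a < r)%nat -> (f a < d)%nat) ->
     (forall a b, (a < r)%nat -> (b < r)%nat -> f a = f b -> a = b) ->
     rsum r (fun a => y (f a)) <= T) ->
  exists B : nat -> bool, rsum d (fun k => if B k then y k else 0) <= T /\
    forall k, (k < d)%nat -> if B k then T / INR r < y k else y k <= T / INR r.
Proof.
  intros Hr Hrd Hy HT.
  set (B := fun k => if Rlt_dec (T / INR r) (y k) then true else false).
  exists B; split; [|intros k _; unfold B; destruct Rlt_dec; lra].
  set (L1 := filter B (seq 0 d)); set (L2 := filter (fun k => negb (B k)) (seq 0 d)).
  assert (HP : Permutation (seq 0 d) (L1 ++ L2)) by apply Permutation_filter_partition.
  assert (Hlen : length (L1 ++ L2) = d) by (rewrite <- (Permutation_length HP); apply length_seq).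
  assert (HN : NoDup (L1 ++ L2)) by (apply (Permutation_NoDup HP), seq_NoDup).
  assert (Hlt : forall a, (a < d)%nat -> (nth a (L1 ++ L2) 0 < d)%nat).
  { intros a Ha; assert (HI : In (nth a (L1 ++ L2) 0%nat) (seq 0 d)).
    { apply (Permutation_in _ (Permutation_sym HP)), nth_In; lia. }
    apply in_seq in HI; lia. }
  assert (HS : rsum r (fun a => y (nth a (L1 ++ L2) 0%nat)) <= T).
  { apply HT; [intros; apply Hlt; lia|].
    intros a b Ha Hb; apply (proj1 (NoDup_nth (L1 ++ L2) 0%nat) HN); lia. }
  rewrite <- list_rsum_filter_seq; fold L1.
  destruct (Nat.lt_ge_cases (length L1) r) as [Hl|Hl].
  - replace r with (length L1 + (r - length L1))%nat in HS by lia; rewrite rsum_app in HS.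
    rewrite (rsum_ext (length L1) _ (fun i => y (nth i L1 0%nat))) in HS
      by (intros; rewrite app_nth1 by assumption; reflexivity).
    rewrite rsum_list_nth in HS; fold (list_rsum y L1) in HS.
    assert (0 <= rsum (r - length L1) (fun i => y (nth (length L1 + i) (L1 ++ L2) 0%nat))); [|lra].
    apply rsum_nonneg; intros; apply Hy, Hlt; lia.
  - exfalso; assert (rsum r (fun _ => T / INR r) < rsum r (fun a => y (nth a (L1 ++ L2) 0%nat))) as H.
    { apply rsum_lt; [assumption|]; intros a Ha; rewrite app_nth1 by lia.
      assert (HI : In (nth a L1 0%nat) L1) by (apply nth_In; lia).
      apply filter_In in HI; destruct HI as [_ HI]; unfold B in HI; destruct Rlt_dec; [assumption|discriminate]. }
    rewrite rsum_const in H; replace (INR r * (T / INR r)) with T in H; [lra|].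
    field; apply not_0_INR; lia.
Qed.

Lemma rpow_le_linear x z p : 1 < p -> 0 <= x <= z -> rpow x p <= x * rpow z (p - 1).
Proof.
  intros Hp [[Hx|<-] Hz]; [|rewrite rpow_npos; lra].
  rewrite !rpow_pos by lra.
  replace (Rpower x p) with (x * Rpower x (p - 1)).
  - apply Rmult_le_compat_l; [lra|]; apply Rle_Rpower_l; lra.
  - rewrite <- (Rpower_1 x) at 1 by assumption; rewrite <- Rpower_plus; f_equal; ring.
Qed.

(* [y] has [r]-term sums at most [r / (2 d)]; adding the flat part [tau / d] costs a factor three on the
   large entries. *)
Lemma flattened_power_sum d r (y lam : nat -> R) tau p :
  1 < p -> (0 < r)%nat -> (r <= d)%nat -> (forall k, (k < d)%nat -> 0 <= y k) -> 0 <= tau <= 1 ->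
  (forall k, (k < d)%nat -> lam k = y k + tau / INR d) -> rsum d lam = 1 ->
  (forall f : nat -> nat, (forall a, (a < r)%nat -> (f a < d)%nat) ->
     (forall a b, (a < r)%nat -> (b < r)%nat -> f a = f b -> a = b) ->
     rsum r (fun a => y (f a)) <= INR r / (2 * INR d)) ->
  rsum d (fun k => rpow (lam k) p) <= rpow (2 / INR d) (p - 1) + rpow (2 * INR r / INR d) p.
Proof.
  intros Hp Hr Hrd Hy Htau Hlam Hsum HT.
  assert (Hr1 : 1 <= INR r) by (apply (le_INR 1); lia).
  assert (Hd1 : 1 <= INR d) by (apply (le_INR 1); lia).
  assert (Hid : 0 < / INR d) by (apply Rinv_0_lt_compat; lra).
  destruct (large_entries_split d r y (INR r / (2 * INR d)) Hr Hrd Hy HT) as (B & HB & Hk).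
  replace (INR r / (2 * INR d) / INR r) with (/ 2 * / INR d) in Hk by (field; lra).
  replace (INR r / (2 * INR d)) with (/ 2 * INR r * / INR d) in HB by (field; lra).
  unfold Rdiv in *.
  set (W := rsum d (fun k => if B k then lam k else 0)).
  assert (Hl0 : forall k, (k < d)%nat -> 0 <= lam k).
  { intros k H; rewrite Hlam by assumption; specialize (Hy k H).
    assert (0 <= tau * / INR d) by (apply Rmult_le_pos; lra); lra. }
  assert (Htd : tau * / INR d <= / INR d) by nra.
  (* On the exceptional set [y > 1 / (2 d)], so the flat part is below [2 y] and the eigenvalue
     below [3 y]; the total is at most [3 r / (2 d)]. *)
  assert (HW : W <= 2 * INR r * / INR d).
  { apply Rle_trans with (3 * rsum d (fun k => if B k then y k else 0)).
    - rewrite <- rsum_scal; apply rsum_le; intros k H; specialize (Hk k H).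
      destruct (B k); [rewrite Hlam by assumption; lra|lra].
    - assert (0 <= INR r * / INR d) by (apply Rmult_le_pos; lra); lra. }
  assert (HW0 : forall k, (k < d)%nat -> B k = true -> lam k <= W).
  { intros k H HBk; pose proof (rsum_term_le d (fun k => if B k then lam k else 0) k) as E.
    cbv beta in E; rewrite HBk in E; apply E; [|assumption].
    intros i Hi; destruct (B i); [auto|lra]. }
  (* Each power is made linear by [x ^ p <= x z ^ (p - 1)], with [z = 2 / d] for the bulk and
     [z = 2 r / d] on the exceptional set; what remains are the total masses [1] and [W]. *)
  apply Rle_trans with (rsum d (fun k => lam k * rpow (2 * / INR d) (p - 1) +
     (if B k then lam k else 0) * rpow (2 * INR r * / INR d) (p - 1))).
  - apply rsum_le; intros k H; specialize (Hk k H).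
    pose proof (rpow_nonneg (2 * / INR d) (p - 1)); pose proof (Hl0 k H) as Hl.
    destruct (B k) eqn:EB.
    + assert (rpow (lam k) p <= lam k * rpow (2 * INR r * / INR d) (p - 1)); [|nra].
      apply rpow_le_linear; [assumption|]; specialize (HW0 k H EB); lra.
    + rewrite Rmult_0_l, Rplus_0_r; apply rpow_le_linear; [assumption|].
      rewrite Hlam in * by assumption; lra.
  - rewrite rsum_plus, !rsum_scal_r, Hsum, Rmult_1_l; apply Rplus_le_compat_l; fold W.
    assert (0 < 2 * INR r * / INR d) by (apply Rmult_lt_0_compat; lra).
    replace (rpow (2 * INR r * / INR d) p) with (2 * INR r * / INR d * rpow (2 * INR r * / INR d) (p - 1)).
    + apply Rmult_le_compat_r; [apply rpow_nonneg|assumption].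
    + rewrite !rpow_pos by assumption.
      rewrite <- (Rpower_1 (2 * INR r * / INR d)) at 1 by assumption.
      rewrite <- Rpower_plus; f_equal; ring.
Qed.

(** * Kraus maps *)

Definition kraus (M n : nat) (K : nat -> Mat) : Map := fun X a b =>
  csum M (fun s => csum n (fun l => csum n (fun m => Cmul (Cmul (K s a l) (X l m)) (Cconj (K s b m))))).

Definition adj_apply (d : nat) (A : Mat) (v : Vec) : Vec :=
  fun m => csum d (fun b => Cmul (Cconj (A b m)) (v b)).

Lemma kraus_linear M n d K : linear_map n d (kraus M n K).
Proof.
  split.
  - intros X Y H a b _ _; apply csum_ext; intros s _; apply csum_ext; intros l Hl.
    apply csum_ext; intros m Hm; rewrite H by assumption; reflexivity.
  - intros c X Y a b _ _; unfold madd, mscale, kraus.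
    rewrite <- csum_mul_l, <- csum_add; apply csum_ext; intros s _.
    rewrite <- csum_mul_l, <- csum_add; apply csum_ext; intros l _.
    rewrite <- csum_mul_l, <- csum_add; apply csum_ext; intros m _; ring.
Qed.

Lemma kraus_quad M n d K X v :
  quad d (kraus M n K X) v = csum M (fun s => quad n X (adj_apply d (K s) v)).
Proof.
  unfold quad at 1, kraus.
  transitivity (csum d (fun a => csum d (fun b => csum M (fun s => csum n (fun l => csum n (fun m =>
    Cmul (Cmul (Cmul (Cconj (v a)) (K s a l)) (X l m)) (Cmul (Cconj (K s b m)) (v b)))))))).
  { apply csum_ext; intros a _; apply csum_ext; intros b _.
    rewrite <- csum_mul_r, <- csum_mul_l; apply csum_ext; intros s _.
    rewrite <- csum_mul_r, <- csum_mul_l; apply csum_ext; intros l _.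
    rewrite <- csum_mul_r, <- csum_mul_l; apply csum_ext; intros m _; ring. }
  transitivity (csum M (fun s => csum d (fun a => csum d (fun b => csum n (fun l => csum n (fun m =>
    Cmul (Cmul (Cmul (Cconj (v a)) (K s a l)) (X l m)) (Cmul (Cconj (K s b m)) (v b)))))))).
  { symmetry; rewrite csum_exchange; apply csum_ext; intros a _; apply csum_exchange. }
  apply csum_ext; intros s _; unfold quad, adj_apply.
  transitivity (csum n (fun l => csum n (fun m => csum d (fun a => csum d (fun b =>
    Cmul (Cmul (Cmul (Cconj (v a)) (K s a l)) (X l m)) (Cmul (Cconj (K s b m)) (v b))))))).
  - rewrite (csum_ext d _ (fun a => csum n (fun l => csum d (fun b => csum n (fun m =>
      Cmul (Cmul (Cmul (Cconj (v a)) (K s a l)) (X l m)) (Cmul (Cconj (K s b m)) (v b)))))))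
      by (intros; apply csum_exchange).
    rewrite csum_exchange; apply csum_ext; intros l _.
    rewrite (csum_ext d _ (fun a => csum n (fun m => csum d (fun b =>
      Cmul (Cmul (Cmul (Cconj (v a)) (K s a l)) (X l m)) (Cmul (Cconj (K s b m)) (v b))))))
      by (intros; apply csum_exchange).
    apply csum_exchange.
  - apply csum_ext; intros l _; apply csum_ext; intros m _.
    rewrite csum_prod, csum_mul_r.
    rewrite csum_conj, (csum_ext d (fun i => Cconj (Cmul (Cconj (K s i l)) (v i)))
      (fun a => Cmul (Cconj (v a)) (K s a l))).
    + ring.
    + intros; rewrite Cconj_mul, Cconj_conj; ring.
Qed.

Lemma kraus_psd M n d K X : psd n X -> psd d (kraus M n K X).
Proof.
  intros [HX HQ]; split.
  - intros a b _ _; unfold adj, kraus; rewrite csum_conj; apply csum_ext; intros s _.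
    rewrite csum_conj, csum_exchange; apply csum_ext; intros m Hm.
    rewrite csum_conj; apply csum_ext; intros l Hl.
    rewrite !Cconj_mul, Cconj_conj, (HX l m) by assumption; unfold adj; ring.
  - intros v; rewrite kraus_quad, csum_fst; apply rsum_nonneg; intros; apply HQ.
Qed.

Definition kraus_complete (M n d : nat) (K : nat -> Mat) : Prop :=
  forall l m, (l < n)%nat -> (m < n)%nat ->
    csum M (fun s => csum d (fun a => Cmul (K s a l) (Cconj (K s a m)))) = idm l m.

Lemma kraus_trace M n d K X : kraus_complete M n d K -> trace d (kraus M n K X) = trace n X.
Proof.
  intros HK; unfold trace, kraus.
  transitivity (csum n (fun l => csum n (fun m => Cmul (X l m)
     (csum M (fun s => csum d (fun a => Cmul (K s a l) (Cconj (K s a m)))))))).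
  - rewrite csum_exchange.
    transitivity (csum n (fun l => csum M (fun s => csum d (fun a => csum n (fun m =>
      Cmul (Cmul (K s a l) (X l m)) (Cconj (K s a m))))))).
    + symmetry; rewrite csum_exchange; apply csum_ext; intros s _; apply csum_exchange.
    + apply csum_ext; intros l _.
      transitivity (csum n (fun m => csum M (fun s => csum d (fun a =>
        Cmul (Cmul (K s a l) (X l m)) (Cconj (K s a m)))))).
      * symmetry; rewrite csum_exchange; apply csum_ext; intros s _; apply csum_exchange.
      * apply csum_ext; intros m _; rewrite <- csum_mul_l; apply csum_ext; intros s _.
        rewrite <- csum_mul_l; apply csum_ext; intros; ring.
  - apply csum_ext; intros l Hl.
    rewrite (csum_ext n _ (fun m => if Nat.eqb m l then X l m else C0)).
    + apply csum_delta; assumption.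
    + intros m Hm; rewrite HK by assumption; unfold idm; rewrite Nat.eqb_sym.
      destruct (Nat.eqb m l); ring.
Qed.

Lemma csum_block k n g (A F : nat -> C) : (g < k)%nat ->
  csum (k * n) (fun q => if Nat.eqb (q / n) g then Cmul (A (q mod n)%nat) (F q) else C0)
  = csum n (fun l => Cmul (A l) (F (g * n + l)%nat)).
Proof.
  intros Hg; rewrite csum_flatten.
  rewrite (csum_ext k _ (fun h => if Nat.eqb h g then csum n (fun l => Cmul (A l) (F (h * n + l)%nat)) else C0)).
  - apply csum_delta with (f := fun h => csum n (fun l => Cmul (A l) (F (h * n + l)%nat))); assumption.
  - intros h _; destruct (Nat.eqb h g) eqn:E.
    + apply csum_ext; intros l Hl; destruct (divmod_add n h l Hl) as [-> ->]; rewrite E; reflexivity.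
    + apply csum_zero; intros l Hl; destruct (divmod_add n h l Hl) as [-> ->]; rewrite E; reflexivity.
Qed.

(** This is the identity tensor [A] in block form. An amplified Kraus map is thus again a Kraus map,
    and complete positivity follows from [kraus_psd]. *)
Definition block_kraus (n d : nat) (A : Mat) : Mat := fun r q =>
  if Nat.eqb (q / n) (r / d) then A (r mod d)%nat (q mod n)%nat else C0.

Lemma ampliate_kraus M n d k K X :
  agree (k * d) (ampliate k n d (kraus M n K) X) (kraus M (k * n) (fun s => block_kraus n d (K s)) X).
Proof.
  intros r s Hr Hs; destruct (div_mod_lt k d r Hr) as [[Hrd _] _]; destruct (div_mod_lt k d s Hs) as [[Hsd _] _].
  unfold ampliate, kraus; apply csum_ext; intros q _.
  symmetry; transitivity (csum (k * n) (fun l => if Nat.eqb (l / n) (r / d)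
    then Cmul (K q (r mod d)%nat (l mod n)%nat)
      (csum n (fun m => Cmul (Cconj (K q (s mod d)%nat m)) (X l (s / d * n + m)%nat))) else C0)).
  - apply csum_ext; intros l _; rewrite <- (csum_block k n (s / d) (fun m => Cconj (K q (s mod d)%nat m)) (X l)) by assumption.
    unfold block_kraus; destruct (Nat.eqb (l / n) (r / d)).
    + rewrite <- csum_mul_l; apply csum_ext; intros m _; destruct (Nat.eqb (m / n) (s / d)); [ring|].
      rewrite Cconj_0; ring.
    + apply csum_zero; intros; ring.
  - rewrite (csum_block k n (r / d) (K q (r mod d)%nat)
      (fun l => csum n (fun m => Cmul (Cconj (K q (s mod d)%nat m)) (X l (s / d * n + m)%nat)))) by assumption.
    apply csum_ext; intros l _; rewrite <- csum_mul_l; apply csum_ext; intros; ring.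
Qed.

Lemma psd_agree n A B : agree n A B -> psd n A -> psd n B.
Proof.
  intros H [H1 H2]; split.
  - intros i j Hi Hj; unfold adj; rewrite <- !H by assumption; apply H1; assumption.
  - intros v; rewrite <- (quad_ext n A B v v H) by reflexivity; apply H2.
Qed.

Lemma density_agree n A B : agree n A B -> density n A -> density n B.
Proof.
  intros H [H1 H2]; split; [apply (psd_agree n A); assumption|].
  rewrite <- H2; apply csum_ext; intros; symmetry; apply H; assumption.
Qed.

Lemma kraus_density M n d K rho : kraus_complete M n d K -> density n rho -> density d (kraus M n K rho).
Proof.
  intros HK [H1 H2]; split; [apply kraus_psd; assumption|].
  rewrite kraus_trace by assumption; assumption.
Qed.

Lemma kraus_channel M n d K : kraus_complete M n d K -> is_channel n d (kraus M n K).
Proof.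
  intros HK; split; [apply kraus_linear|split].
  - intros k X HX.
    apply psd_agree with (kraus M (k * n) (fun s => block_kraus n d (K s)) X).
    + intros i j Hi Hj; symmetry; apply ampliate_kraus; assumption.
    + apply kraus_psd; assumption.
  - intros X; apply kraus_trace; assumption.
Qed.

Lemma kraus_output_continuous M n d K : output_continuous n d (kraus M n K).
Proof.
  intros x v Hx a b _ _; unfold kraus.
  apply (Ccv_csum M (fun j s => csum n (fun l => csum n (fun m =>
    Cmul (Cmul (K s a l) (pure (x j) l m)) (Cconj (K s b m)))))); intros s _.
  apply (Ccv_csum n (fun j l => csum n (fun m =>
    Cmul (Cmul (K s a l) (pure (x j) l m)) (Cconj (K s b m))))); intros l Hl.
  apply (Ccv_csum n (fun j m =>
    Cmul (Cmul (K s a l) (pure (x j) l m)) (Cconj (K s b m)))); intros m Hm.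
  apply Ccv_mul; [|apply Ccv_const]; apply Ccv_mul; [apply Ccv_const|].
  apply (Ccv_mul (fun j => x j l)); [apply Hx; assumption|].
  apply (Ccv_conj (fun j => x j m)); apply Hx; assumption.
Qed.

(** * Tensor products of Kraus maps *)

Definition kraus_kron (M2 n2 d : nat) (K1 K2 : nat -> Mat) : nat -> Mat := fun s r q =>
  Cmul (K1 (s / M2)%nat (r / d)%nat (q / n2)%nat) (K2 (s mod M2)%nat (r mod d)%nat (q mod n2)%nat).

Lemma csum_delta2 n a b (F : nat -> nat -> C) : (a < n)%nat -> (b < n)%nat ->
  csum n (fun l => csum n (fun m => Cmul (munit a b l m) (F l m))) = F a b.
Proof.
  intros Ha Hb.
  rewrite (csum_ext n _ (fun l => if Nat.eqb l a then F l b else C0)).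
  - apply csum_delta with (f := fun l => F l b); assumption.
  - intros l Hl; unfold munit; destruct (Nat.eqb l a); simpl.
    + rewrite (csum_ext n _ (fun m => if Nat.eqb m b then F l m else C0)).
      * apply csum_delta; assumption.
      * intros m _; destruct (Nat.eqb m b); ring.
    + apply csum_zero; intros; ring.
Qed.

Lemma kraus_munit M n K a b i j : (a < n)%nat -> (b < n)%nat ->
  kraus M n K (munit a b) i j = csum M (fun s => Cmul (K s i a) (Cconj (K s j b))).
Proof.
  intros Ha Hb; unfold kraus; apply csum_ext; intros s _.
  rewrite <- (csum_delta2 n a b (fun l m => Cmul (K s i l) (Cconj (K s j m))) Ha Hb).
  apply csum_ext; intros l _; apply csum_ext; intros m _; ring.
Qed.

Lemma chan_tensor_kraus M1 M2 n1 n2 d1 d K1 K2 X :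
  agree (d1 * d) (chan_tensor n1 d1 n2 d (kraus M1 n1 K1) (kraus M2 n2 K2) X)
    (kraus (M1 * M2) (n1 * n2) (kraus_kron M2 n2 d K1 K2) X).
Proof.
  intros r s Hr Hs; unfold chan_tensor.
  transitivity (csum n1 (fun a => csum n1 (fun b => csum n2 (fun c => csum n2 (fun e =>
    csum (M1 * M2) (fun q => Cmul (Cmul (kraus_kron M2 n2 d K1 K2 q r (a * n2 + c)%nat) (X (a * n2 + c)%nat (b * n2 + e)%nat))
      (Cconj (kraus_kron M2 n2 d K1 K2 q s (b * n2 + e)%nat)))))))).
  - apply csum_ext; intros a Ha; apply csum_ext; intros b Hb.
    apply csum_ext; intros c Hc; apply csum_ext; intros e He.
    unfold kron; rewrite !kraus_munit by assumption.
    rewrite <- csum_prod, <- csum_mul_l, csum_flatten; apply csum_ext; intros q1 _.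
    rewrite <- csum_mul_l; apply csum_ext; intros q2 Hq2; unfold kraus_kron.
    destruct (divmod_add M2 q1 q2 Hq2) as [-> ->].
    destruct (divmod_add n2 a c Hc) as [-> ->]; destruct (divmod_add n2 b e He) as [-> ->].
    rewrite Cconj_mul; ring.
  - unfold kraus.
    transitivity (csum (n1 * n2) (fun l => csum (n1 * n2) (fun m => csum (M1 * M2) (fun q =>
      Cmul (Cmul (kraus_kron M2 n2 d K1 K2 q r l) (X l m)) (Cconj (kraus_kron M2 n2 d K1 K2 q s m)))))).
    + rewrite csum_flatten; apply csum_ext; intros a _; rewrite csum_exchange.
      apply csum_ext; intros c _; rewrite csum_flatten; reflexivity.
    + symmetry; rewrite csum_exchange; apply csum_ext; intros l _; apply csum_exchange.
Qed.

Lemma kraus_kron_complete M1 M2 n1 n2 d1 d K1 K2 :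
  kraus_complete M1 n1 d1 K1 -> kraus_complete M2 n2 d K2 ->
  kraus_complete (M1 * M2) (n1 * n2) (d1 * d) (kraus_kron M2 n2 d K1 K2).
Proof.
  intros H1 H2 l m Hl Hm.
  destruct (div_mod_lt n1 n2 l Hl) as [[Hl1 Hl2] El]; destruct (div_mod_lt n1 n2 m Hm) as [[Hm1 Hm2] Em].
  transitivity (Cmul (idm (l / n2) (m / n2))%nat (idm (l mod n2) (m mod n2))%nat).
  - rewrite <- H1, <- H2 by assumption.
    rewrite <- csum_prod, csum_flatten; apply csum_ext; intros q1 _; apply csum_ext; intros q2 Hq2.
    rewrite <- csum_prod, csum_flatten; apply csum_ext; intros a _; apply csum_ext; intros b Hb.
    unfold kraus_kron; destruct (divmod_add M2 q1 q2 Hq2) as [-> ->].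
    destruct (divmod_add d a b Hb) as [-> ->]; rewrite Cconj_mul; ring.
  - unfold idm; destruct (Nat.eqb_spec l m) as [->|Hne].
    + rewrite !Nat.eqb_refl; ring.
    + destruct (Nat.eqb_spec (l / n2) (m / n2)) as [E1|]; [|ring].
      destruct (Nat.eqb_spec (l mod n2) (m mod n2)) as [E2|]; [|ring].
      exfalso; apply Hne; rewrite El, Em, E1, E2; reflexivity.
Qed.

(** Applied to the missing part [1 - sum_i A_i^T A_i], this supplies the vectors from which the
    filling Kraus operators are built. *)
Lemma psd_factor n P : psd n P ->
  exists g : nat -> Vec, forall l m, (l < n)%nat -> (m < n)%nat ->
    P l m = csum n (fun q => Cmul (g q l) (Cconj (g q m))).
Proof.
  intros HP; destruct (psd_eigvals n P HP) as (_ & _ & _ & _ & H0).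
  destruct (eigvals_spectral n P (proj1 HP)) as (U & HU & HA).
  exists (fun q l => Cmul (RtoC (sqrt (eigvals n P q))) (U l q)); intros l m Hl Hm.
  rewrite HA by assumption; apply csum_ext; intros q Hq.
  rewrite <- (sqrt_sqrt (eigvals n P q)) at 1 by auto.
  rewrite Cconj_mul, Cconj_RtoC, RtoC_mul; ring.
Qed.

(** * The random channel *)

Definition amp (k n : nat) (e : nat -> R) (s : R) : nat -> Mat :=
  fun i a l => RtoC (s * e ((a * k + i) * n + l)%nat).

Lemma inner_amp d k n e s i v w :
  inner n w (adj_apply d (amp k n e s i) v) = Cmul (RtoC s) (Cconj (ccontract d k n e v w i)).
Proof.
  unfold inner, adj_apply, ccontract; rewrite csum_conj, <- csum_mul_l.
  transitivity (csum n (fun l => csum d (fun b =>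
    Cmul (RtoC s) (Cconj (Cmul (Cmul (Cconj (v b)) (RtoC (e ((b * k + i) * n + l)%nat))) (w l)))))).
  - apply csum_ext; intros l _; rewrite <- csum_mul_l; apply csum_ext; intros b _; unfold amp.
    rewrite !Cconj_mul, Cconj_conj, !Cconj_RtoC, RtoC_mul; ring.
  - rewrite csum_exchange; apply csum_ext; intros b _; rewrite csum_conj, <- csum_mul_l; reflexivity.
Qed.

Lemma unitary_select d r U (f : nat -> nat) :
  unitary d U -> (forall a, (a < r)%nat -> (f a < d)%nat) ->
  (forall a b, (a < r)%nat -> (b < r)%nat -> f a = f b -> a = b) ->
  subnormal d r (fun a => col U (f a)).
Proof.
  intros HU Hf Hinj; apply orthonormal_subnormal; intros a b Ha Hb.
  rewrite (proj1 (unitary_inner d U) HU) by auto.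
  destruct (Nat.eqb_spec (f a) (f b)) as [E|E], (Nat.eqb_spec a b) as [E'|E']; try reflexivity.
  - destruct E'; auto.
  - destruct E; congruence.
Qed.

Lemma quad_sub n A B f : quad n (fun i j => Csub (A i j) (B i j)) f = Csub (quad n A f) (quad n B f).
Proof.
  unfold quad, Csub; replace (Copp (csum n (fun i => csum n (fun j => Cmul (Cconj (f i)) (Cmul (B i j) (f j))))))
    with (Cmul (Copp C1) (csum n (fun i => csum n (fun j => Cmul (Cconj (f i)) (Cmul (B i j) (f j)))))) by ring.
  rewrite <- csum_mul_l, <- csum_add; apply csum_ext; intros i _.
  rewrite <- csum_mul_l, <- csum_add; apply csum_ext; intros; ring.
Qed.

Lemma quad_scal n A c f : quad n A (fun i => Cmul c (f i)) = Cmul (RtoC (Cnorm2 c)) (quad n A f).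
Proof.
  unfold quad; rewrite <- csum_mul_l; apply csum_ext; intros i _.
  rewrite <- csum_mul_l; apply csum_ext; intros j _.
  rewrite Cconj_mul, <- Cmul_conj_l; ring.
Qed.

(* Squared modulus of the output [sum_i <v, A_i w>] over the environment. *)
Definition weight (d k n : nat) (e : nat -> R) (s : R) (v w : Vec) : R :=
  s ^ 2 * rsum k (fun i => Cnorm2 (ccontract d k n e v w i)).

Lemma weight_nonneg d k n e s v w : 0 <= weight d k n e s v w.
Proof.
  apply Rmult_le_pos; [apply pow2_ge_0|apply rsum_nonneg; intros; apply Cnorm2_nonneg].
Qed.

(** [123008] is twice the constant of [ccontract_bound], so that [61504 r k s ^ 2] is exactly
    [r / (2 d)]. *)
Definition good_scale (d k : nat) (s : R) : Prop := s ^ 2 = / (123008 * (INR k * INR d)).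

Lemma weight_select_le d r k e s U f w :
  (0 < d)%nat -> (0 < k)%nat -> good_scale d k s -> tensor_bound d r k e ->
  unitary d U -> (forall a, (a < r)%nat -> (f a < d)%nat) ->
  (forall a b, (a < r)%nat -> (b < r)%nat -> f a = f b -> a = b) ->
  rsum r (fun a => weight d k (r * k) e s (col U (f a)) w) <= INR r / (2 * INR d) * norm2 (r * k) w.
Proof.
  intros Hd Hk Hs HT HU Hf Hinj.
  assert (Hd1 : 1 <= INR d) by (apply (le_INR 1); lia).
  assert (Hk1 : 1 <= INR k) by (apply (le_INR 1); lia).
  unfold weight; rewrite rsum_scal.
  apply Rle_trans with (s ^ 2 * (61504 * INR (r * k) * norm2 (r * k) w)).
  - apply Rmult_le_compat_l; [apply pow2_ge_0|].
    apply (ccontract_bound d r k e (fun a => col U (f a)) w HT), unitary_select; assumption.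
  - right; rewrite Hs, mult_INR; field; lra.
Qed.

(** The bound on [r] directions controls all [d] of them, also when [r] does not divide [d]: entries
    above [T / r] sum to at most [T], hence to half the norm, and the others to at most [d T / r],
    the other half. It says that [sum_i A_i^T A_i] is at most [1]. *)
Lemma weight_total_le d r k e s w :
  (0 < r)%nat -> (r <= d)%nat -> (0 < k)%nat -> good_scale d k s -> tensor_bound d r k e ->
  rsum d (fun a => weight d k (r * k) e s (col idm a) w) <= norm2 (r * k) w.
Proof.
  intros Hr Hrd Hk Hs HT.
  assert (Hr1 : 1 <= INR r) by (apply (le_INR 1); lia).
  assert (Hd1 : INR r <= INR d) by (apply le_INR; lia).
  set (y := fun a => weight d k (r * k) e s (col idm a) w).
  set (T := INR r / (2 * INR d) * norm2 (r * k) w).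
  pose proof (norm2_nonneg (r * k) w) as Hw.
  destruct (large_entries_split d r y T Hr Hrd) as (B & HB & HnB).
  - intros; apply weight_nonneg.
  - intros f Hf Hinj; apply weight_select_le; auto; [lia|apply unitary_idm].
  - apply Rle_trans with (rsum d (fun a => (if B a then y a else 0) + T / INR r)).
    + apply rsum_le; intros a Ha; specialize (HnB a Ha); fold (y a).
      assert (0 <= T / INR r).
      { unfold T; replace (INR r / (2 * INR d) * norm2 (r * k) w / INR r) with (/ (2 * INR d) * norm2 (r * k) w)
          by (field; lra).
        apply Rmult_le_pos; [left; apply Rinv_0_lt_compat; lra|assumption]. }
      destruct (B a); lra.
    + rewrite rsum_plus, rsum_const.
      replace (INR d * (T / INR r)) with (norm2 (r * k) w / 2) by (unfold T; field; lra).
      assert (T <= norm2 (r * k) w / 2); [|lra].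
      unfold T; assert (INR r / (2 * INR d) <= 1 / 2); [|nra].
      apply Rmult_le_reg_r with (2 * INR d); [lra|].
      replace (INR r / (2 * INR d) * (2 * INR d)) with (INR r) by (field; lra); lra.
Qed.

(* [1 - V^* V], where [V] stacks the blocks [amp i]. *)
Definition defect (d k n : nat) (e : nat -> R) (s : R) : Mat := fun l m =>
  Csub (idm l m) (csum (k * d) (fun q => Cmul (amp k n e s (q / d) (q mod d) l)%nat
    (Cmul (RtoC 1) (Cconj (amp k n e s (q / d) (q mod d) m)%nat)))).

Lemma defect_psd d r k e s :
  (0 < r)%nat -> (r <= d)%nat -> (0 < k)%nat -> good_scale d k s -> tensor_bound d r k e ->
  psd (r * k) (defect d k (r * k) e s).
Proof.
  intros Hr Hrd Hk Hs HT; set (n := (r * k)%nat) in *; split.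
  - intros l m _ _; unfold adj, defect, Csub; rewrite Cconj_add, Cconj_opp, csum_conj.
    f_equal; [|f_equal].
    + unfold idm; rewrite Nat.eqb_sym; destruct (Nat.eqb m l); Cext; ring.
    + apply csum_ext; intros q _; rewrite !Cconj_mul, Cconj_conj, Cconj_RtoC; ring.
  - intros f; unfold defect; rewrite quad_sub, quad_idm.
    rewrite (quad_rank_one_sum n (k * d) (fun _ => 1) (fun q l => amp k n e s (q / d)%nat (q mod d)%nat l)).
    simpl; rewrite rsum_flatten, rsum_exchange.
    pose proof (weight_total_le d r k e s f Hr Hrd Hk Hs HT) as B; fold n in B.
    apply Rle_trans with (norm2 n f - rsum d (fun a => weight d k n e s (col idm a) f)); [lra|].
    right; unfold Rminus; f_equal; f_equal; apply rsum_ext; intros a Ha; unfold weight.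
    rewrite <- rsum_scal; apply rsum_ext; intros i Hi; destruct (divmod_add d i a Ha) as [-> ->].
    rewrite Rmult_1_l; replace (s ^ 2) with (Cnorm2 (RtoC s)) by (rewrite Cnorm2_RtoC; ring).
    rewrite <- Cnorm2_mul; f_equal; unfold ccontract, inner.
    rewrite (csum_ext d _ (fun b => if Nat.eqb b a
       then csum n (fun l => Cmul (RtoC (e ((b * k + i) * n + l)%nat)) (f l)) else C0)).
    + rewrite csum_delta with (f := fun b => csum n (fun l => Cmul (RtoC (e ((b * k + i) * n + l)%nat)) (f l)))
        by assumption.
      rewrite <- csum_mul_l; apply csum_ext; intros l _; unfold amp; rewrite Cconj_RtoC, RtoC_mul; ring.
    + intros b _; unfold col, idm; destruct (Nat.eqb b a).
      * apply csum_ext; intros; rewrite Cconj_1; ring.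
      * apply csum_zero; intros; rewrite Cconj_0; ring.
Qed.

(* The first [k] Kraus operators are the random ones; the others send the missing trace to the maximally
   mixed state. *)
Definition filled_kraus (d k n : nat) (e : nat -> R) (s : R) (g : nat -> Vec) : nat -> Mat := fun q a l =>
  if Nat.ltb q k then amp k n e s q a l
  else if Nat.eqb a ((q - k) / n) then Cmul (RtoC (/ sqrt (INR d))) (g ((q - k) mod n)%nat l) else C0.


Lemma filled_kraus_low d k n e s g q a l : (q < k)%nat -> filled_kraus d k n e s g q a l = amp k n e s q a l.
Proof. intros H; unfold filled_kraus; destruct (Nat.ltb_spec q k); [reflexivity|lia]. Qed.

Lemma filled_kraus_high d k n e s g b j a l : (j < n)%nat ->
  filled_kraus d k n e s g (k + (b * n + j)) a l
  = if Nat.eqb a b then Cmul (RtoC (/ sqrt (INR d))) (g j l) else C0.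
Proof.
  intros H; unfold filled_kraus; destruct (Nat.ltb_spec (k + (b * n + j)) k); [lia|].
  replace (k + (b * n + j) - k)%nat with (b * n + j)%nat by lia.
  destruct (divmod_add n b j H) as [-> ->]; reflexivity.
Qed.

Lemma inv_sqrt_sq x : 0 < x -> / sqrt x * / sqrt x = / x.
Proof. intros Hx; rewrite <- Rinv_mult, sqrt_sqrt; lra. Qed.

Lemma filled_kraus_complete d k n e s g :
  (0 < d)%nat ->
  (forall l m, (l < n)%nat -> (m < n)%nat ->
     defect d k n e s l m = csum n (fun q => Cmul (g q l) (Cconj (g q m)))) ->
  kraus_complete (k + d * n) n d (filled_kraus d k n e s g).
Proof.
  intros Hd Hg l m Hl Hm; rewrite csum_app.
  assert (Hd1 : 0 < INR d) by (apply lt_0_INR; assumption).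
  assert (E1 : csum (d * n) (fun j => csum d (fun a =>
     Cmul (filled_kraus d k n e s g (k + j) a l) (Cconj (filled_kraus d k n e s g (k + j) a m))))
     = defect d k n e s l m).
  { rewrite csum_flatten.
    rewrite (csum_ext d _ (fun _ => Cmul (RtoC (/ INR d)) (defect d k n e s l m))).
    - rewrite csum_mul_r, csum_RtoC, rsum_const, Rinv_r by lra; Cext; ring.
    - intros b Hb; rewrite Hg, <- csum_mul_l by assumption; apply csum_ext; intros j Hj.
      rewrite (csum_ext d _ (fun a => if Nat.eqb a b then Cmul (RtoC (/ INR d)) (Cmul (g j l) (Cconj (g j m))) else C0)).
      + apply csum_delta with (f := fun _ => Cmul (RtoC (/ INR d)) (Cmul (g j l) (Cconj (g j m)))); assumption.
      + intros a _; rewrite !filled_kraus_high by assumption; destruct (Nat.eqb a b); [|ring].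
        rewrite Cconj_mul, Cconj_RtoC, <- (inv_sqrt_sq (INR d)), RtoC_mul by assumption; ring. }
  set (S := csum k (fun i => csum d (fun a => Cmul (amp k n e s i a l) (Cconj (amp k n e s i a m))))).
  assert (E2 : defect d k n e s l m = Csub (idm l m) S).
  { unfold defect; rewrite csum_flatten; f_equal; apply csum_ext; intros i _; apply csum_ext; intros a Ha.
    destruct (divmod_add d i a Ha) as [-> ->]; change (RtoC 1) with C1; ring. }
  rewrite E1, E2; transitivity (Cadd S (Csub (idm l m) S)); [f_equal|ring].
  apply csum_ext; intros i Hi; apply csum_ext; intros a _; rewrite !filled_kraus_low by assumption; reflexivity.
Qed.

(** The filling operators add the same amount to every unit vector [v]: this is the flat part
    [tau / d] of [flattened_power_sum]. *)
Lemma filled_kraus_quad d k n e s g rho v :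
  (0 < d)%nat ->
  fst (quad d (kraus (k + d * n) n (filled_kraus d k n e s g) rho) v)
  = rsum k (fun i => fst (quad n rho (adj_apply d (amp k n e s i) v)))
    + norm2 d v * (rsum n (fun j => fst (quad n rho (fun m => Cconj (g j m)))) / INR d).
Proof.
  intros Hd; assert (Hd1 : 0 < INR d) by (apply lt_0_INR; assumption).
  rewrite kraus_quad, csum_fst, rsum_app; f_equal.
  - apply rsum_ext; intros i Hi; f_equal; apply quad_ext; [intros ? ? ? ?; reflexivity|].
    intros m _; apply csum_ext; intros b _; rewrite filled_kraus_low by assumption; reflexivity.
  - rewrite rsum_flatten; unfold norm2; rewrite <- rsum_scal_r; apply rsum_ext; intros b Hb.
    unfold Rdiv; rewrite <- rsum_scal_r, <- rsum_scal; apply rsum_ext; intros j Hj.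
    rewrite (quad_ext n rho rho _ (fun m => Cmul (Cmul (RtoC (/ sqrt (INR d))) (v b)) (Cconj (g j m)))).
    + rewrite quad_scal, Cnorm2_mul, Cnorm2_RtoC, inv_sqrt_sq by assumption; simpl; ring.
    + intros ? ? ? ?; reflexivity.
    + intros m _; unfold adj_apply.
      rewrite (csum_ext d _ (fun a => if Nat.eqb a b then Cmul (Cmul (RtoC (/ sqrt (INR d))) (v a)) (Cconj (g j m)) else C0)).
      * apply csum_delta with (f := fun a => Cmul (Cmul (RtoC (/ sqrt (INR d))) (v a)) (Cconj (g j m))); assumption.
      * intros a _; rewrite filled_kraus_high by assumption; destruct (Nat.eqb a b).
        -- rewrite Cconj_mul, Cconj_RtoC; ring.
        -- rewrite Cconj_0; ring.
Qed.

Lemma rsum_quad_amp n k d e s rho U lam v :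
  (forall x, fst (quad n rho x) = rsum n (fun q => lam q * Cnorm2 (inner n (col U q) x))) ->
  rsum k (fun i => fst (quad n rho (adj_apply d (amp k n e s i) v)))
  = rsum n (fun q => lam q * weight d k n e s v (col U q)).
Proof.
  intros HQ; rewrite (rsum_ext k _ (fun i => rsum n (fun q => lam q *
     Cnorm2 (inner n (col U q) (adj_apply d (amp k n e s i) v))))) by (intros; apply HQ).
  rewrite rsum_exchange; apply rsum_ext; intros q _; rewrite rsum_scal; f_equal; unfold weight.
  rewrite <- rsum_scal; apply rsum_ext; intros i _.
  rewrite inner_amp, Cnorm2_mul, Cnorm2_conj, Cnorm2_RtoC; ring.
Qed.

Lemma density_eigvals_sum n rho : density n rho -> rsum n (eigvals n rho) = 1.
Proof.
  intros [HP HT]; rewrite (trace_spectral n rho _ (eigvals_spectral n rho (proj1 HP))) in HT.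
  apply (f_equal fst) in HT; exact HT.
Qed.

(** The weight bound is used at the eigenvectors of the output, whatever they are, and averaged over
    the eigenvectors of [rho]. Mixed inputs are covered because the maximal norm ranges over all
    density matrices. *)
Lemma filled_kraus_trpow_le d r k e s g rho p :
  1 < p -> (0 < r)%nat -> (r <= d)%nat -> (0 < k)%nat -> good_scale d k s -> tensor_bound d r k e ->
  let n := (r * k)%nat in
  kraus_complete (k + d * n) n d (filled_kraus d k n e s g) -> density n rho ->
  trpow d p (kraus (k + d * n) n (filled_kraus d k n e s g) rho)
  <= rpow (2 / INR d) (p - 1) + rpow (2 * INR r / INR d) p.
Proof.
  intros Hp Hr Hrd Hk Hs HT n HK Hrho.
  assert (Hd : (0 < d)%nat) by lia.
  assert (Hd1 : 0 < INR d) by (apply lt_0_INR; assumption).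
  set (sigma := kraus _ _ _ rho).
  assert (Hsigma : density d sigma) by (apply kraus_density; assumption).
  destruct (psd_eigvals d sigma (proj1 Hsigma)) as (U & HU & _ & HE & _).
  destruct (psd_eigvals n rho (proj1 Hrho)) as (W & HW & HQ & _ & H0).
  set (tau := rsum n (fun j => fst (quad n rho (fun m => Cconj (g j m))))).
  set (y := fun q => rsum k (fun i => fst (quad n rho (adj_apply d (amp k n e s i) (col U q))))).
  assert (Hy : forall q, (q < d)%nat -> 0 <= y q).
  { intros q _; apply rsum_nonneg; intros; apply Hrho. }
  assert (Htau : 0 <= tau) by (apply rsum_nonneg; intros; apply Hrho).
  assert (Hlam : forall q, (q < d)%nat -> eigvals d sigma q = y q + tau / INR d).
  { intros q Hq; rewrite HE by assumption; unfold sigma; rewrite filled_kraus_quad by assumption.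
    rewrite unitary_norm2 by assumption; fold tau (y q); ring. }
  pose proof (density_eigvals_sum d sigma Hsigma) as Hsum.
  assert (Htau1 : tau <= 1).
  { rewrite (rsum_ext d _ (fun q => y q + tau / INR d) Hlam), rsum_plus, rsum_const in Hsum.
    replace (INR d * (tau / INR d)) with tau in Hsum by (field; lra).
    pose proof (rsum_nonneg d y Hy); lra. }
  apply (flattened_power_sum d r y (eigvals d sigma) tau p); auto.
  intros f Hf Hinj.
  rewrite (rsum_ext r _ (fun a => rsum n (fun q => eigvals n rho q * weight d k n e s (col U (f a)) (col W q))))
    by (intros a _; apply rsum_quad_amp, HQ).
  rewrite rsum_exchange.
  apply Rle_trans with (rsum n (fun q => eigvals n rho q * (INR r / (2 * INR d)))).
  - apply rsum_le; intros q Hq; rewrite rsum_scal; apply Rmult_le_compat_l; [auto|].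
    rewrite <- (Rmult_1_r (INR r / (2 * INR d))), <- (unitary_norm2 n W q HW Hq).
    apply weight_select_le; assumption.
  - rewrite rsum_scal_r, density_eigvals_sum by assumption; lra.
Qed.

(** * The maximally entangled input *)

Definition max_ent (n : nat) : Vec := fun q =>
  if Nat.eqb (q / n) (q mod n) then RtoC (/ sqrt (INR n)) else C0.

Lemma max_ent_unit n : (0 < n)%nat -> unit_vec (n * n) (max_ent n).
Proof.
  intros Hn; assert (Hn1 : 0 < INR n) by (apply lt_0_INR; assumption).
  unfold unit_vec; rewrite rsum_flatten.
  rewrite (rsum_ext n _ (fun _ => / INR n)); [rewrite rsum_const; field; lra|].
  intros i Hi; rewrite (rsum_ext n _ (fun j => if Nat.eqb j i then / INR n else 0)).
  - apply rsum_delta with (f := fun _ => / INR n); assumption.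
  - intros j Hj; unfold max_ent; destruct (divmod_add n i j Hj) as [-> ->]; rewrite Nat.eqb_sym.
    destruct (Nat.eqb j i); [rewrite Cnorm2_RtoC; apply inv_sqrt_sq; assumption|].
    unfold Cnorm2; simpl; ring.
Qed.

Lemma csum_max_ent n (F : nat -> C) : (0 < n)%nat ->
  csum (n * n) (fun q => Cmul (F q) (max_ent n q)) = Cmul (RtoC (/ sqrt (INR n))) (csum n (fun l => F (l * n + l)%nat)).
Proof.
  intros Hn; rewrite csum_flatten, <- csum_mul_l; apply csum_ext; intros i Hi.
  rewrite (csum_ext n _ (fun j => if Nat.eqb j i then Cmul (RtoC (/ sqrt (INR n))) (F (i * n + j)%nat) else C0)).
  - apply csum_delta with (f := fun j => Cmul (RtoC (/ sqrt (INR n))) (F (i * n + j)%nat)); assumption.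
  - intros j Hj; unfold max_ent; destruct (divmod_add n i j Hj) as [-> ->]; rewrite Nat.eqb_sym.
    destruct (Nat.eqb j i); ring.
Qed.

Lemma quad_pure n w v : fst (quad n (pure w) v) = Cnorm2 (inner n w v).
Proof.
  rewrite (quad_ext n (pure w) (fun i j => csum 1 (fun _ => Cmul (w i) (Cmul (RtoC 1) (Cconj (w j))))) v v).
  - rewrite (quad_rank_one_sum n 1 (fun _ => 1) (fun _ => w) v); simpl; ring.
  - intros i j _ _; unfold pure; simpl; change (RtoC 1) with C1; ring.
  - reflexivity.
Qed.

(** For a real matrix [A] with entries of square [c], the matrix element of [A] tensor [A] between
    the two maximally entangled vectors is [Tr (A A^T) / sqrt (n d) = sqrt (n d) c], whatever the
    signs. Only the pairs [(i, i)] with [i < k] are kept; all other Kraus pairs contribute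
    nonnegative terms. *)
Lemma tensor_overlap M k n d K c :
  (0 < n)%nat -> (0 < d)%nat -> (k <= M)%nat ->
  (forall i a l, (i < k)%nat -> (a < d)%nat -> (l < n)%nat -> exists x, K i a l = RtoC x /\ x * x = c) ->
  INR k * INR n * INR d * c ^ 2
  <= fst (quad (d * d) (kraus (M * M) (n * n) (kraus_kron M n d K K) (pure (max_ent n))) (max_ent d)).
Proof.
  intros Hn Hd HkM HK.
  assert (Hn1 : 0 < INR n) by (apply lt_0_INR; assumption).
  assert (Hd1 : 0 < INR d) by (apply lt_0_INR; assumption).
  rewrite kraus_quad, csum_fst.
  set (t := fun q => fst (quad (n * n) (pure (max_ent n)) (adj_apply (d * d) (kraus_kron M n d K K q) (max_ent d)))).
  assert (Ht : forall q, 0 <= t q) by (intros; unfold t; rewrite quad_pure; apply Cnorm2_nonneg).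
  change (INR k * INR n * INR d * c ^ 2 <= rsum (M * M) t).
  apply Rle_trans with (rsum M (fun i => t (i * M + i)%nat)).
  - replace M with (k + (M - k))%nat at 1 by lia; rewrite rsum_app.
    assert (0 <= rsum (M - k) (fun i => t ((k + i) * M + (k + i))%nat)) by (apply rsum_nonneg; auto).
    assert (rsum k (fun i => t (i * M + i)%nat) = INR k * (INR n * INR d * c ^ 2)); [|lra].
    rewrite <- rsum_const; apply rsum_ext; intros i Hi; unfold t; rewrite quad_pure.
    assert (E : inner (n * n) (max_ent n) (adj_apply (d * d) (kraus_kron M n d K K (i * M + i)) (max_ent d))
       = Cmul (RtoC (/ sqrt (INR n) * / sqrt (INR d))) (RtoC (INR n * (INR d * c)))).
    { rewrite <- inner_conj; unfold inner.
      rewrite csum_max_ent, Cconj_mul, csum_conj, Cconj_RtoC, RtoC_mul by assumption.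
      rewrite <- rsum_const, <- csum_RtoC.
      rewrite (csum_ext n _ (fun _ => Cmul (RtoC (/ sqrt (INR d))) (RtoC (INR d * c)))); [rewrite csum_mul_l; ring|].
      intros l Hl; rewrite Cconj_conj; unfold adj_apply; rewrite csum_max_ent by assumption; f_equal.
      rewrite <- rsum_const, <- csum_RtoC; apply csum_ext; intros a Ha; unfold kraus_kron.
      destruct (divmod_add M i i) as [-> ->]; [lia|].
      destruct (divmod_add n l l Hl) as [-> ->]; destruct (divmod_add d a a Ha) as [-> ->].
      destruct (HK i a l Hi Ha Hl) as (x & -> & <-).
      rewrite <- RtoC_mul, Cconj_RtoC; reflexivity. }
    rewrite E, Cnorm2_mul, !Cnorm2_RtoC.
    replace (/ sqrt (INR n) * / sqrt (INR d) * (/ sqrt (INR n) * / sqrt (INR d)))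
      with ((/ sqrt (INR n) * / sqrt (INR n)) * (/ sqrt (INR d) * / sqrt (INR d))) by ring.
    rewrite !inv_sqrt_sq by assumption; field; lra.
  - rewrite rsum_flatten; apply rsum_le; intros i Hi.
    apply (rsum_term_le M (fun j => t (i * M + j)%nat)); auto.
Qed.

(** * Choice of the parameters and conclusion *)

Lemma channel_exists d r :
  (0 < r)%nat -> (r <= d)%nat ->
  exists k M K, let n := (r * k)%nat in
    (0 < k)%nat /\ kraus_complete M n d K /\
    (forall p rho, 1 < p -> density n rho ->
       trpow d p (kraus M n K rho) <= rpow (2 / INR d) (p - 1) + rpow (2 * INR r / INR d) p) /\
    INR r / INR d * / 123008 ^ 2
    <= fst (quad (d * d) (kraus (M * M) (n * n) (kraus_kron M n d K K) (pure (max_ent n))) (max_ent d)).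
Proof.
  (* The final bounds do not involve [k], so it may exceed [(8 d + 1) ^ d] itself, where its
     exponential would suffice. *)
  intros Hr Hrd; destruct (INR_unbounded (INR (8 * d + 1) ^ d)) as [k Hk].
  assert (Hk0 : 0 < INR k).
  { eapply Rle_lt_trans; [|exact Hk]; apply pow_le, pos_INR. }
  assert (Hk1 : (0 < k)%nat) by (apply INR_lt; assumption).
  assert (Hd1 : 0 < INR d) by (apply lt_0_INR; lia).
  assert (Hkd : 0 < 123008 * (INR k * INR d)) by (repeat apply Rmult_lt_0_compat; lra).
  destruct (tensor_signs_sq d r k Hr Hrd Hk1) as (e & He & HT).
  { pose proof (exp_ineq1_le (INR k)); lra. }
  set (s := sqrt (/ (123008 * (INR k * INR d)))).
  assert (Hs : good_scale d k s).
  { unfold good_scale, s; rewrite pow2_sqrt; [reflexivity|left; apply Rinv_0_lt_compat; assumption]. }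
  destruct (psd_factor (r * k) (defect d k (r * k) e s)) as [g Hg]; [apply defect_psd; assumption|].
  set (n := (r * k)%nat) in *.
  assert (HK := filled_kraus_complete d k n e s g ltac:(lia) Hg).
  exists k, (k + d * n)%nat, (filled_kraus d k n e s g); fold n; repeat split; auto.
  - intros p rho Hp Hrho; apply filled_kraus_trpow_le; assumption.
  - eapply Rle_trans; [|apply (tensor_overlap (k + d * n) k n d _ (s ^ 2))]; [|unfold n; nia|lia|lia|].
    (* [k (r k) d s ^ 4]: the factors [k ^ 2] cancel and [r / d] remains. *)
    + rewrite Hs; unfold n; rewrite mult_INR; right; field; lra.
    + intros i a l Hi _ _; exists (s * e ((a * k + i) * n + l)%nat); split.
      * apply filled_kraus_low; assumption.
      * destruct (He ((a * k + i) * n + l)%nat) as [-> | ->]; ring.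
Qed.

Lemma trpow_le_1 n p A : 1 < p -> density n A -> trpow n p A <= 1.
Proof.
  intros Hp HA; destruct (psd_eigvals n A (proj1 HA)) as (_ & _ & _ & _ & H0).
  rewrite <- (density_eigvals_sum n A HA); apply rsum_le; intros k Hk.
  rewrite <- (Rmult_1_r (eigvals n A k)) at 2.
  replace 1 with (rpow 1 (p - 1)) by (rewrite rpow_pos by lra; unfold Rpower; rewrite ln_1, Rmult_0_r; apply exp_0).
  apply rpow_le_linear; [assumption|split; [auto|]].
  rewrite <- (density_eigvals_sum n A HA); apply (rsum_term_le n (eigvals n A)); auto.
Qed.

Lemma rank_exists (d : nat) x : 1 <= x -> x < INR d ->
  exists r : nat, (0 < r)%nat /\ (r <= d)%nat /\ x <= INR r /\ INR r <= 2 * x.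
Proof.
  intros Hx Hxd; destruct (archimed x) as [H1 H2].
  assert (Hz : (0 < up x)%Z) by (apply lt_IZR; lra).
  assert (Er : INR (Z.to_nat (up x)) = IZR (up x)) by (rewrite INR_IZR_INZ, Z2Nat.id by lia; reflexivity).
  exists (Z.to_nat (up x)); repeat split; [lia| |lra|lra].
  apply Nat.lt_succ_r, INR_lt; rewrite S_INR, Er; lra.
Qed.

(** The bulk gives [2 ^ (p - 1) d ^ (1 - p)]. The exceptional part is at most
    [4 ^ p d ^ (p (1 - p))], smaller than [d ^ (1 - p)] by a factor [d ^ (- (p - 1) ^ 2)] up to a
    constant, so for large [d] it fits in the gap between [2 ^ (p - 1)] and [exp (2 (p - 1))]. The
    loss [2] in the entropy comes from here. *)
Lemma output_bound (d r : nat) p L :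
  1 < p -> 0 < INR d -> L = ln (INR d) -> 0 < INR r -> INR r <= 2 * exp ((2 - p) * L) ->
  exp (p * ln 4 - (p - 1) ^ 2 * L) <= exp (2 * (p - 1)) - exp ((p - 1) * ln 2) ->
  rpow (2 / INR d) (p - 1) + rpow (2 * INR r / INR d) p <= exp (2 * (p - 1) + (1 - p) * L).
Proof.
  intros Hp Hd HL Hr0 Hr Hc.
  assert (ED : INR d = exp L) by (rewrite HL; symmetry; apply exp_ln; assumption).
  assert (H1 : rpow (2 / INR d) (p - 1) = exp ((p - 1) * ln 2) * exp ((1 - p) * L)).
  { rewrite rpow_pos by (apply Rdiv_lt_0_compat; lra); unfold Rpower.
    rewrite ln_quotient, <- HL, <- exp_plus by lra; f_equal; ring. }
  assert (H2 : rpow (2 * INR r / INR d) p <= exp (p * ln 4 - (p - 1) ^ 2 * L) * exp ((1 - p) * L)).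
  { apply Rle_trans with (rpow (4 * exp ((1 - p) * L)) p).
    - apply rpow_le; [lra|]; rewrite ED; apply Rmult_le_reg_r with (exp L); [apply exp_pos|].
      replace (2 * INR r / exp L * exp L) with (2 * INR r) by (field; pose proof (exp_pos L); lra).
      rewrite Rmult_assoc, <- exp_plus; replace ((1 - p) * L + L) with ((2 - p) * L) by ring; lra.
    - pose proof (exp_pos ((1 - p) * L)); rewrite rpow_pos by lra; unfold Rpower.
      rewrite ln_mult, ln_exp, <- exp_plus by lra; right; f_equal; ring. }
  rewrite exp_plus; pose proof (exp_pos ((1 - p) * L)); rewrite H1; nra.
Qed.

Lemma renyi_le_of_quad m p A f q :
  1 < p -> density m A -> norm2 m f <= 1 -> 0 < q -> q <= fst (quad m A f) ->
  renyi m p A <= p / (1 - p) * ln q.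
Proof.
  intros Hp HA Hf Hq Hle; unfold renyi.
  pose proof (rpow_quad_le_trpow m A p f Hp (proj1 HA) Hf) as H.
  assert (Hq' : rpow q p <= trpow m p A) by (eapply Rle_trans; [apply rpow_le; [lra|exact Hle]|exact H]).
  rewrite rpow_pos in Hq' by assumption.
  assert (L : p * ln q <= ln (trpow m p A)).
  { rewrite <- (ln_exp (p * ln q)); fold (Rpower q p).
    destruct Hq' as [Hlt|Heq]; [left; apply ln_increasing; [apply exp_pos|assumption]|rewrite Heq; lra]. }
  assert (/ (1 - p) < 0) by (apply Rinv_lt_0_compat; lra).
  unfold Rdiv; rewrite (Rmult_comm p), Rmult_assoc; nra.
Qed.

Lemma renyi_ge_of_trpow m p A x :
  1 < p -> density m A -> trpow m p A <= exp x -> / (1 - p) * x <= renyi m p A.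
Proof.
  intros Hp HA Hle; unfold renyi; pose proof (trpow_pos m A p HA) as H.
  assert (L : ln (trpow m p A) <= x).
  { rewrite <- (ln_exp x); destruct Hle as [Hlt|Heq]; [left; apply ln_increasing; assumption|rewrite Heq; lra]. }
  assert (/ (1 - p) < 0) by (apply Rinv_lt_0_compat; lra). nra.
Qed.

Theorem theorem1 :
  forall p : R, 1 < p < 2 ->
  exists Cp : R, exists d0 : nat, forall d : nat, (d0 <= d)%nat ->
    exists (n1 n2 : nat) (N1 N2 : Map),
      is_channel n1 d N1 /\ is_channel n2 d N2 /\
      exists h1 h2 h12 : R,
        is_Hmin n1 d N1 p h1 /\
        is_Hmin n2 d N2 p h2 /\
        is_Hmin (n1 * n2) (d * d) (chan_tensor n1 d n2 d N1 N2) p h12 /\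
        h1 >= ln (INR d) - 2 /\
        h2 >= ln (INR d) - 2 /\
        h12 <= p * ln (INR d) + Cp /\
        h1 + h2 - h12 >= (2 - p) * ln (INR d) - Cp - 4 /\
        h1 + h2 - h12 > 0 /\
        exists nu1 nu2 nu12 : R,
          is_nu n1 d N1 p nu1 /\ is_nu n2 d N2 p nu2 /\
          is_nu (n1 * n2) (d * d) (chan_tensor n1 d n2 d N1 N2) p nu12 /\
          nu12 > nu1 * nu2.
Proof.
  intros p [Hp Hp2].
  set (kappa := / 123008 ^ 2).
  assert (Hkappa : 0 < kappa < 1).
  { split; [apply Rinv_0_lt_compat; lra|]; rewrite <- Rinv_1; apply Rinv_lt_contravar; lra. }
  assert (Hlnk : ln kappa < 0) by (rewrite <- ln_1; apply ln_increasing; lra).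
  (* An overlap [q = kappa d ^ (1 - p)] gives the entropy bound [p / (1 - p) ln q = p ln d + Cp]. *)
  set (Cp := p / (1 - p) * ln kappa).
  assert (ECp : (p - 1) * Cp = - (p * ln kappa)) by (unfold Cp; field; lra).
  assert (HCp : 0 < Cp) by nra.
  set (delta := exp (2 * (p - 1)) - exp ((p - 1) * ln 2)).
  assert (Hdelta : 0 < delta).
  { assert (exp ((p - 1) * ln 2) < exp (2 * (p - 1))); [|unfold delta; lra].
    apply exp_increasing; pose proof (ln_le_sub_1 2); nra. }
  (* [X1] is the threshold on [ln d] beyond which the exceptional eigenvalues fit into the gap
     [delta], and [X2] the one beyond which [(2 - p) ln d] exceeds [Cp + 4]. *)
  set (X1 := (p * ln 4 - ln delta) / (p - 1) ^ 2).
  set (X2 := (Cp + 4) / (2 - p)).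
  destruct (INR_unbounded (exp (Rmax X1 X2))) as [d0 Hd0].
  exists Cp, d0; intros d Hd.
  assert (Hdd : exp (Rmax X1 X2) < INR d) by (eapply Rlt_le_trans; [exact Hd0|apply le_INR; assumption]).
  assert (Hd1 : 0 < INR d) by (pose proof (exp_pos (Rmax X1 X2)); lra).
  remember (ln (INR d)) as L eqn:EL.
  assert (HLX : Rmax X1 X2 < L).
  { rewrite EL, <- (ln_exp (Rmax X1 X2)); apply ln_increasing; [apply exp_pos|assumption]. }
  assert (HL2 : Cp + 4 < (2 - p) * L).
  { pose proof (Rmax_r X1 X2); replace (Cp + 4) with ((2 - p) * X2) by (unfold X2; field; lra).
    apply Rmult_lt_compat_l; lra. }
  assert (HL1 : exp (p * ln 4 - (p - 1) ^ 2 * L) <= delta).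
  { rewrite <- (exp_ln delta) by assumption; left; apply exp_increasing.
    assert ((p - 1) ^ 2 * X1 < (p - 1) ^ 2 * L) as HX.
    { apply Rmult_lt_compat_l; [apply pow_lt; lra|]; pose proof (Rmax_l X1 X2); lra. }
    replace ((p - 1) ^ 2 * X1) with (p * ln 4 - ln delta) in HX by (unfold X1; field; lra). lra. }
  assert (HL0 : 0 < L) by nra.
  assert (ED : exp L = INR d) by (rewrite EL; apply exp_ln; assumption).
  (* [d ^ (2 - p)] lies between [1] and [d] since [1 < p < 2], so it can be rounded up to a rank
     [r <= d] at the cost of a factor [2]. *)
  destruct (rank_exists d (exp ((2 - p) * L))) as (r & Hr & Hrd & Hrlo & Hrhi).
  { rewrite <- exp_0; left; apply exp_increasing; nra. }
  { rewrite <- ED; apply exp_increasing; nra. }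
  assert (Hr0 : 0 < INR r) by (apply lt_0_INR; assumption).
  destruct (channel_exists d r Hr Hrd) as (k & M & K & Hk & HK & Hout & Hov).
  set (n := (r * k)%nat) in *.
  assert (Hn : (0 < n)%nat) by (unfold n; nia).
  assert (Hbound : forall rho, density n rho ->
            trpow d p (kraus M n K rho) <= exp (2 * (p - 1) + (1 - p) * L)).
  { intros rho Hrho; eapply Rle_trans; [apply Hout; assumption|].
    apply output_bound; assumption. }
  set (N := kraus M n K) in *.
  set (N12 := chan_tensor n d n d N N).
  assert (Hagree : forall X, agree (d * d) (kraus (M * M) (n * n) (kraus_kron M n d K K) X) (N12 X)).
  { intros X i j Hi Hj; symmetry; apply (chan_tensor_kraus M M n n d d K K X i j Hi Hj). }
  assert (HD : forall rho, density n rho -> density d (N rho)) by (intros; apply kraus_density; assumption).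
  assert (HD12 : forall rho, density (n * n) rho -> density (d * d) (N12 rho)).
  { intros rho Hrho; apply (density_agree _ _ _ (Hagree rho)).
    apply kraus_density; [apply kraus_kron_complete; assumption|assumption]. }
  assert (Hq : exp (ln kappa + (1 - p) * L) <= fst (quad (d * d) (N12 (pure (max_ent n))) (max_ent d))).
  { rewrite <- (quad_ext _ _ _ (max_ent d) (max_ent d) (Hagree (pure (max_ent n)))) by reflexivity.
    eapply Rle_trans; [|exact Hov]; fold kappa.
    rewrite exp_plus, exp_ln, Rmult_comm by lra; apply Rmult_le_compat_r; [lra|].
    apply Rmult_le_reg_r with (INR d); [assumption|].
    replace (INR r / INR d * INR d) with (INR r) by (field; lra).
    rewrite <- ED, <- exp_plus; replace ((1 - p) * L + L) with ((2 - p) * L) by ring; assumption. }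
  assert (Hent : norm2 (d * d) (max_ent d) <= 1) by (right; apply max_ent_unit; lia).
  assert (Hin : density (n * n) (pure (max_ent n))) by (apply pure_density, max_ent_unit; assumption).
  destruct (is_Hmin_exists n d N p Hp Hn) as [h Hh].
  { apply kraus_output_continuous. }
  { intros v Hv; apply HD, pure_density; assumption. }
  { intros v w Hvw; apply kraus_linear; intros i j Hi Hj; unfold pure; rewrite !Hvw by assumption; reflexivity. }
  destruct (is_Hmin_exists (n * n) (d * d) N12 p Hp) as [h12 Hh12].
  { nia. }
  { intros x v Hx a b Ha Hb; rewrite <- (Hagree (pure v) a b Ha Hb).
    apply Ccv_ext with (fun j => kraus (M * M) (n * n) (kraus_kron M n d K K) (pure (x j)) a b);
      [intros j; apply Hagree; assumption|].
    apply (kraus_output_continuous (M * M) (n * n) (d * d)); assumption. }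
  { intros v Hv; apply HD12, pure_density; assumption. }
  { intros v w Hvw i j Hi Hj; rewrite <- !Hagree by assumption.
    apply (kraus_linear (M * M) (n * n) (d * d)); [|assumption|assumption].
    intros l m Hl Hm; unfold pure; rewrite !Hvw by assumption; reflexivity. }
  assert (Hlow : h >= L - 2).
  { destruct Hh as [(v & Hv & <-) _]; apply Rle_ge.
    apply Rle_trans with (/ (1 - p) * (2 * (p - 1) + (1 - p) * L)); [right; field; lra|].
    apply renyi_ge_of_trpow; [assumption|apply HD, pure_density; assumption|].
    apply Hbound, pure_density; assumption. }
  assert (Hhigh : h12 <= p * L + Cp).
  { eapply Rle_trans; [apply (proj2 Hh12 (max_ent n)), max_ent_unit; assumption|].
    apply Rle_trans with (p / (1 - p) * ln (exp (ln kappa + (1 - p) * L))).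
    - apply renyi_le_of_quad with (max_ent d); auto; apply exp_pos.
    - rewrite ln_exp; unfold Cp; right; field; lra. }
  exists n, n, N, N; split; [apply kraus_channel; assumption|split; [apply kraus_channel; assumption|]].
  exists h, h, h12; repeat (split; [assumption|]); repeat (split; [lra|]).
  destruct (is_nu_exists n d N p _ Hp Hn HD Hbound) as (nu & Hnu & Hnule).
  (* The trivial bound [1] on trace powers makes the supremum exist; the estimate from below comes
     from the overlap. *)
  destruct (is_nu_exists (n * n) (d * d) N12 p 1 Hp) as (nu12 & Hnu12 & _).
  { nia. }
  { assumption. }
  { intros; apply trpow_le_1; auto. }
  exists nu, nu, nu12; repeat (split; [assumption|]).
  assert (Hnu0 : 0 <= nu).
  { destruct (unit_vec_exists n Hn) as [v Hv].
    apply Rle_trans with (schatten d p (N (pure v))); [left; apply exp_pos|].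
    apply Hnu; exists (pure v); split; [apply pure_density; assumption|reflexivity]. }
  unfold Rpower in Hnule; rewrite ln_exp in Hnule.
  set (y := / p * (2 * (p - 1) + (1 - p) * L)) in *.
  apply Rlt_le_trans with (exp (ln kappa + (1 - p) * L)).
  - apply Rle_lt_trans with (exp y * exp y); [apply Rmult_le_compat; assumption|].
    rewrite <- exp_plus; apply exp_increasing.
    apply Rmult_lt_reg_l with p; [lra|].
    replace (p * (y + y)) with (2 * (2 * (p - 1) + (1 - p) * L)) by (unfold y; field; lra).
    (* After multiplication by [p], the comparison of [nu * nu] with the overlap becomes the entropy
       inequality [Cp + 4 < (2 - p) ln d] times [p - 1], so the same threshold serves. *)
    assert ((p - 1) * (Cp + 4) < (p - 1) * ((2 - p) * L)) by (apply Rmult_lt_compat_l; lra).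
    replace (p * (ln kappa + (1 - p) * L)) with (- ((p - 1) * Cp) + p * ((1 - p) * L)) by (rewrite ECp; ring).
    lra.
  - apply Rle_trans with (schatten (d * d) p (N12 (pure (max_ent n)))).
    + eapply Rle_trans; [exact Hq|]; apply schatten_ge_quad; auto.
      eapply Rlt_le_trans; [apply exp_pos|exact Hq].
    + apply Hnu12; exists (pure (max_ent n)); auto.
Qed.
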